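(* Let $K$ be a number field and $S$ a finite set of places of $K$ containing all archimedean places. For each $v\in S$ let $A_v$ be an $m\times n$ matrix over $K_v$, with $i$-th row $A_v^{(i)}$ ($i=1,\dots,m$). For each $v\in S$ let $\varepsilon_v^{(1)},\dots,\varepsilon_v^{(m)},\delta_v^{(1)},\dots,\delta_v^{(n)}\in K_v\setminus\{0\}$ be given such that $|\varepsilon_v^{(i)}|_v<1$ for all $i=1,\dots,m$, $|\delta_v^{(j)}|_v\ge 1$ for all $j=1,\dots,n$, and $$\prod_{v\in S}|\varepsilon_v^{(1)}|_v\cdots|\varepsilon_v^{(m)}|_v\,|\delta_v^{(1)}|_v\cdots|\delta_v^{(n)}|_v=(\mathrm{const}_K)^{m+n}.$$ Then there exist $\vec x=(x_1,\dots,x_n)\in\mathcal O_S^n\setminus\{\vec 0\}$ and $\vec y=(y_1,\dots,y_m)\in\mathcal O_S^m$ such that for all $v\in S$, $$\|A_v^{(i)}\vec x-y_i\|_v\le\|\varepsilon_v^{(i)}\|_v\ (i=1,\dots,m),\qquad \|x_j\|_v\le\|\delta_v^{(j)}\|_v\ (j=1,\dots,n).$$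
   Context: $K$ has degree $d$ over $\mathbb Q$; for a place $v$ of $K$, $K_v$ is the completion and $d_v=[K_v:\mathbb Q_v]$ the local degree (with $\mathbb Q_v=\mathbb R$ or $\mathbb Q_p$). The absolute value $\|\cdot\|_v$ on $K_v$ is normalized so that $\|p\|_v=p^{-1}$ if $v$ lies over the prime $p$, and $\|x\|_v=|x|$ (usual absolute value on $\mathbb R$ or $\mathbb C$) if $v$ is archimedean; and $|x|_v:=\|x\|_v^{d_v}$. The ring of $S$-integers is $\mathcal O_S=\{x\in K:|x|_v\le 1\text{ for all places }v\notin S\}$, viewed inside each $K_v$ via the natural embedding. $\mathrm{const}_K=(2/\pi)^s|D_K|^{1/2}$, where $s$ is the number of complex places of $K$ and $D_K$ is the discriminant of $K$. *)

(* Defs.v *)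
From HB Require Import structures.
From mathcomp Require Import all_boot all_order all_algebra all_field.
From mathcomp Require Import boolp reals trigo.
Set Implicit Arguments. Unset Strict Implicit. Unset Printing Implicit Defensive.
Import Order.TTheory GRing.Theory Num.Theory.
Local Open Scope ring_scope.

Section NF.
Variable R : realType.

Definition is_absval (F : nzRingType) (f : F -> R) : Prop :=
  (forall x, 0 <= f x) /\ (forall x, f x = 0 <-> x = 0) /\
  (forall x y, f (x * y) = f x * f y) /\ (forall x y, f (x + y) <= f x + f y).

Definition padic_abs (p : nat) (q : rat) : R :=
  if q == 0 then 0
  else (p%:R ^+ logn p (absz (denq q))) / (p%:R ^+ logn p (absz (numq q))).

(* Places of a number field K, each represented by its normalised absolute
   value ||.||_v : K -> R (restriction to Q is the usual absolute value, or the
   p-adic one normalised by ||p|| = 1/p). *)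
Definition is_arch_place (K : fieldExtType rat) (f : K -> R) : Prop :=
  is_absval f /\ forall q : rat, f (ratr q) = `|ratr q : R|.

Definition is_place (K : fieldExtType rat) (f : K -> R) : Prop :=
  is_absval f /\
  ((forall q : rat, f (ratr q) = `|ratr q : R|) \/
   exists p : nat, prime p /\ forall q : rat, f (ratr q) = padic_abs p q).

Definition is_completion (K : fieldExtType rat) (f : K -> R) (Kv : fieldType)
    (iota : K -> Kv) (nv : Kv -> R) : Prop :=
  is_absval nv /\ (forall x, nv (iota x) = f x) /\
  (forall u : nat -> Kv,
     (forall e, 0 < e -> exists N, forall a b, (N <= a)%N -> (N <= b)%N ->
        nv (u a - u b) < e) ->
     exists l, forall e, 0 < e -> exists N, forall a, (N <= a)%N -> nv (u a - l) < e) /\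
  (forall y e, 0 < e -> exists x, nv (y - iota x) < e).

Definition in_Qv (Kv : fieldType) (nv : Kv -> R) (y : Kv) : Prop :=
  forall e, 0 < e -> exists q : rat, nv (y - ratr q) < e.

Definition local_degree (Kv : fieldType) (nv : Kv -> R) (d : nat) : Prop :=
  exists b : 'I_d -> Kv,
    (forall y, exists c : 'I_d -> Kv,
        (forall j, in_Qv nv (c j)) /\ y = \sum_j c j * b j) /\
    (forall c : 'I_d -> Kv, (forall j, in_Qv nv (c j)) ->
        \sum_j c j * b j = 0 -> forall j, c j = 0).

End NF.

Definition is_integral (K : fieldExtType rat) (x : K) : Prop :=
  exists p : {poly int}, p \is monic /\ root (map_poly (fun z : int => z%:~R) p) x.

Definition ftrace (K : fieldExtType rat) (x : K) : rat :=
  \sum_(k < \dim {:K}) coord (vbasis {:K}) k (x * tnth (vbasis {:K}) k).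

Definition is_discriminant (K : fieldExtType rat) (D : rat) : Prop :=
  exists w : 'I_(\dim {:K}) -> K,
    (forall j, is_integral (w j)) /\
    (forall x, is_integral x -> exists c : 'I_(\dim {:K}) -> int,
        x = \sum_j (c j)%:~R * w j) /\
    D = \det (\matrix_(j, k) ftrace (w j * w k)).

Definition in_OS (R : realType) (K : fieldExtType rat) (I : Type) (v : I -> K -> R)
    (x : K) : Prop :=
  forall f : K -> R, is_place f -> (forall i, v i <> f) -> f x <= 1.

Definition constK (R : realType) (s : nat) (D : rat) : R :=
  (2 / pi) ^+ s * Num.sqrt `|ratr D : R|.

(* Main.v *)
(** The proof is a pigeonhole argument over O_K^(n+m), with O_K = Z^d through an
    integral basis.  At the finite places of S the matrices and radii are replaced by
    elements of K, and after multiplication by a large integer q the conditions there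
    become congruences, which define finitely many labels: the local degree is the size
    of a maximal family independent modulo p in the local integers.  At the archimedean
    places the completions are identified with R or C, and the body is cut out by
    intervals and discs.  Its lattice points are counted directly, reducing modulo an
    integer approximation of the lattice through its Smith normal form; a limit then
    gives Minkowski's theorem for the closed body, at the critical volume |D_K|^(1/2).
    An element y of K with |y|_f <= 1 for all finite f is integral: otherwise a
    maximal subring containing 1/y but not y is a valuation ring, whose place has
    |y| > 1.  This makes O_K the lattice cut out by the finite places, and shows that
    y = 0 when x = 0, since y is then integral and all its conjugates are less than 1. *)
Require Import Defs.
From HB Require Import structures.
From mathcomp Require Import all_boot all_order all_algebra all_field.
From mathcomp Require Import boolp classical_sets reals topology normedtype sequences derive realfun exp trigo.
From mathcomp Require Import complex ring lra zify.
Import Order.TTheory GRing.Theory Num.Theory numFieldNormedType.Exports.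
Local Open Scope classical_set_scope.
Local Open Scope ring_scope.

Set Implicit Arguments. Unset Strict Implicit. Unset Printing Implicit Defensive.

(** Two points of a disc of radius r/2 differ by at most r, so a complex place contributes pi r^2/4
    to the volume and a real place r. In the coordinates Re, Im the lattice O_K has covolume |det B|
    with |D_K| = 4^s (det B)^2, and (2/pi)^s |D_K|^(1/2) = (4/pi)^s |det B| lets the volume just
    reach what the pigeonhole needs, without exceeding it. The missing strictness is bought by
    enlarging all radii by the factor 1 + y; the differences found then lie in one finite set, so
    one of them serves every y > 0. Labels are only ever compared between two points, so what has to
    be found is a bound for their number. It has two sources: the local integers have at most
    |a|^(-r) classes modulo a, where r is the local degree, and the local degrees over one prime add
    up to at most d = [K : Q]. The second bound pays for the denominator q: it costs q^(d(n+m))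
    labels, which are regained at the archimedean places because the radii there are multiplied by q
    as well. *)

(** * Absolute values on a field: separation, weak approximation, ultrametric criterion *)

Section AbsoluteValues.
Variables (R : realType) (K : fieldType).
Implicit Types (f g : K -> R).

Lemma bernoulli_le (C : R) k : 1 < C -> 1 + k%:R * (C - 1) <= C ^+ k.
Proof.
move=> C1; elim: k => [|k IH]; first by rewrite mul0r addr0 expr0.
rewrite exprS -natr1.
have h : 0 <= (k%:R : R) * (C - 1) ^+ 2 by rewrite mulr_ge0 // sqr_ge0.
have h2 : C * (1 + k%:R * (C - 1)) <= C * C ^+ k by rewrite ler_pM2l//; lra.
by apply: le_trans h2; nra.
Qed.

Lemma expr_unbounded (C y : R) : 1 < C -> \forall k \near \oo, y < C ^+ k.
Proof.
move=> C1; exists (Num.bound `|y / (C - 1)|) => //= k /= hk.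
apply: lt_le_trans (bernoulli_le k C1).
have C0 : 0 < C - 1 by lra.
have h : y / (C - 1) < k%:R.
  apply: le_lt_trans (ler_norm _) _.
  apply: lt_le_trans (archi_boundP (normr_ge0 _)) _.
  by rewrite ler_nat.
by move: h; rewrite ltr_pdivrMr//; lra.
Qed.

Lemma expr_small (a y : R) : 0 <= a < 1 -> 0 < y -> \forall k \near \oo, a ^+ k < y.
Proof.
move=> /andP[a0 a1] y0; have [->|an0] := eqVneq a 0.
  by exists 1%N => //= -[|k] //= _; rewrite expr0n.
have ap : 0 < a by rewrite lt0r an0.
have := @expr_unbounded a^-1 y^-1 _; rewrite invf_gt1// => /(_ a1).
apply: filterS => k; rewrite exprVn ltf_pV2 // posrE //.
by rewrite exprn_gt0.
Qed.

Section Basics.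
Variable f : K -> R.
Hypothesis fA : is_absval f.

Lemma absval_ge0 x : 0 <= f x. Proof. by case: fA. Qed.
Lemma absval_eq0 x : (f x == 0) = (x == 0).
Proof. by case: fA => _ [h _]; apply/eqP/eqP => /h. Qed.
Lemma absval0 : f 0 = 0. Proof. by apply/eqP; rewrite absval_eq0. Qed.
Lemma absval_gt0 x : (0 < f x) = (x != 0).
Proof. by rewrite lt0r absval_ge0 andbT absval_eq0. Qed.
Lemma absvalM x y : f (x * y) = f x * f y. Proof. by case: fA => _ [_ []]. Qed.
Lemma ler_absvalD x y : f (x + y) <= f x + f y. Proof. by case: fA => _ [_ []]. Qed.
Lemma absval1 : f 1 = 1.
Proof.
have : f 1 != 0 by rewrite absval_eq0 oner_eq0.
by move=> /mulfI; apply; rewrite -absvalM !mulr1.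
Qed.
Lemma absvalX x k : f (x ^+ k) = f x ^+ k.
Proof. by elim: k => [|k IH]; rewrite ?expr0 ?absval1// !exprS absvalM IH. Qed.
Lemma absvalN x : f (- x) = f x.
Proof.
rewrite -mulN1r absvalM; suff -> : f (-1) = 1 by rewrite mul1r.
have : f (-1) ^+ 2 == 1 by rewrite -absvalX sqrrN expr1n absval1.
rewrite sqrf_eq1 => /orP[/eqP//|/eqP h].
by have := absval_ge0 (-1); rewrite h; lra.
Qed.
Lemma absvalV x : f x^-1 = (f x)^-1.
Proof.
have [->|x0] := eqVneq x 0; first by rewrite invr0 absval0 invr0.
have h : f x != 0 by rewrite absval_eq0.
by apply: (mulfI h); rewrite -absvalM !divff// absval1.
Qed.
Lemma absval_div x y : f (x / y) = f x / f y.
Proof. by rewrite absvalM absvalV. Qed.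
Lemma ler_absvalB x y : f (x - y) <= f x + f y.
Proof. by rewrite -[f y]absvalN ler_absvalD. Qed.
Lemma absval_distC x y : f (x - y) = f (y - x).
Proof. by rewrite -absvalN opprB. Qed.
Lemma ler_absval_dist x y : f x - f y <= f (x - y).
Proof. by rewrite lerBlDr; apply: le_trans (ler_absvalD _ _); rewrite subrK. Qed.
Lemma ler_absval_sum (J : Type) (s : seq J) (P : pred J) (u : J -> K) :
  f (\sum_(j <- s | P j) u j) <= \sum_(j <- s | P j) f (u j).
Proof.
elim/big_ind2 : _ => //; first by rewrite absval0.
by move=> x a y b hx hy; apply: le_trans (ler_absvalD _ _) (lerD hx hy).
Qed.
Lemma absval_prod (J : Type) (s : seq J) (P : pred J) (u : J -> K) :
  f (\prod_(j <- s | P j) u j) = \prod_(j <- s | P j) f (u j).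
Proof.
by elim/big_ind2 : _ => //; [rewrite absval1 | move=> ? ? ? ? <- <-; rewrite absvalM].
Qed.
End Basics.

Lemma absval_near1 f e y : is_absval f -> 1 < f e -> 0 < y ->
  \forall k \near \oo, f (e ^+ k / (1 + e ^+ k) - 1) < y.
Proof.
move=> fA e1 y0; have := expr_unbounded (y^-1 + 1) e1.
apply: filterS => k hk.
have h1 : f (e ^+ k) - 1 <= f (1 + e ^+ k).
  by have := ler_absval_dist fA (1 + e ^+ k) 1; have := ler_absvalB fA (1 + e ^+ k) 1;
    rewrite [1 + e ^+ k - 1]addrAC subrr add0r absval1 //; lra.
rewrite absvalX// in h1.
have y' : 0 < y^-1 by rewrite invr_gt0.
have n0 : 1 + e ^+ k != 0 by rewrite -(absval_gt0 fA); lra.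
have -> : e ^+ k / (1 + e ^+ k) - 1 = - (1 + e ^+ k)^-1.
  by rewrite -[in RHS](mulr1 _^-1) -[X in _ - X](divff n0); field.
rewrite absvalN// absvalV// -[y]invrK ltf_pV2 ?posrE//; lra.
Qed.

Lemma absval_near0 f e y : is_absval f -> f e < 1 -> 0 < y ->
  \forall k \near \oo, f (e ^+ k / (1 + e ^+ k)) < y.
Proof.
move=> fA e1 y0; have m0 : 0 < Num.min (1/2) (y/2) by rewrite lt_min !divr_gt0.
have e0 : 0 <= f e < 1 by rewrite absval_ge0.
have := expr_small e0 m0.
apply: filterS => k; rewrite lt_min => /andP[hk hk2].
have h1 : 1 - f (e ^+ k) <= f (1 + e ^+ k).
  by have := ler_absval_dist fA 1 (- e ^+ k); rewrite opprK absval1// absvalN.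
rewrite absvalX// in h1.
rewrite absval_div// absvalX// ltr_pdivrMr; last by lra.
by nra.
Qed.

(** Since [f c = g c], a power of [c] scales both values by the same factor. Once a power of [x] has
    spread them by a ratio above [C ^+ 2], such a scaling puts 1 strictly between them. *)
Lemma absval_separate f g (c : K) : is_absval f -> is_absval g ->
  f c = g c -> 1 < f c -> f <> g -> exists z, 1 < f z /\ g z < 1.
Proof.
move=> fA gA cE c1 fg.
have [z0 z0P] : exists z0, f z0 <> g z0.
  by apply: contrapT => h; apply: fg; apply/funext => z; apply: contrapT => h'; apply: h; exists z.
have [x xP] : exists x, g x < f x.
  have [h|h|//] := ltgtP (f z0) (g z0); last by exists z0.
  exists z0^-1; rewrite !absvalV// ltf_pV2 // posrE absval_gt0//.
    by apply/eqP => z00; move: h; rewrite z00 !absval0 ?ltxx.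
  by apply/eqP => z00; move: h; rewrite z00 !absval0 ?ltxx.
have fx0 : 0 < f x by apply: le_lt_trans xP; apply: absval_ge0.
have [gx0|gx0] := eqVneq (g x) 0.
  have x0 : x = 0 by apply/eqP; rewrite -(absval_eq0 gA) gx0.
  by move: fx0; rewrite x0 absval0 ?ltxx.
have gxp : 0 < g x by rewrite lt0r gx0 absval_ge0.
set C := f c in c1 *.
have C0 : 0 < C by lra.
have q1 : 1 < f x / g x by rewrite ltr_pdivlMr ?mul1r.
have [n _ /(_ n (leqnn n)) hn] := expr_unbounded (C ^+ 2) q1.
(* The factor [C ^+ j] lifts the [g]-value above 1, so that the least exponent [k] below is positive
   and has a predecessor. *)
have [j _ /(_ j (leqnn j)) /= hj] := expr_unbounded ((g x ^+ n)^-1) c1.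
have [k0 _ /(_ k0 (leqnn k0)) /= hk0] := expr_unbounded (g x ^+ n * C ^+ j) c1.
have ex : exists k, g x ^+ n * C ^+ j < C ^+ k by exists k0.
have [k kP kmin] := ex_minnP ex.
have gn0 : 0 < g x ^+ n by rewrite exprn_gt0.
have gC : 1 < g x ^+ n * C ^+ j by rewrite mulrC -ltr_pdivrMr// div1r.
case: k kP kmin => [|k] kP kmin; first by move: kP; rewrite expr0; lra.
have hk : C ^+ k <= g x ^+ n * C ^+ j.
  by rewrite leNgt; apply/negP => /kmin; rewrite ltnn.
exists (x ^+ n * c ^+ j / c ^+ k.+1).
rewrite !absval_div// !absvalM// !absvalX// -cE -/C; split; last first.
  by rewrite ltr_pdivrMr ?mul1r// exprn_gt0.
rewrite ltr_pdivlMr ?mul1r ?exprn_gt0//.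
move: hn; rewrite expr_div_n ltr_pdivlMr// => hn.
have Cj : 0 < C ^+ j by rewrite exprn_gt0.
have : C ^+ 2 * g x ^+ n * C ^+ j < f x ^+ n * C ^+ j by rewrite ltr_pM2r.
apply: le_lt_trans; rewrite exprS -mulrA.
apply: (@le_trans _ _ (C * (g x ^+ n * C ^+ j))); first by rewrite ler_pM2l.
by rewrite ler_pM2r ?mulr_gt0//; nra.
Qed.

(** The induction of Artin and Whaples: [e] separates [f] from all but the last [h], and [z]
    separates [f] from [h]. If [h e <= 1], then [e ^+ k * z] works for large [k]; otherwise
    [e ^+ k / (1 + e ^+ k) * z] does, its first factor tending to 1 at [f] and [h] and to 0 at the
    others. *)
Lemma absval_separate_family f (c : K) n (g : 'I_n -> K -> R) :
  is_absval f -> 1 < f c -> (forall i, is_absval (g i)) ->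
  (forall i, g i c = f c) -> (forall i, g i <> f) ->
  exists e, 1 < f e /\ forall i, g i e < 1.
Proof.
move=> fA c1; elim: n g => [|n IH] g gA gc gf; first by exists c; split => // -[].
have [e [e1 eP]] := IH (fun i => g (widen_ord (leqnSn n) i)) (fun i => gA _)
  (fun i => gc _) (fun i => gf _).
pose h := g ord_max.
have hA : is_absval h by apply: gA.
have [z [z1 hz]] : exists z, 1 < f z /\ h z < 1.
  by apply: (absval_separate fA hA _ c1); rewrite /h ?gc// => /esym/gf.
have last_case i : i = ord_max \/ exists i', i = widen_ord (leqnSn n) i'.
  case: (unliftP ord_max i) => [i' ->|->]; [right; exists i' | by left].
  by apply: val_inj; rewrite /= /bump leqNgt ltn_ord.
have small i : \forall k \near \oo, g (widen_ord (leqnSn n) i) (e ^+ k * z) < 1.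
  have gi := gA (widen_ord (leqnSn n) i).
  have [zz|zz] := eqVneq (g (widen_ord (leqnSn n) i) z) 0.
    by near=> k; rewrite absvalM// zz mulr0.
  have zp : 0 < g (widen_ord (leqnSn n) i) z by rewrite lt0r zz absval_ge0.
  have e0 : 0 <= g (widen_ord (leqnSn n) i) e < 1 by rewrite absval_ge0//= eP.
  have := expr_small e0 (y := (g (widen_ord (leqnSn n) i) z)^-1).
  rewrite invr_gt0 => /(_ zp); apply: filterS => k hk.
  by rewrite absvalM// absvalX// -ltr_pdivlMr// div1r.
have [he|he] := leP (h e) 1.
  have := @filter_forall _ _ _ \oo _ small.
  case=> k _ /(_ k (leqnn k)) /= hk; exists (e ^+ k * z); split.
    rewrite absvalM// absvalX//; apply: lt_le_trans z1 _.
    by rewrite ler_peMl ?absval_ge0// exprn_ege1// ltW.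
  move=> i; case: (last_case i) => [->|[i' ->]]; last exact: hk.
  rewrite -/h absvalM// absvalX//; apply: le_lt_trans hz.
  by rewrite ler_piMl ?absval_ge0// exprn_ile1// absval_ge0.
pose u k := e ^+ k / (1 + e ^+ k).
have tail f' (f'A : is_absval f') (y : R) : 1 < f' e -> 0 < y ->
    \forall k \near \oo, f' (u k * z) < f' z + y /\ f' z - y < f' (u k * z).
  move=> fe y0; have fz := absval_ge0 f'A z.
  have y' : 0 < y / (f' z + 1) by rewrite divr_gt0//; lra.
  have := absval_near1 f'A fe y'; apply: filterS => k hk.
  have b : f' (u k * z - z) < y.
    have -> : u k * z - z = (u k - 1) * z by ring.
    rewrite absvalM//; move: hk; rewrite ltr_pdivlMr -/(u k); last lra.
    by have := absval_ge0 f'A (u k - 1); nra.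
  have b1 := ler_absval_dist f'A (u k * z) z.
  have := ler_absval_dist f'A z (u k * z); rewrite absval_distC//.
  by lra.
have := @filter_forall _ _ (fun i k => g (widen_ord (leqnSn n) i) (u k * z) < 1) \oo _ _.
case.
  move=> i; have gi := gA (widen_ord (leqnSn n) i).
  have fz := absval_ge0 gi z.
  have y' : 0 < (g (widen_ord (leqnSn n) i) z + 1)^-1 by rewrite invr_gt0; lra.
  have := absval_near0 gi (eP i) y'; apply: filterS => k.
  rewrite -/(u k) -div1r ltr_pdivlMr; last lra.
  by rewrite absvalM//; have := absval_ge0 gi (u k); nra.
move=> N1 _ h1.
have [N2 _ h2] := tail f fA (f z - 1) e1 ltac:(lra).
have [N3 _ h3] := tail h hA (1 - h z) he ltac:(lra).
pose k := maxn N1 (maxn N2 N3); exists (u k * z); split.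
  have [] := h2 k; last by lra.
  by rewrite /= /k leq_max leq_max leqnn orbT.
move=> i; case: (last_case i) => [->|[i' ->]].
  have [] := h3 k; last by rewrite -/h; lra.
  by rewrite /= /k !leq_max leqnn !orbT.
by apply: (h1 k); rewrite /= /k leq_max leqnn.
Unshelve. all: by end_near.
Qed.

Lemma absval_weak_approx n (g : 'I_n -> K -> R) (c : K) (C y : R) :
  (forall i, is_absval (g i)) -> injective g -> 1 < C -> (forall i, g i c = C) ->
  0 < y -> forall i, exists e, g i (e - 1) < y /\ forall j, j != i -> g j e < y.
Proof.
case: n g => [|n] g gA gI C1 gc y0 i; first by case: i.
have [e [e1 eP]] := @absval_separate_family (g i) c n (fun j => g (lift i j)) (gA i)
  ltac:(by rewrite gc) (fun j => gA _) ltac:(by move=> j; rewrite !gc)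
  ltac:(by move=> j /gI /eqP; rewrite eq_sym (negbTE (neq_lift i j))).
have [N1 _ h1] := absval_near1 (gA i) e1 y0.
have [N2 _ h2] := @filter_forall _ _ (fun j k => g (lift i j) (e ^+ k / (1 + e ^+ k)) < y) \oo _
  (fun j => absval_near0 (gA _) (eP j) y0).
exists (e ^+ (maxn N1 N2) / (1 + e ^+ (maxn N1 N2))); split.
  by apply: h1; rewrite /= leq_maxl.
move=> j; rewrite eq_sym => /unlift_some[j' -> _].
by apply: h2; rewrite /= leq_maxr.
Qed.

Lemma ler1_of_expr_bounded (a M : R) : 0 <= a -> (forall k, a ^+ k <= M) -> a <= 1.
Proof.
move=> a0 h; rewrite leNgt; apply/negP => a1.
have [k _ /(_ k (leqnn k)) /=] := expr_unbounded M a1.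
by rewrite ltNge h.
Qed.

Lemma expr_gt_linear (a : R) : 1 < a -> exists k, k%:R + 1 < a ^+ k.
Proof.
move=> a1; pose c := a - 1; have c0 : 0 < c by rewrite subr_gt0.
(* The exponent will be [2 n]: by Bernoulli [a ^+ (2 n)] is at least (1 + n c)^2, and n c^2 > 3
   makes its last term exceed 3 n. *)
pose n := (Num.bound (3 / c ^+ 2)).+1.
have hn : 3 / c ^+ 2 < n%:R.
  apply: lt_le_trans (archi_boundP _) _; first by rewrite divr_ge0// exprn_ge0// ltW.
  by rewrite ler_nat.
have n1 : 1 <= (n%:R : R) by rewrite ler1n.
exists (n * 2)%N; rewrite exprM natrM.
have := bernoulli_le n a1; rewrite -/c; move: hn; rewrite ltr_pdivrMr ?exprn_gt0// => hn b.
set N : R := n%:R in hn n1 b *.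
have h1 : (1 + N * c) ^+ 2 <= (a ^+ n) ^+ 2.
  by rewrite lerXn2r// ?nnegrE; [nra | apply: le_trans b; nra].
have h2 : 3 * N < N * (N * c ^+ 2) by nra.
by apply: lt_le_trans h1; nra.
Qed.

(** The binomial expansion of [(x + y) ^+ k] has [k + 1] terms of size at most [M ^+ k], so the
    powers of [f (x + y) / M] grow at most linearly, which excludes a value above 1. *)
Lemma absval_ultrametric f : is_absval f -> (forall k : nat, f k%:R <= 1) ->
  forall x y, f (x + y) <= Num.max (f x) (f y).
Proof.
move=> fA fn x y; set M := Num.max _ _.
have [M0|M0] := eqVneq M 0.
  have fx : f x <= 0 by rewrite -M0 le_max lexx.
  have fy : f y <= 0 by rewrite -M0 le_max lexx orbT.
  have := ler_absvalD fA x y; rewrite M0; lra.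
have Mp : 0 < M by rewrite lt0r M0 le_max absval_ge0.
rewrite leNgt; apply/negP => h.
have /expr_gt_linear[k] : 1 < f (x + y) / M by rewrite ltr_pdivlMr ?mul1r.
rewrite expr_div_n ltr_pdivlMr ?exprn_gt0// -(absvalX fA) exprDn.
apply/negP; rewrite -leNgt; apply: le_trans (ler_absval_sum fA _ _ _) _.
apply: (@le_trans _ _ (\sum_(i < k.+1) M ^+ k)); last first.
  by rewrite sumr_const card_ord natr1 mulr_natl.
apply: ler_sum => i _; rewrite -mulr_natl (absvalM fA) (absvalM fA) !(absvalX fA).
apply: (@le_trans _ _ (1 * (M ^+ (k - i) * M ^+ i))); last first.
  by rewrite mul1r -exprD subnK// -ltnS ltn_ord.
have fx := absval_ge0 fA x; have fy := absval_ge0 fA y.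
apply: ler_pM => //; rewrite ?mulr_ge0 ?exprn_ge0 ?(absval_ge0 fA)//.
apply: ler_pM; rewrite ?exprn_ge0// lerXn2r ?nnegrE ?(ltW Mp)// /M le_max lexx ?orbT//.
Qed.

End AbsoluteValues.

(** * Counting residue classes at one p-adic place *)

Section Padic.
Variables (R : realType) (K : fieldExtType rat).
Implicit Types (f : K -> R) (p : nat).

Definition is_padic_place p f : Prop :=
  is_absval f /\ forall q : rat, f (ratr q) = padic_abs R p q.

Lemma padic_abs_nat p k : (0 < k)%N -> padic_abs R p k%:R = (p%:R ^+ logn p k)^-1.
Proof.
move=> k0; rewrite /padic_abs pnatr_eq0 eqn0Ngt k0 /=.
have -> : (k%:R : rat) = (k%:Z)%:~R by rewrite -pmulrn.
by rewrite numq_int denq_int logn1 expr0 absz_nat div1r.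
Qed.

Section OnePlace.
Variables (p : nat) (f : K -> R).
Hypotheses (pr_p : prime p) (fP : is_padic_place p f).

Let p0 : 0 < (p%:R : R). Proof. by rewrite ltr0n prime_gt0. Qed.
Let p1 : 1 < (p%:R : R). Proof. by rewrite ltr1n prime_gt1. Qed.

Lemma padic_absval : is_absval f. Proof. by case: fP. Qed.
Let fA := padic_absval.
Hint Resolve fA : core.

Lemma padic_nat k : (0 < k)%N -> f k%:R = (p%:R ^+ logn p k)^-1.
Proof. by move=> k0; rewrite -padic_abs_nat// -(proj2 fP) ratr_nat. Qed.

Lemma padic_p : f p%:R = p%:R^-1.
Proof. by rewrite padic_nat ?prime_gt0// logn_prime// eqxx expr1. Qed.

Lemma padic_nat_le1 k : f k%:R <= 1.
Proof.
case: k => [|k]; first by rewrite absval0.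
by rewrite padic_nat// invf_le1 ?exprn_gt0// exprn_ege1// ltW.
Qed.

Lemma padic_ultra x y : f (x + y) <= Num.max (f x) (f y).
Proof. by apply: absval_ultrametric => //; apply: padic_nat_le1. Qed.

Lemma padic_addl x y (e : R) : f x <= e -> f y <= e -> f (x + y) <= e.
Proof. by move=> hx hy; apply: le_trans (padic_ultra _ _) _; rewrite ge_max hx. Qed.

Lemma padic_subl x y (e : R) : f x <= e -> f y <= e -> f (x - y) <= e.
Proof. by move=> hx hy; apply: padic_addl; rewrite ?(absvalN fA). Qed.

Lemma padic_sum_le (J : Type) (s : seq J) (P : pred J) (u : J -> K) (e : R) : 0 <= e ->
  (forall j, P j -> f (u j) <= e) -> f (\sum_(j <- s | P j) u j) <= e.
Proof.
move=> e0 h; elim/big_ind : _ => //; first by rewrite absval0.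
by move=> x y; apply: padic_addl.
Qed.

Lemma padic_intE (z : int) : f z%:~R = f (absz z)%:R.
Proof. by case: z => n //=; rewrite NegzE mulrNz (absvalN fA). Qed.

Lemma padic_int_le1 (z : int) : f z%:~R <= 1.
Proof. by rewrite padic_intE padic_nat_le1. Qed.

Lemma padic_int_small (z : int) : (f z%:~R <= p%:R^-1) = (p %| absz z)%N.
Proof.
rewrite padic_intE; case: (posnP (absz z)) => [->|z0].
  by rewrite (absval0 fA) invr_ge0 ltW// dvdn0.
rewrite padic_nat// -(expr1n _ 1) -(expr1 (p%:R : R)) lef_pV2 ?posrE ?exprn_gt0// expr1.
have := pfactor_dvdn 1 pr_p z0; rewrite expn1 => ->.
by rewrite -{1}(expr1 p%:R) ler_eXn2l.
Qed.

Lemma padic_eq_gt x y : f y < f x -> f (x + y) = f x.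
Proof.
move=> h; apply/eqP; rewrite eq_le; apply/andP; split.
  by apply: padic_addl => //; apply: ltW.
rewrite leNgt; apply/negP => h'.
have := padic_ultra (x + y) (- y); rewrite addrK (absvalN fA) leNgt.
by rewrite gt_max h' h.
Qed.

(** Independence over F_p in O_f / p O_f, where O_f is the ring [f <= 1] of K. This quotient has
    dimension [K_f : Q_p], so the local degree can be read inside K, before completing. *)
Definition residue_free r (b : 'I_r -> K) : Prop :=
  (forall j, f (b j) <= 1) /\
  forall c : 'I_r -> int, f (\sum_j (c j)%:~R * b j) <= p%:R^-1 ->
    forall j, (p %| absz (c j))%N.

Definition residue_spans r (b : 'I_r -> K) : Prop :=
  forall x, f x <= 1 -> exists c : 'I_r -> 'I_p, f (x - \sum_j (c j)%:R * b j) <= p%:R^-1.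

Lemma residue_digits r (b : 'I_r -> K) : residue_spans b -> forall k x, f x <= 1 ->
  exists c : 'I_k -> 'I_r -> 'I_p,
    f (x - \sum_(i < k) p%:R ^+ i * \sum_j (c i j)%:R * b j) <= p%:R^-1 ^+ k.
Proof.
move=> bs; elim=> [|k IH] x x1.
  have c0 : 'I_0 -> 'I_r -> 'I_p by case.
  by exists c0; rewrite big_ord0 subr0 expr0.
have [c0 hc0] := bs x x1.
pose y := (x - \sum_j (c0 j)%:R * b j) / p%:R.
have y1 : f y <= 1 by rewrite (absval_div fA) padic_p invrK -ler_pdivlMr// div1r.
have [c hc] := IH y y1.
pose D (i : 'I_k.+1) j := if unlift ord0 i is Some i' then c i' j else c0 j.
exists D.
set S0 := \sum_j (c0 j)%:R * b j in y y1 hc *.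
set T := \sum_(i < k) p%:R ^+ i * \sum_j (c i j)%:R * b j in hc.
have -> : \sum_(i < k.+1) p%:R ^+ i * \sum_j (D i j)%:R * b j = S0 + p%:R * T.
  rewrite big_ord_recl; congr (_ + _).
    by rewrite mul1r; apply: eq_bigr => j _; rewrite /D unlift_none.
  rewrite mulr_sumr; apply: eq_bigr => i _; rewrite /= /bump add1n exprS mulrA.
  by congr (_ * _); apply: eq_bigr => j _; rewrite /D liftK.
have pK : (p%:R : K) != 0 by rewrite -(absval_gt0 fA) padic_p invr_gt0.
have -> : x - (S0 + p%:R * T) = p%:R * (y - T) by rewrite /y mulrBr mulrCA divff// mulr1 opprD addrA.
by rewrite (absvalM fA) padic_p exprS ler_pM2l ?invr_gt0.
Qed.

(** Such a family represents distinct classes of the ring [f <= 1] modulo the ideal [f <= a]. *)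
Definition separated (a : R) (T : finType) (u : T -> K) : Prop :=
  (forall i, f (u i) <= 1) /\ forall i j, i != j -> a < f (u i - u j).

Lemma separated_pX r (b : 'I_r -> K) k (T : finType) (u : T -> K) : residue_spans b ->
  separated (p%:R^-1 ^+ k) u -> (#|T| <= p ^ (r * k))%N.
Proof.
move=> bs [u1 us].
pose D i := projT1 (cid (residue_digits bs k (u1 i))).
have DP i := projT2 (cid (residue_digits bs k (u1 i))).
pose g i : {ffun 'I_k * 'I_r -> 'I_p} := [ffun x => D i x.1 x.2].
have gi : injective g.
  move=> i j gij; apply/eqP; apply: contraT => /us; rewrite ltNge => /negP[].
  have DE : D i = D j.
    apply/funext => x; apply/funext => y.
    by move/ffunP: gij => /(_ (x, y)); rewrite !ffunE.
  have := padic_subl (DP i) (DP j); rewrite -/(D i) -/(D j) DE.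
  by rewrite opprB addrA subrK.
by have := leq_card g gi; rewrite card_ffun card_prod !card_ord mulnC.
Qed.

(** Two digits in base [a]: when the first digits differ, their difference exceeds [f a] and
    dominates the second part; when they agree, the second digits decide. *)
Lemma separatedM (a a' : K) (T T' : finType) (u : T -> K) (u' : T' -> K) :
  f a <= 1 -> f a' <= 1 -> a != 0 ->
  separated (f a) u -> separated (f a') u' ->
  separated (f (a * a')) (fun x : T * T' => u x.1 + a * u' x.2).
Proof.
move=> a1 a1' a0 [u1 us] [u1' us']; split.
  move=> i; apply: padic_addl => //; rewrite (absvalM fA) mulr_ile1 ?(absval_ge0 fA)//.
have fa0 : 0 < f a by rewrite absval_gt0.
move=> [i i'] [j j'] /= ne.
have -> : u i + a * u' i' - (u j + a * u' j') = (u i - u j) + a * (u' i' - u' j') by ring.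
have [ij|ij] := eqVneq i j.
  rewrite ij subrr add0r !(absvalM fA) ltr_pM2l//; apply: us'.
  by apply: contraNneq ne => ->; rewrite ij.
have h : f (a * (u' i' - u' j')) <= f a.
  by rewrite (absvalM fA) ler_piMr ?(absval_ge0 fA)// padic_subl.
have h2 := us _ _ ij.
rewrite padic_eq_gt; last by apply: le_lt_trans h2.
by apply: le_lt_trans h2; rewrite (absvalM fA) ler_piMr// ltW.
Qed.

(** A power trick. The value [f a] need not be a power of 1/p, so counting base-p digits loses a
    factor; but for the [#|T| ^ M] points separated by [f (a ^+ M)] the loss is at most [p ^+ r],
    whatever [M] is, and it disappears as [M] grows. *)
Lemma separated_card r (b : 'I_r -> K) (a : K) (T : finType) (u : T -> K) :
  residue_spans b -> a != 0 -> f a <= 1 -> separated (f a) u -> #|T|%:R <= (f a)^-1 ^+ r.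
Proof.
move=> bs a0 a1 us; have fa0 : 0 < f a by rewrite absval_gt0.
have pow M : exists (T' : finType) (u' : T' -> K), separated (f (a ^+ M)) u' /\ #|T'| = (#|T| ^ M)%N.
  elim: M => [|M [T' [u' [us' cT]]]].
    exists unit, (fun=> 0); rewrite card_unit expn0; split=> //; split.
      by move=> _; rewrite absval0.
    by move=> [] [].
  exists (T * T')%type, (fun x => u x.1 + a * u' x.2); split.
    by rewrite exprS; apply: separatedM => //; rewrite (absvalX fA) exprn_ile1// ltW.
  by rewrite card_prod cT expnS.
have key M : (#|T|%:R * f a ^+ r) ^+ M <= p%:R ^+ r.
  have [T' [u' [us' cT]]] := pow M.
  have faM : 0 < f (a ^+ M) by rewrite absval_gt0// expf_neq0.
  have ex : exists k, p%:R^-1 ^+ k <= f (a ^+ M).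
    have pI : 0 <= (p%:R^-1 : R) < 1 by rewrite invr_ge0 ltW//= invf_lt1.
    have [k _ /(_ k (leqnn k)) /= h] := expr_small pI faM.
    by exists k; apply: ltW.
  have [k kP kmin] := ex_minnP ex.
  have sk : separated (p%:R^-1 ^+ k) u'.
    by case: us' => h1 h2; split => // i j /h2; apply: le_lt_trans.
  have := separated_pX bs sk; rewrite cT => cTk.
  rewrite exprMn; apply: (@le_trans _ _ ((p ^ (r * k))%:R * (f a ^+ r) ^+ M)).
    by rewrite ler_pM2r -?natrX ?ler_nat//; do 2 apply: exprn_gt0.
  have -> : (f a ^+ r) ^+ M = f (a ^+ M) ^+ r by rewrite (absvalX fA) -!exprM mulnC.
  have -> : ((p ^ (r * k))%:R : R) = (p%:R ^+ k) ^+ r by rewrite natrX -exprM mulnC.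
  have fM1 : f (a ^+ M) <= 1 by rewrite (absvalX fA) exprn_ile1// ltW.
  case: k kmin {kP sk cTk} => [|k] kmin.
    rewrite expr1n mul1r; apply: (@le_trans _ _ 1); last by rewrite exprn_ege1// ltW.
    by rewrite exprn_ile1 ?(absval_ge0 fA).
  have hk : f (a ^+ M) <= p%:R^-1 ^+ k.
    by rewrite leNgt; apply/negP => /ltW /kmin; rewrite ltnn.
  rewrite -exprMn.
  rewrite lerXn2r ?nnegrE ?mulr_ge0 ?exprn_ge0 ?(absval_ge0 fA) ?(ltW p0)// exprSr.
  apply: (@le_trans _ _ (p%:R ^+ k * p%:R * p%:R^-1 ^+ k)).
    by rewrite ler_pM2l// mulr_gt0// exprn_gt0.
  by rewrite mulrAC -exprMn divff ?gt_eqF// expr1n mul1r.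
have := ler1_of_expr_bounded _ key.
rewrite mulr_ge0 ?exprn_ge0 ?(ltW fa0)// => /(_ isT) h.
by rewrite exprVn -[X in _ <= X]mul1r ler_pdivlMr ?exprn_gt0.
Qed.

(** A separated family of maximal size exists by [separated_card], and every integral [x] is within
    [f a] of one of its members, since otherwise [x] could be added. That member is the label. *)
Lemma residue_labels r (b : 'I_r -> K) (a : K) : residue_spans b -> a != 0 -> f a <= 1 ->
  exists (F : finType) (phi : K -> F), #|F|%:R <= (f a)^-1 ^+ r /\
    forall x y, f x <= 1 -> f y <= 1 -> phi x = phi y -> f (x - y) <= f a.
Proof.
move=> bs a0 a1.
pose P c := `[< exists u : 'I_c -> K, separated (f a) u >].
have exP : exists c, P c.
  exists 1%N; apply/asboolP; exists (fun=> 0); split; first by rewrite absval0.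
  by move=> i j; rewrite !ord1.
have bnd : exists M, forall c, P c -> (c <= M)%N.
  exists (Num.bound ((f a)^-1 ^+ r)) => c /asboolP[u us].
  have := separated_card bs a0 a1 us; rewrite card_ord -(ler_nat R).
  move=> h; apply: le_trans h _; apply/ltW/archi_boundP.
  by rewrite exprn_ge0// invr_ge0 absval_ge0.
have [M MP] := bnd.
have [c /asboolP[u us] cmax] := ex_maxnP exP MP.
have near x : f x <= 1 -> exists i, f (x - u i) <= f a.
  move=> x1; apply: contrapT => h.
  suff : P c.+1 by move=> /cmax; rewrite ltnn.
  apply/asboolP; exists (fun i => if unlift ord0 i is Some i' then u i' else x).
  have [u1 uS] := us; split=> [i|i j]; first by case: unliftP.
  case: unliftP => [i' ->|->]; case: unliftP => [j' ->|->] ne //.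
  - by apply: uS; apply: contraNneq ne => ->.
  - by rewrite (absval_distC fA) ltNge; apply/negP => h'; apply: h; exists i'.
  - by rewrite ltNge; apply/negP => h'; apply: h; exists j'.

have [i0 _] := near 0 ltac:(by rewrite (absval0 fA)).
have phiP x : exists i, f x <= 1 -> f (x - u i) <= f a.
  by have [/near[i hi]|h] := pselect (f x <= 1); [exists i | exists i0].
exists 'I_c, (fun x => projT1 (cid (phiP x))); split.
  exact: (separated_card bs a0 a1 us).
move=> x y x1 y1 xy; have hx := projT2 (cid (phiP x)) x1.
have hy := projT2 (cid (phiP y)) y1; rewrite xy in hx.
by have := padic_subl hx hy; rewrite opprB addrA subrK.
Qed.

End OnePlace.

Lemma rat_family_dependent (J : finType) (b : J -> K) : (\dim {:K} < #|J|)%N ->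
  exists q : J -> rat, (exists j, q j != 0) /\ \sum_j (q j)%:A * b j = 0.
Proof.
move=> dJ; pose M : 'M[rat]_(#|J|, \dim {:K}) :=
  \matrix_(i, k) coord (vbasis {:K}) k (b (enum_val i)).
have : kermx M != 0.
  by rewrite kermx_eq0 /row_free neq_ltn (leq_ltn_trans (rank_leq_col _) dJ).
move=> /rowV0Pn[u /sub_kermxP uM u0].
exists (fun j => u 0 (enum_rank j)); split.
  move: u0 => /rV0Pn[i hi]; exists (enum_val i).
  by rewrite enum_valK.
rewrite (reindex _ (onW_bij _ (enum_val_bij J))) /=.
under eq_bigr => i _.
  rewrite enum_valK (coord_vbasis (memvf (b (enum_val i)))) mulr_algl scaler_sumr.
  over.
rewrite exchange_big /= big1// => k _.
under eq_bigr do rewrite scalerA.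
rewrite -scaler_suml; move/matrixP: uM => /(_ 0 k); rewrite !mxE => h.
rewrite [X in X *: _](_ : _ = 0) ?scale0r//.
by rewrite -[RHS]h; apply: eq_bigr => i _; rewrite mxE.
Qed.

(** Among the nonzero integer relations, one whose coefficients have the least sum of absolute
    values cannot be divided by [p]. *)
Lemma int_family_dependent p (J : finType) (b : J -> K) : prime p -> (\dim {:K} < #|J|)%N ->
  exists c : J -> int, (exists j, ~~ (p %| absz (c j))%N) /\ \sum_j (c j)%:~R * b j = 0.
Proof.
move=> pr_p dJ; have [q [[j0 qj0] qb]] := rat_family_dependent b dJ.
pose P N := `[< exists c : J -> int, (exists j, c j != 0) /\ \sum_j (c j)%:~R * b j = 0 /\
  (\sum_j absz (c j))%N = N >].
have exP : exists N, P N.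
  pose D := \prod_j denq (q j).
  have Dj j : exists z : int, z%:~R = D%:~R * q j.
    exists (numq (q j) * \prod_(i | i != j) denq (q i)).
    rewrite /D [in RHS](bigD1 j)//= !rmorphM /= -[X in _ = _ * X]divq_num_den.
    by rewrite [RHS]mulrC mulrA divfK ?intr_eq0 ?denq_eq0.
  pose c j := projT1 (cid (Dj j)); have cP j : (c j)%:~R = D%:~R * q j := projT2 (cid (Dj j)).
  have D0 : D != 0 by apply/prodf_neq0 => j _; apply: denq_neq0.
  exists (\sum_j absz (c j))%N; apply/asboolP; exists c; split.
    by exists j0; rewrite -(intr_eq0 rat) cP mulf_neq0 ?intr_eq0.
  split=> //; transitivity ((D%:~R : rat)%:A * \sum_j (q j)%:A * b j : K); last by rewrite qb mulr0.
  rewrite mulr_sumr; apply: eq_bigr => j _; rewrite mulrA; congr (_ * _).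
  by rewrite mulr_algl scalerA -cP alg_num_field ratr_int.
have [N /asboolP[c [cn0 [cb cN]]] Nmin] := ex_minnP exP.
exists c; split=> //; apply: contrapT => hdiv.
have hd j : (p %| absz (c j))%N by apply: contraT => h; case: hdiv; exists j.
have cd j : exists z : int, c j = z * p.
  by exists (c j %/ p)%Z; rewrite divzK// dvdzE; apply: hd.
pose e j := projT1 (cid (cd j)); have eP j : c j = e j * p := projT2 (cid (cd j)).
suff : P (\sum_j absz (e j))%N.
  move=> /Nmin; rewrite -cN leqNgt => /negP[].
  have -> : (\sum_j absz (c j) = (\sum_j absz (e j)) * p)%N.
    by rewrite big_distrl; apply: eq_bigr => j _; rewrite eP abszM.
  case: cn0 => j cj; have : (0 < \sum_j absz (e j))%N.
    rewrite (bigD1 j)//= addn_gt0 absz_gt0; apply/orP; left.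
    by apply: contraNneq cj => h; rewrite eP h mul0r.
  by move=> h; rewrite -[X in (X < _)%N]muln1 ltn_pmul2l// prime_gt1.
apply/asboolP; exists e; split.
  by case: cn0 => j cj; exists j; apply: contraNneq cj => h; rewrite eP h mul0r.
split=> //; have pK : (p%:R : K) != 0.
  by rewrite -(ratr_nat K) -alg_num_field scaler_eq0 oner_eq0 orbF pnatr_eq0 -lt0n prime_gt0.
apply: (mulfI pK); rewrite mulr0 -[RHS]cb mulr_sumr; apply: eq_bigr => j _.
by rewrite eP intrM mulrA [p%:R * _]mulrC.
Qed.

End Padic.

(** * The finitely many places over a prime *)

Section PlacesOverPrime.
Variables (R : realType) (K : fieldExtType rat) (p : nat).
Hypothesis pr_p : prime p.
Implicit Types (f : K -> R).

Let p1 : 1 < (p%:R : R). Proof. by rewrite ltr1n prime_gt1. Qed.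
Let p0 : 0 < (p%:R : R). Proof. by rewrite ltr0n prime_gt0. Qed.

Lemma ler_term_sum (J : finType) (j : J) (F : J -> R) (x : R) :
  (forall j, 0 <= F j) -> x <= F j -> x <= \sum_j F j.
Proof. by move=> F0 h; rewrite (bigD1 j)//=; apply: ler_wpDr => //; apply: sumr_ge0. Qed.

(** Weak approximation gives [e i] near 1 at [W i] and near 0 at the other places. In the joint
    family [e i * b i k] an integer relation reduces, at each place, to a relation modulo [p] among
    the [b i k], so all its coefficients are divisible by [p]; more than [\dim {:K}] elements would
    have a relation violating this. *)
Lemma residue_free_sum s (W : 'I_s -> K -> R) (r : 'I_s -> nat)
    (b : forall i, 'I_(r i) -> K) :
  injective W -> (forall i, is_padic_place p (W i)) ->
  (forall i, residue_free p (W i) (b i)) -> (\sum_i r i <= \dim {:K})%N.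
Proof.
move=> WI WP bf; rewrite leqNgt; apply/negP => hd.
have WA i : is_absval (W i) by case: (WP i).
have pV : W^~ p%:R^-1 = fun=> p%:R.
  by apply/funext => i; rewrite (absvalV (WA i)) (padic_p pr_p (WP i)) invrK.
have pI0 : 0 < (p%:R^-1 : R) by rewrite invr_gt0.
(* A factor of size below [1 / M] brings every [b j k] down to size at most [1 / p]. *)
pose M := p%:R * (1 + \sum_i \sum_j \sum_k W i (b j k)).
have Mb i j k : p%:R * W i (b j k) <= M.
  rewrite /M ler_pM2l//; apply: (@le_trans _ _ (\sum_i \sum_j \sum_k W i (b j k))); last by rewrite lerDr.
  have A0 i' j' k' : 0 <= W i' (b j' k') by apply: (absval_ge0 (WA i')).
  apply: (@ler_term_sum _ i) => [i'|]; first by do 2 (apply: sumr_ge0 => ? _).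
  apply: (@ler_term_sum _ j) => [j'|]; first by apply: sumr_ge0.
  exact: (@ler_term_sum _ k).
have M0 : 0 < M.
  rewrite mulr_gt0// ltr_pwDl//; apply: sumr_ge0 => i _; do 2 (apply: sumr_ge0 => ? _); exact: (absval_ge0 (WA i)).
have MI : 0 < M^-1 by rewrite invr_gt0.
have ap i := absval_weak_approx WA WI p1 (fun i => congr1 (@^~ i) pV) MI i.
pose e i := projT1 (cid (ap i)).
have e1 i : W i (e i - 1) < M^-1 by case: (projT2 (cid (ap i))).
have e0 i j : j != i -> W j (e i) < M^-1 by case: (projT2 (cid (ap i))) => _ h; apply: h.
have small i j k x : W i x < M^-1 -> W i (x * b j k) <= p%:R^-1.
  move=> hx; rewrite (absvalM (WA i)) -[X in _ <= X]mul1r ler_pdivlMr// -mulrA [_ * p%:R]mulrC.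
  apply: (@le_trans _ _ (M^-1 * M)); last by rewrite mulVf ?gt_eqF.
  by apply: ler_pM; rewrite ?mulr_ge0 ?(absval_ge0 (WA i)) ?(ltW p0) ?(ltW hx).
pose B (x : {i : 'I_s & 'I_(r i)}) := e (tag x) * b (tag x) (tagged x).
have [|c [[[i k] ck] cB]] := int_family_dependent B pr_p.
  by rewrite card_tagged sumnE big_map big_enum /=; under eq_bigr do rewrite card_ord.
have cB' : \sum_i \sum_k (c (Tagged (fun i => 'I_(r i)) k))%:~R * (e i * b i k) = 0 :> K.
  rewrite (@sig_big_dep _ _ _ _ (fun i => 'I_(r i)) xpredT (fun _ => xpredT)
    (fun i k => (c (Tagged (fun i => 'I_(r i)) k))%:~R * (e i * b i k))) /=.
  by rewrite -[RHS]cB; apply: eq_bigr => -[i' k'].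
have WU := padic_sum_le pr_p (WP i).
have [_ /(_ (fun k => c (Tagged (fun i => 'I_(r i)) k)))] := bf i.
move=> /(_ _ k) /negP; rewrite /= (negbTE ck) => h; case: (h _) => // {h}.
have -> : \sum_j (c (Tagged (fun i => 'I_(r i)) j))%:~R * b i j =
   \sum_j (c (Tagged (fun i => 'I_(r i)) j))%:~R * - ((e i - 1) * b i j) -
   \sum_(i' | i' != i) \sum_k (c (Tagged (fun i => 'I_(r i)) k))%:~R * (e i' * b i' k).
  move: cB'; rewrite (bigD1 i)//= => /eqP; rewrite addr_eq0 => /eqP <-.
  by rewrite -big_split /=; apply: eq_bigr => j _; ring.
have tsmall (z : int) x : W i x <= p%:R^-1 -> W i (z%:~R * x) <= p%:R^-1.
  move=> hx; rewrite (absvalM (WA i)); apply: le_trans hx.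
  by rewrite ler_piMl ?(absval_ge0 (WA i))// (padic_int_le1 pr_p (WP i)).
have pI := ltW pI0.
apply: (padic_subl pr_p (WP i)).
  apply: (WU) => // j _; apply: tsmall; rewrite (absvalN (WA i)).
  exact: small.
apply: (WU) => // i' i'i; apply: (WU) => // j _; apply: tsmall.
by apply: small; apply: e0; rewrite eq_sym.
Qed.

(** A free family of maximal length spans: adjoining an [x] outside its span keeps it free, because
    in a relation modulo [p] a coefficient of [x] prime to [p] could be inverted by Bezout. *)
Lemma residue_basis_exists f : is_padic_place p f ->
  exists r (b : 'I_r -> K), residue_free p f b /\ residue_spans p f b.
Proof.
move=> fP; have fA : is_absval f by case: fP.
pose P r := `[< exists b : 'I_r -> K, residue_free p f b >].
have ex : exists r, P r.
  have b0 : 'I_0 -> K by case.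
  by exists 0%N; apply/asboolP; exists b0; split => [[]|c _ []].
have bnd r : P r -> (r <= \dim {:K})%N.
  move=> /asboolP[b bf].
  have := @residue_free_sum 1 (fun=> f) (fun=> r) (fun=> b).
  rewrite big_ord1; apply => //; by move=> i j _; rewrite !ord1.
have [r /asboolP[b bf] rmax] := ex_maxnP ex bnd.
exists r, b; split=> // x x1; apply: contrapT => hx.
suff : P r.+1 by move=> /rmax; rewrite ltnn.
apply/asboolP; exists (fun i => if unlift ord0 i is Some i' then b i' else x).
have [b1 bF] := bf; split=> [i|c]; first by case: unliftP.
rewrite big_ord_recl /= unlift_none.
under eq_bigr => i _ do rewrite -/(lift ord0 i) liftK.
set S := \sum_i _ => hS.
have p_c0 : (p %| absz (c ord0))%N.
  apply: contraT => nc0; case: hx.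
  have cop : coprimez (c ord0) p by rewrite coprimezE coprime_sym prime_coprime.
  have [u [v uv]] := Bezoutz (c ord0) p.
  have uv1 : u * c ord0 + v * p = 1 by rewrite uv; apply/eqP.
  have pz : (p : int) != 0 by rewrite -lt0n prime_gt0.
  pose z i := absz ((- u * c (lift ord0 i)) %% p)%Z.
  have zp i : (z i < p)%N.
    by rewrite -ltz_nat /z gez0_abs ?modz_ge0// ltz_pmod// ltz_nat prime_gt0.
  exists (fun i => Ordinal (zp i)).
  have zE i : exists w : int, (z i)%:R = (- u * c (lift ord0 i) - w * p)%:~R :> K.
    exists ((- u * c (lift ord0 i)) %/ p)%Z.
    have -> : - u * c (lift ord0 i) - ((- u * c (lift ord0 i)) %/ p)%Z * p =
        ((- u * c (lift ord0 i)) %% p)%Z.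
      by rewrite {1}(divz_eq (- u * c (lift ord0 i)) p) addrAC subrr add0r.
    by rewrite pmulrn /z gez0_abs ?modz_ge0.
  pose w i := projT1 (cid (zE i)); have wE i := projT2 (cid (zE i)).
  have -> : x - \sum_j (Ordinal (zp j) : nat)%:R * b j
    = u%:~R * ((c ord0)%:~R * x + S) + p%:R * (v%:~R * x + \sum_j (w j)%:~R * b j).
    transitivity ((u * c ord0 + v * p)%:~R * x - \sum_j (Ordinal (zp j) : nat)%:R * b j).
      by rewrite uv1 mul1r.
    have -> : \sum_j (Ordinal (zp j) : nat)%:R * b j =
       - (u%:~R * S) - p%:R * \sum_j (w j)%:~R * b j.
      rewrite /S !mulr_sumr -!sumrN -big_split /=; apply: eq_bigr => j _.
      rewrite wE -/(w j) rmorphB !rmorphM rmorphN /=; ring.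
    rewrite rmorphD !rmorphM /=; ring.
  apply: (padic_addl pr_p fP).
    rewrite (absvalM fA); apply: le_trans hS.
    by rewrite ler_piMl ?(absval_ge0 fA) ?(padic_int_le1 pr_p fP).
  rewrite (absvalM fA) (padic_p pr_p fP) ler_piMr ?invr_ge0//.
  apply: (padic_addl pr_p fP).
    by rewrite (absvalM fA) mulr_ile1 ?(absval_ge0 fA) ?(padic_int_le1 pr_p fP).
  apply: (padic_sum_le pr_p fP) => // j _.
  by rewrite (absvalM fA) mulr_ile1 ?(absval_ge0 fA) ?(padic_int_le1 pr_p fP).
move=> i; case: (unliftP ord0 i) => [j ->|->//].
apply: (bF (fun j => c (lift ord0 j))).
have -> : \sum_j (c (lift ord0 j))%:~R * b j = ((c ord0)%:~R * x + S) - (c ord0)%:~R * x.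
  by rewrite addrC addKr.
apply: (padic_subl pr_p fP) => //; rewrite (absvalM fA) -[X in _ <= X]mulr1.
by rewrite ler_pM ?(absval_ge0 fA)// (padic_int_small pr_p fP).
Qed.

(** Every place contributes at least 1 to the sum of the [r i], so there are at most [\dim {:K}]
    places over [p], and a family of maximal length contains them all. *)
Lemma places_over_prime : exists s (W : 'I_s -> K -> R) (r : 'I_s -> nat) (b : forall i, 'I_(r i) -> K),
  [/\ injective W, forall i, is_padic_place p (W i), (\sum_i r i <= \dim {:K})%N,
    forall i, residue_free p (W i) (b i) /\ residue_spans p (W i) (b i)
    & forall f, is_padic_place p f -> exists i, W i = f].
Proof.
pose P s := `[< exists W : 'I_s -> K -> R, injective W /\ forall i, is_padic_place p (W i) >].
have bas s (W : 'I_s -> K -> R) : (forall i, is_padic_place p (W i)) ->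
    exists (r : 'I_s -> nat) (b : forall i, 'I_(r i) -> K),
    forall i, residue_free p (W i) (b i) /\ residue_spans p (W i) (b i).
  move=> WP; have h i := cid (residue_basis_exists (WP i)).
  exists (fun i => projT1 (h i)), (fun i => projT1 (cid (projT2 (h i)))) => i.
  exact: (projT2 (cid (projT2 (h i)))).
have rk1 f r (b : 'I_r -> K) : is_padic_place p f -> residue_spans p f b -> (0 < r)%N.
  move=> fP bs; case: r b bs => // b /(_ 1)[|c]; first by rewrite (absval1 (proj1 fP)).
  by rewrite big_ord0 subr0 (absval1 (proj1 fP)) leNgt invf_lt1// p1.
have ex : exists s, P s.
  have W0 : 'I_0 -> K -> R by case.
  by exists 0%N; apply/asboolP; exists W0; split => [[]|[]].
have bnd s : P s -> (s <= \dim {:K})%N.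
  move=> /asboolP[W [WI WP]]; have [r [b bP]] := bas s W WP.
  apply: leq_trans (residue_free_sum WI WP (fun i => proj1 (bP i))).
  rewrite -[X in (X <= _)%N]card_ord -sum1_card leq_sum// => i _.
  exact: (rk1 (W i) _ (b i) (WP i) (proj2 (bP i))).
have [s /asboolP[W [WI WP]] smax] := ex_maxnP ex bnd.
have [r [b bP]] := bas s W WP; exists s, W, r, b; split=> //.
  exact: residue_free_sum WI WP (fun i => proj1 (bP i)).
move=> f fP; apply: contrapT => hf.
suff : P s.+1 by move=> /smax; rewrite ltnn.
apply/asboolP; exists (fun i => if unlift ord0 i is Some i' then W i' else f).
split=> [i j|i]; last by case: unliftP.
case: (unliftP ord0 i) => [i' ->|->]; case: (unliftP ord0 j) => [j' ->|->] //.
- by move=> /WI ->.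
- by move=> h; case: hf; exists i'.
- by move=> h; case: hf; exists j'.
Qed.
End PlacesOverPrime.

(** * Maximal subrings excluding an element are valuation rings *)

Section ValuationRing.
Variable (K : fieldType).
Implicit Types (V : set K) (x y z t : K).

Definition subring_set V : Prop :=
  V 1 /\ (forall x y, V x -> V y -> V (x - y)) /\ (forall x y, V x -> V y -> V (x * y)).

Section Closure.
Variable V : set K.
Hypothesis Vr : subring_set V.

Lemma subring1 : V 1. Proof. by case: Vr. Qed.
Lemma subringB x y : V x -> V y -> V (x - y). Proof. by case: Vr => _ []; auto. Qed.
Lemma subringM x y : V x -> V y -> V (x * y). Proof. by case: Vr => _ []; auto. Qed.
Lemma subring0 : V 0. Proof. by rewrite -(subrr 1); apply: subringB; apply: subring1. Qed.
Lemma subringN x : V x -> V (- x).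
Proof. by move=> h; rewrite -sub0r; apply: subringB => //; apply: subring0. Qed.
Lemma subringD x y : V x -> V y -> V (x + y).
Proof. by move=> hx hy; rewrite -[y]opprK; apply: subringB => //; apply: subringN. Qed.
Lemma subringX x k : V x -> V (x ^+ k).
Proof. by move=> h; elim: k => [|k IH]; [apply: subring1 | rewrite exprS; apply: subringM]. Qed.
Lemma subring_sum (J : Type) (s : seq J) (P : pred J) (u : J -> K) :
  (forall j, P j -> V (u j)) -> V (\sum_(j <- s | P j) u j).
Proof. by move=> h; elim/big_ind : _ => //; [apply: subring0 | apply: subringD]. Qed.
Lemma subring_nat k : V k%:R.
Proof. by elim: k => [|k IH]; [apply: subring0 | rewrite -natr1; apply: subringD => //; apply: subring1]. Qed.
Lemma subring_int (k : int) : V k%:~R.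
Proof. by case: k => k; rewrite ?NegzE ?mulrNz; [|apply: subringN]; apply: subring_nat. Qed.

Definition adjoin x : set K := [set y | exists q : {poly K}, (forall i, V q`_i) /\ y = q.[x]].

Lemma adjoin_subring x : subring_set (adjoin x).
Proof.
split; first by exists 1; split; [move=> i; rewrite coef1; case: eqP => _; [apply: subring1|apply: subring0] | rewrite hornerE].
split=> _ _ [q [qV ->]] [r [rV ->]].
  by exists (q - r); split=> [i|]; rewrite ?coefB ?hornerE//; apply: subringB.
exists (q * r); split=> [i|]; rewrite ?hornerM//.
by rewrite coefM; apply: subring_sum => j _; apply: subringM.
Qed.

Lemma sub_adjoin x y : V y -> adjoin x y.
Proof.
move=> Vy; exists y%:P; split=> [i|]; rewrite ?hornerE//.
by rewrite coefC; case: eqP => _ //; apply: subring0.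
Qed.

Lemma gen_adjoin x : adjoin x x.
Proof.
exists 'X; split=> [i|]; rewrite ?hornerE// coefX.
by case: eqP => _; [apply: subring1|apply: subring0].
Qed.
End Closure.

Lemma maximal_subring_excluding V0 t y : subring_set V0 -> V0 t -> ~ V0 y ->
  exists V, [/\ subring_set V, V t, ~ V y &
    forall B, subring_set B -> V `<=` B -> ~ B y -> B `<=` V].
Proof.
move=> V0r V0t V0y.
pose P : set (set K) := [set A | A = set0 \/ [/\ subring_set A, A t & ~ A y]].
have [A [PA Amax]] : exists A : set K, P A /\ (forall B : set K, A `<` B -> ~ P B).
  apply: Zorn_bigcup => F FP Ft.
  have [[A [FA An0]]|h] := pselect (exists A, F A /\ A <> set0); last first.
    left; apply/seteqP; split=> // x [A FA Ax]; apply: h; exists A; split=> //.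
    by move=> A0; rewrite A0 in Ax.
  have big B x : F B -> B x -> exists C, [/\ F C, subring_set C, C t, ~ C y & C x].
    move=> FB Bx; exists B; have [B0|[]//] := FP _ FB.
    by rewrite B0 in Bx.
  have two x z : (\bigcup_(X in F) X) x -> (\bigcup_(X in F) X) z ->
      exists C, [/\ F C, subring_set C, C x & C z].
    move=> [B FB Bx] [C FC Cz].
    have [B' [FB' B'r _ _ B'x]] := big _ _ FB Bx; have [C' [FC' C'r _ _ C'z]] := big _ _ FC Cz.
    have [h|h] := Ft _ _ FB' FC'; first by exists C'; split=> //; apply: h.
    by exists B'; split=> //; apply: h.
  have [//|[Ar At Ay]] := FP _ FA.
  right; split.
  - split; first by exists A => //; apply: subring1.
    split=> x z hx hz; have [C [FC Cr Cx Cz]] := two _ _ hx hz; exists C => //.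
      exact: subringB.
    exact: subringM.
  - by exists A.
  - by move=> [B FB By]; have [C [_ _ _ Cy /Cy]] := big _ _ FB By.
have Ane : [/\ subring_set A, A t & ~ A y].
  case: PA => // A0; case: (Amax V0); last by right.
  rewrite A0; split; first by move=> x [].
  by move=> /(_ _ V0t).
have [Ar At Ay] := Ane; exists A; split=> // B Br AB By; apply: contrapT => nBA.
by apply: (Amax B); [split | right; split=> //; apply: AB].
Qed.

Section Maximal.
Variables (V : set K) (y : K).
Hypotheses (Vr : subring_set V) (y0 : y != 0) (Vt : V y^-1) (Vy : ~ V y).
Hypothesis Vmax : forall B, subring_set B -> V `<=` B -> ~ B y -> B `<=` V.
Local Notation t := y^-1.

(** By maximality V[x] contains [y]; multiplied by [t], this says that [t] generates the unit ideal
    of V[x]. *)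
Let adjoin_y x : ~ V x -> exists q : {poly K}, (forall i, V q`_i) /\ 1 = t * q.[x].
Proof.
move=> Vx; have [[q [qV qy]]|h] := pselect (adjoin V x y).
  by exists q; split=> //; rewrite -qy mulVf.
case: Vx; apply: (Vmax (adjoin_subring Vr x) _ h); last exact: gen_adjoin.
by move=> z; apply: sub_adjoin.
Qed.

(** Thus [t] lies in the Jacobson radical. If u^-1 were outside [V], clearing denominators in 1 = t
    q(u^-1) would put a power of [u] in tV; that power is also 1 modulo tV, so 1 would lie in tV and
    [y] in [V]. *)
Lemma maximal_subring_jacobson b : V b -> 1 - t * b != 0 /\ V (1 - t * b)^-1.
Proof.
move=> Vb; set u := 1 - t * b.
have u0 : u != 0.
  apply/eqP => /eqP; rewrite subr_eq0 => /eqP h; apply: Vy.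
  by have -> : y = b by rewrite -[LHS]mulr1 h mulrA divff// mul1r.
split=> //; apply: contrapT => /adjoin_y[q [qV q1]].
have upow k : exists2 c, V c & u ^+ k = 1 - t * c.
  elim: k => [|k [c Vc ck]]; first by exists 0; [apply: subring0 | rewrite mulr0 subr0].
  exists (c + b - t * (b * c)); last by rewrite exprS ck /u; ring.
  by apply: (subringB Vr); [apply: (subringD Vr) | do 2 apply: (subringM Vr) => //].
have [c Vc ck] := upow (size q).
apply: Vy; pose w := \sum_(i < size q) q`_i * u ^+ (size q - i).
have Vw : V w.
  apply: (subring_sum Vr) => i _; apply: (subringM Vr) => //; apply: (subringX Vr).
  by apply: (subringB Vr); [apply: subring1 | apply: (subringM Vr)].
have : u ^+ size q = t * w.
  rewrite -[LHS]mulr1 q1 mulrCA; congr (_ * _); rewrite horner_coef mulr_sumr.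
  apply: eq_bigr => i _; rewrite mulrCA; congr (_ * _); rewrite exprVn.
  have -> : u ^+ size q = u ^+ (size q - i) * u ^+ i by rewrite -exprD subnK// ltnW.
  by rewrite mulfK// expf_neq0.
rewrite ck => /eqP; rewrite subr_eq -mulrDr => /eqP h.
have -> : y = w + c by rewrite -[LHS]mulr1 h mulrA divff// mul1r.
exact: (subringD Vr).
Qed.

Let rel x n := `[< exists q : {poly K}, [/\ (forall i, V q`_i), (size q <= n.+1)%N & 1 = t * q.[x]] >].

Let rel_exists x : ~ V x -> exists n, rel x n.
Proof.
move=> /adjoin_y[q [qV q1]]; exists (size q); apply/asboolP; exists q; split=> //.
Qed.

Let rel0 x : ~ rel x 0.
Proof.
move=> /asboolP[q [qV /size1_polyC -> ]]; rewrite hornerE => h; apply: Vy.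
suff -> : y = q`_0 by [].
by rewrite -[LHS]mulr1 h mulrA divff// mul1r.
Qed.

(** The constant term of the relation for [x^-1] is moved to the left, where it leaves the unit [v].
    Dividing by [v] and multiplying by [x ^+ n.+1] expresses this power through lower ones, which
    removes the top term of the relation for [x]. *)
Let rel_decr x n m : x != 0 -> (m <= n.+1)%N -> rel x n.+1 -> rel x^-1 m -> rel x n.
Proof.
move=> x0 mn /asboolP[q [qV qs q1]] /asboolP[b [bV bs b1]].
have [v0 Vv] := maximal_subring_jacobson (bV 0%N).
set v := 1 - t * b`_0 in v0 Vv.
pose r : {poly K} := \sum_(i < m) (v^-1 * (t * b`_i.+1)) *: 'X^(n - i).
have rV i : V r`_i.
  rewrite coef_sum; apply: (subring_sum Vr) => j _; rewrite coefZ coefXn.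
  apply: (subringM Vr); first by do 2 apply: (subringM Vr) => //.
  by case: eqP => _; [apply: subring1|apply: subring0].
have rs : (size r <= n.+1)%N.
  apply: (leq_trans (size_sum _ _ _)); apply/bigmax_leqP => i _.
  by apply: leq_trans (size_scale_leq _ _) _; rewrite size_polyXn ltnS leq_subr.
have rx : r.[x] = x ^+ n.+1.
  have vE : v = \sum_(i < m) t * (b`_i.+1 * x^-1 ^+ i.+1).
    rewrite /v {1}b1 (horner_coef_wide _ bs) big_ord_recl mulr1 mulrDr addrAC subrr add0r.
    by rewrite mulr_sumr.
  rewrite horner_sum -[RHS]mul1r -(mulVf v0) [X in v^-1 * X]vE -mulrA mulr_suml mulr_sumr.
  apply: eq_bigr => i _; rewrite hornerE hornerXn -!mulrA; congr (_ * (_ * (_ * _))).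
  have im : (i <= n)%N by rewrite -ltnS (leq_trans (ltn_ord i)).
  have -> : x ^+ n.+1 = x ^+ (n - i) * x ^+ i.+1 by rewrite -exprD addnS subnK.
  by rewrite exprVn mulrCA mulVf ?mulr1// expf_neq0.
apply/asboolP; exists (take_poly n.+1 q + q`_n.+1 *: r); split.
- move=> i; rewrite coefD coefZ coef_take_poly; apply: (subringD Vr).
    by case: ifP => // _; apply: subring0.
  by apply: (subringM Vr).
- apply: (leq_trans (size_polyD _ _)); rewrite geq_max size_take_poly/=.
  exact: leq_trans (size_scale_leq _ _) rs.
- rewrite q1; congr (_ * _); rewrite hornerD hornerZ rx (horner_coef_wide _ qs) big_ord_recr /=.
  congr (_ + _); rewrite (horner_coef_wide _ (size_take_poly _ _)); apply: eq_bigr => i _.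
  by rewrite coef_take_poly ltn_ord.
Qed.

(** If [x] and [x^-1] were both outside [V], each would have a relation of least degree, and the one
    of larger degree could be shortened by the other. *)
Lemma maximal_subring_valuation x : V x \/ V x^-1.
Proof.
have [->|x0] := eqVneq x 0; first by left; apply: subring0.
apply: contrapT => /not_orP[Vx Vx'].
have [n nP nmin] := ex_minnP (rel_exists Vx); have [m mP mmin] := ex_minnP (rel_exists Vx').
case: n nP nmin => [/rel0//|n] nP nmin; case: m mP mmin => [/rel0//|m] mP mmin.
have [mn|/ltnW nm] := leqP m.+1 n.+1.
  by have /nmin := rel_decr x0 mn nP mP; rewrite ltnn.
have x0' : x^-1 != 0 by rewrite invr_eq0.
have := rel_decr x0' nm mP; rewrite invrK => /(_ nP) /mmin; by rewrite ltnn.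
Qed.
End Maximal.
End ValuationRing.

(** * The p-adic place attached to a valuation ring of a number field *)

Section ValuationPlace.
Variables (R : realType) (K : fieldExtType rat) (V : set K) (y : K).
Hypotheses (Vr : subring_set V) (Vval : forall x, V x \/ V x^-1).
Hypotheses (y0 : y != 0) (Vt : V y^-1) (Vy : ~ V y).
Implicit Types (x z u : K).

Let V1 := subring1 Vr.
Let VM := subringM Vr.
Let VD := subringD Vr.
Let VB := subringB Vr.
Let VX := subringX Vr.

Definition vunit u : Prop := [/\ u != 0, V u & V u^-1].

Let vunitM u z : vunit u -> vunit z -> vunit (u * z).
Proof. by move=> [u0 uV uI] [z0 zV zI]; split; [by apply: mulf_neq0| |rewrite invfM]; apply: VM. Qed.
Let vunitV u : vunit u -> vunit u^-1.
Proof. by move=> [u0 uV uI]; split; rewrite ?invr_eq0 ?invrK. Qed.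
Let vunit1 : vunit 1. Proof. by split; rewrite ?invr1 ?oner_eq0. Qed.
Let vunitX u k : vunit u -> vunit (u ^+ k).
Proof. by move=> h; elim: k => [|k IH]; rewrite ?expr0 ?exprS; [exact: vunit1 | exact: vunitM]. Qed.

Definition vnonunit x : Prop := V x /\ (x = 0 \/ ~ V x^-1).

(** Of two elements one divides the other in [V]; it then divides the difference as well, and would
    be a unit if the difference were one. *)
Let vnonunitB x z : vnonunit x -> vnonunit z -> vnonunit (x - z).
Proof.
move=> [Vx hx] [Vz hz]; split; first exact: VB.
have [d0|d0] := eqVneq (x - z) 0; [by left | right => hV].
have [xE|x0] := eqVneq x 0.
  move: hV; rewrite xE sub0r; case: hz => [zE|nz]; first by rewrite xE zE subrr eqxx in d0.
  by rewrite invrN => h; apply: nz; rewrite -[_^-1]opprK; apply: (subringN Vr).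
have [zE|z0] := eqVneq z 0.
  by move: hV; rewrite zE subr0; case: hx => [xE|//]; rewrite xE eqxx in x0.
case: hx => [xE|nx]; first by rewrite xE eqxx in x0.
case: hz => [zE|nz]; first by rewrite zE eqxx in z0.
have [h|h] := Vval (x / z).
  apply: nz; have -> : z^-1 = (x / z - 1) * (x - z)^-1; last by apply: VM => //; apply: VB.
  by field; rewrite d0 z0.
apply: nx; have -> : x^-1 = (1 - (x / z)^-1) * (x - z)^-1; last by apply: VM => //; apply: VB.
by field; rewrite d0 x0 z0.
Qed.

Let vunit_or x : V x -> vunit x \/ vnonunit x.
Proof.
move=> Vx; have [x0|x0] := eqVneq x 0; first by right; split=> //; left.
have [h|h] := pselect (V x^-1); first by left.
by right; split=> //; right.
Qed.

Let vunit_not x : vunit x -> vnonunit x -> False.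
Proof. by move=> [x0 Vx VI] [_ [xE|//]]; rewrite xE eqxx in x0. Qed.

Let vunitD u z : vunit u -> vnonunit z -> vunit (u + z).
Proof.
move=> hu hz; have Vuz : V (u + z) by apply: VD; [case: hu | case: hz].
have [//|h] := vunit_or Vuz; case: (vunit_not hu).
by rewrite -[u](addrK z); apply: vnonunitB.
Qed.

Lemma alg_relation x : exists2 q : {poly rat}, q != 0 & \sum_(i < size q) (q`_i)%:A * x ^+ i = 0.
Proof.
have [|q [[j0 qj0] qx]] := rat_family_dependent (J := 'I_(\dim {:K}).+1) (fun i => x ^+ i).
  by rewrite card_ord.
pose Q : {poly rat} := \poly_(i < (\dim {:K}).+1) q (inord i).
have Qi (i : 'I_(\dim {:K}).+1) : Q`_i = q i by rewrite coef_poly ltn_ord inord_val.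
exists Q; first by apply: contraNneq qj0 => Q0; rewrite -Qi Q0 coef0.
rewrite -[RHS]qx; under [RHS]eq_bigr do rewrite -Qi.
rewrite (big_ord_widen _ (fun i => (Q`_i)%:A * x ^+ i) (size_poly _ _)) big_mkcond /=.
apply: eq_bigr => i _; case: ifPn => //; rewrite -leqNgt => h.
by rewrite nth_default// scale0r mul0r.
Qed.

Let Kchar k : (0 < k)%N -> (k%:R : K) != 0.
Proof. by move=> k0; rewrite -(ratr_nat K) -alg_num_field scaler_eq0 oner_eq0 orbF pnatr_eq0 -lt0n. Qed.

(** Otherwise [V] contains Q, and an algebraic equation of [y], divided by a power of [y], writes
    [y] as a polynomial in [y^-1] over Q, hence as an element of [V]. *)
Let nonunit_prime : exists2 p, prime p & ~ V (p%:R)^-1.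
Proof.
apply: contrapT => h.
have hp p : prime p -> V (p%:R)^-1.
  by move=> pp; apply: contrapT => hV; apply: h; exists p.
have hn k : V (k%:R)^-1.
  case: (posnP k) => [->|k0]; first by rewrite invr0; apply: subring0.
  rewrite [k in V k%:R^-1](prod_prime_decomp k0) prime_decompE big_map /=.
  rewrite natr_prod -prodfV big_seq; elim/big_ind : _ => //.
  by move=> p; rewrite mem_primes => /andP[/hp Vp _]; rewrite natrX -exprVn; apply: VX.
have hq (q : rat) : V q%:A.
  rewrite alg_num_field /ratr; apply: VM; first exact: (subring_int Vr).
  by have -> : (denq q)%:~R = (absz (denq q))%:R :> K by rewrite pmulrn gez0_abs// ltW// denq_gt0.
have [q q0 qy] := alg_relation y.
have lq : lead_coef q != 0 by rewrite lead_coef_eq0.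
case: (posnP (size q)) => [/eqP|]; first by rewrite size_poly_eq0 (negbTE q0).
move=> sq; apply: Vy; pose n := (size q).-1.
have sE : size q = n.+1 by rewrite prednK.
have yE : y = - \sum_(i < n) (q`_i / lead_coef q)%:A * y^-1 ^+ (n.-1 - i).
  case: (posnP n) => n0.
    move: qy; rewrite sE n0 big_ord_recl big_ord0 addr0 mulr1 => /eqP.
    rewrite scaler_eq0 oner_eq0 orbF; move: lq; rewrite lead_coefE sE n0 /= => /negbTE.
    by move=> ->.
  have yn : y ^+ n.-1 != 0 by apply: expf_neq0.
  apply: (mulIf yn); rewrite -exprS prednK// mulNr mulr_suml.
  move: qy; rewrite sE big_ord_recr /= => /eqP; rewrite addrC addr_eq0 => /eqP hy.
  have -> : y ^+ n = ((lead_coef q)^-1)%:A * ((q`_n)%:A * y ^+ n).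
    by rewrite -[q`_n]lead_coefE !mulr_algl scalerA mulVf// scale1r.
  rewrite hy mulrN mulr_sumr; congr (- _); apply: eq_bigr => i _.
  rewrite !mulr_algl scalerA mulrC -!scalerAl; congr (_ *: _).
  have im : (i <= n.-1)%N by rewrite -ltnS prednK.
  rewrite -[X in _ = _ * y ^+ X](subnK im) exprD mulrA exprVn mulVf ?mul1r// expf_neq0//.
rewrite yE; apply: (subringN Vr); apply: (subring_sum Vr) => i _; apply: VM => //; exact: VX.
Qed.

Let p := s2val (cid2 nonunit_prime).
Let pr_p : prime p := s2valP (cid2 nonunit_prime).
Let Vp : ~ V (p%:R)^-1 := s2valP' (cid2 nonunit_prime).
Let pK : (p%:R : K) != 0. Proof. by rewrite Kchar// prime_gt0. Qed.

Let coprime_unit n : (0 < n)%N -> coprime n p -> vunit n%:R.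
Proof.
move=> n0 /eqP cnp; have nK := Kchar n0; split=> //; first exact: (subring_nat Vr).
have [u [v uv]] := Bezoutz n p.
have uv1 : u%:~R * n%:R + v%:~R * p%:R = 1 :> K.
  rewrite !pmulrn -!intrM -intrD uv /gcdz /= cnp//.
have [h|h] := Vval (n%:R / p%:R).
  case: Vp; have -> : (p%:R)^-1 = u%:~R * (n%:R / p%:R) + v%:~R :> K.
    by apply: (mulIf pK); rewrite mulrDl -mulrA divfK// uv1 mulVf.
  by apply: VD; [apply: VM => //|]; apply: (subring_int Vr).
have -> : (n%:R)^-1 = u%:~R + v%:~R * (p%:R / n%:R) :> K.
  by apply: (mulIf nK); rewrite mulrDl -mulrA divfK// uv1 mulVf.
apply: VD; first exact: (subring_int Vr).
by apply: VM; [apply: (subring_int Vr) | move: h; rewrite invf_div].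
Qed.

Let nat_unit n : (0 < n)%N -> exists2 u, vunit u & n%:R = p%:R ^+ logn p n * u.
Proof.
move=> n0; have [m cm nE] := pfactor_coprime pr_p n0.
have m0 : (0 < m)%N by move: n0; rewrite nE muln_gt0 => /andP[].
exists m%:R; first by apply: coprime_unit => //; rewrite coprime_sym.
by rewrite {1}nE natrM natrX mulrC.
Qed.

Let powp_le (k l : nat) u : vunit u -> p%:R ^+ k * u = p%:R ^+ l -> (l <= k)%N.
Proof.
move=> uU h; rewrite leqNgt; apply/negP => kl; apply: Vp.
have uE : u = p%:R * p%:R ^+ (l - k).-1.
  rewrite -exprS prednK ?subn_gt0//; apply: (mulfI (expf_neq0 k pK)).
  by rewrite h -exprD subnKC// ltnW.
have -> : (p%:R)^-1 = u^-1 * p%:R ^+ (l - k).-1.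
  have [u0 _ _] := uU; apply: (mulfI u0).
  by rewrite mulrA divff// mul1r {1}uE mulrAC divff// mul1r.
by have [_ _ uI] := uU; apply: VM => //; apply: VX; apply: (subring_nat Vr).
Qed.

Let powp_eq (k l : nat) u u' : vunit u -> vunit u' -> p%:R ^+ k * u = p%:R ^+ l * u' -> k = l.
Proof.
move=> hu hu' h; apply/eqP; rewrite eqn_leq; have [u0 _ _] := hu; have [u0' _ _] := hu'.
apply/andP; split.
  apply: (powp_le (u := u' / u)); first by apply: vunitM => //; apply: vunitV.
  by rewrite mulrA -h mulfK.
apply: (powp_le (u := u / u')); first by apply: vunitM => //; apply: vunitV.
by rewrite mulrA h mulfK.
Qed.

(* Then x^b = p^(a - c) up to a unit, so (a - c) / b is the p-adic order of x. *)
Definition vrel x (a c b : nat) : Prop :=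
  (0 < b)%N /\ exists2 u, vunit u & x ^+ b * p%:R ^+ c = p%:R ^+ a * u.

(* If no two terms have unit quotient, the dominant one cannot be cancelled. *)
Let dominant (J : eqType) (s : seq J) (T : J -> K) : (forall j, j \in s -> T j != 0) -> uniq s ->
  (exists i j, [/\ i \in s, j \in s, i != j & vunit (T i / T j)]) \/
  (s = [::] \/ exists k u, [/\ k \in s, vunit u & \sum_(j <- s) T j = T k * u]).
Proof.
elim: s => [|i s IH] hT; first by right; left.
move=> /= /andP[nis us].
have hs j : j \in s -> T j != 0 by move=> js; apply: hT; rewrite inE js orbT.
have Ti : T i != 0 by apply: hT; rewrite inE eqxx.
case: (IH hs us) => [[k [l [ks ls kl h]]]|].
  by left; exists k, l; rewrite !inE ks ls !orbT.
move=> [s0|[k [u [ks uU sE]]]].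
  right; right; exists i, 1; split=> //; first by rewrite inE eqxx.
  by rewrite s0 big_seq1 mulr1.
have Tk := hs _ ks; have ik : i != k by apply: contraNneq nis => ->.
have dec (a b : K) : a != 0 -> b != 0 -> V (a / b) -> vunit (a / b) \/ vnonunit (a / b).
  by move=> a0 b0; apply: vunit_or.
have [h|h] := Vval (T i / T k).
  have [hu|hn] := dec _ _ Ti Tk h.
    by left; exists i, k; rewrite !inE eqxx ks orbT.
  right; right; exists k, (u + T i / T k); split; first by rewrite inE ks orbT.
    exact: vunitD.
  by rewrite big_cons sE mulrDr mulrCA divff// mulr1 addrC.
rewrite invf_div in h; have [hu|hn] := dec _ _ Tk Ti h.
  by left; exists k, i; rewrite !inE eqxx ks orbT eq_sym.
right; right; exists i, (1 + T k / T i * u); split; first by rewrite inE eqxx.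
  apply: vunitD => //; have [u0 uV uI] := uU.
  have [hV hx] := hn; split; first exact: VM.
  right => hI; have [hE|hx'] := hx.
    by move/eqP: hE; rewrite mulf_eq0 invr_eq0 (negbTE Ti) (negbTE Tk).
  apply: hx'; have -> : (T k / T i)^-1 = u * (T k / T i * u)^-1; last exact: VM.
  by rewrite [in RHS]invfM mulrCA divff// mulr1.
by rewrite big_cons sE mulrDr mulr1 -!mulrA [T i * _]mulrCA mulVKf// .
Qed.

Let rat_val (q : rat) : q != 0 -> exists a c u, vunit u /\ q%:A * p%:R ^+ c = p%:R ^+ a * u.
Proof.
move=> q0; have nq : (0 < absz (numq q))%N by rewrite absz_gt0 numq_eq0.
have dq : (0 < absz (denq q))%N by rewrite absz_gt0 denq_eq0.
have [u uU uE] := nat_unit nq; have [w wU wE] := nat_unit dq.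
exists (logn p (absz (numq q))), (logn p (absz (denq q))).
have dE : (denq q)%:~R = (absz (denq q))%:R :> K by rewrite pmulrn gez0_abs// ltW// denq_gt0.
have nE : (numq q)%:~R = (-1) ^+ (numq q < 0)%R * (absz (numq q))%:R :> K.
  by rewrite {1}[numq q]intEsign rmorphM rmorphXn /= rmorphN1.
exists ((-1) ^+ (numq q < 0)%R * u / w); split.
  apply: vunitM; last exact: vunitV.
  apply: vunitM => //; apply: vunitX; split; rewrite ?oppr_eq0 ?oner_eq0 ?invrN1//; exact: (subringN Vr).
rewrite alg_num_field /ratr dE nE uE wE.
have [w0 _ _] := wU; have pn := expf_neq0 (logn p `|denq q|) pK.
have alg (e A B C D : K) : B != 0 -> D != 0 -> e * (A * C) / (B * D) * B = A * (e * C / D).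
  by move=> B0 D0; field; rewrite B0 D0.
exact: alg.
Qed.

(** The terms of an algebraic equation of [x] sum to 0, so by [dominant] two of them have a unit as
    quotient. A positive power of [x] is then a rational number up to a unit, and a rational number
    is a power of [p] up to a unit. This is why the value group has rank one. *)
Lemma vrel_exists x : x != 0 -> exists a c b, vrel x a c b.
Proof.
move=> x0; have [q q0 qx] := alg_relation x.
pose s := [seq i <- iota 0 (size q) | q`_i != 0].
have us : uniq s by rewrite filter_uniq// iota_uniq.
pose T i := (q`_i)%:A * x ^+ i.
have sT i : i \in s -> T i != 0.
  rewrite mem_filter => /andP[qi _]; rewrite mulf_neq0 ?expf_neq0//.
  by rewrite scaler_eq0 oner_eq0 orbF.
have sumT : \sum_(j <- s) T j = 0.
  rewrite big_filter big_mkcond /= -[RHS]qx -(big_mkord xpredT T) /index_iota subn0.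
  by apply: eq_bigr => i _; case: eqP => // qi; rewrite /T qi scale0r mul0r.
case: (dominant sT us) => [|[s0|[k [u [ks [u0 _ _] h]]]]]; last first.
- by move: h; rewrite sumT => /esym /eqP; rewrite mulf_eq0 (negbTE u0) orbF (negbTE (sT _ ks)).
- have : (size q).-1 \in s.
    rewrite mem_filter -lead_coefE lead_coef_eq0 q0 mem_iota /= add0n.
    by rewrite prednK// lt0n size_poly_eq0.
  by rewrite s0.
have main i j : i \in s -> j \in s -> (j < i)%N -> vunit (T i / T j) -> exists a c b, vrel x a c b.
  move=> is' js ji hu.
  have qi : q`_i != 0 by move: is'; rewrite mem_filter => /andP[].
  have qj : q`_j != 0 by move: js; rewrite mem_filter => /andP[].
  have [a [c [u [uU uE]]]] := rat_val qi; have [a' [c' [u' [uU' uE']]]] := rat_val qj.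
  have aK (k : nat) := expf_neq0 k pK.
  have q'K (r : rat) : r != 0 -> r%:A != 0 :> K by move=> r0; rewrite scaler_eq0 oner_eq0 orbF.
  exists (a' + c)%N, (a + c')%N, (i - j)%N; split; first by rewrite subn_gt0.
  exists ((T i / T j) * u' / u); first by apply: vunitM; [apply: vunitM|apply: vunitV].
  have [u0 _ _] := uU; apply: (mulIf u0); rewrite -[RHS]mulrA [X in _ = _ * X](divfK u0).
  have -> : T i / T j = (q`_i)%:A / (q`_j)%:A * x ^+ (i - j).
    have xi : x ^+ i = x ^+ (i - j) * x ^+ j by rewrite -exprD subnK// ltnW.
    rewrite /T xi invfM.
    have alg (A B C D : K) : B != 0 -> D != 0 -> A * (C * D) * (B^-1 * D^-1) = A / B * C.
      by move=> B0 D0; field; rewrite B0 D0.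
    by apply: alg; rewrite ?q'K ?expf_neq0.
  rewrite !exprD.
  have alg (X Pa Pc Pa' Pc' Qi Qj U U' : K) : Qj != 0 -> Qi * Pc = Pa * U -> Qj * Pc' = Pa' * U' ->
      X * (Pa * Pc') * U = Pa' * Pc * (Qi / Qj * X * U').
    move=> Qj0 E E'; have -> : X * (Pa * Pc') * U = X * Pc' * (Pa * U) by ring.
    have -> : Pa' * Pc * (Qi / Qj * X * U') = Qi / Qj * X * Pc * (Pa' * U') by ring.
    by rewrite -E -E'; field.
  exact: alg (q'K _ qj) uE uE'.
move=> [i [j [is' js ij h]]]; have [ji|ij'|ijE] := ltngtP j i.
- exact: main h.
- by apply: (main j i) => //; rewrite -invf_div; apply: vunitV.
- by rewrite ijE eqxx in ij.
Qed.

Let vrel_uniq x a c b a' c' b' : vrel x a c b -> vrel x a' c' b' ->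
  (a * b' + c' * b = a' * b + c * b')%N.
Proof.
move=> [b0 [u uU uE]] [b0' [u' uU' uE']].
apply: (powp_eq (u := u ^+ b') (u' := u' ^+ b)); do ?exact: vunitX.
have h1 := congr1 (fun z => z ^+ b') uE; have h2 := congr1 (fun z => z ^+ b) uE'.
rewrite /= !exprMn -!exprM in h1 h2; rewrite [(b' * b)%N]mulnC in h2.
rewrite !exprD [LHS]mulrAC [RHS]mulrAC -h1 -h2; ring.
Qed.

(** The additive valuation with value 1 at [p]; by [vrel_exists] the default 0 is taken only at
    [x = 0]. *)
Definition vorder x : R :=
  if pselect (exists abc : nat * nat * nat, vrel x abc.1.1 abc.1.2 abc.2) is left h
  then let: (a, c, b) := projT1 (cid h) in (a%:R - c%:R) / b%:R else 0.

Let vorderE x a c b : vrel x a c b -> vorder x = (a%:R - c%:R) / b%:R.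
Proof.
move=> h; rewrite /vorder; case: pselect => [h'|[]]; last by exists (a, c, b).
case: cid => -[[a' c'] b'] /= h2; have E := vrel_uniq h h2.
have [b0 _] := h; have [b0' _] := h2.
have bR : (b%:R : R) != 0 by rewrite pnatr_eq0 -lt0n.
have bR' : (b'%:R : R) != 0 by rewrite pnatr_eq0 -lt0n.
have := congr1 (fun k => k%:R : R) E; rewrite !natrD !natrM => E'.
apply/eqP; rewrite eqr_div//; apply/eqP; move: E'; nra.
Qed.

Let vorderM x z : x != 0 -> z != 0 -> vorder (x * z) = vorder x + vorder z.
Proof.
move=> x0 z0; have [a [c [b h]]] := vrel_exists x0; have [a' [c' [b' h']]] := vrel_exists z0.
have hM : vrel (x * z) (a * b' + a' * b) (c * b' + c' * b) (b * b').
  case: h h' => b0 [u uU uE] [b0' [u' uU' uE']]; split; first by rewrite muln_gt0 b0.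
  exists (u ^+ b' * u' ^+ b); first by apply: vunitM; apply: vunitX.
  have h1 := congr1 (fun z => z ^+ b') uE; have h2 := congr1 (fun z => z ^+ b) uE'.
  rewrite /= !exprMn -!exprM in h1 h2; rewrite [(b' * b)%N]mulnC in h2.
  rewrite exprMn !exprD; transitivity ((x ^+ (b * b') * p%:R ^+ (c * b')) * (z ^+ (b * b') * p%:R ^+ (c' * b))).
    by ring.
  by rewrite h1 h2; ring.
rewrite (vorderE h) (vorderE h') (vorderE hM) !natrD !natrM.
case: h h' => b0 _ [b0' _]; field.
by rewrite !pnatr_eq0 -!lt0n b0 b0'.
Qed.

Let vorder_ge0 x : x != 0 -> V x -> 0 <= vorder x.
Proof.
move=> x0 Vx; have [a [c [b h]]] := vrel_exists x0; rewrite (vorderE h).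
rewrite divr_ge0// subr_ge0 ler_nat leqNgt; apply/negP => ac; apply: Vp.
case: h => b0 [u [u0 uV uI] uE].
have -> : (p%:R)^-1 = x ^+ b * u^-1 * p%:R ^+ (c - a).-1.
  apply: (mulIf pK); rewrite mulVf// -[RHS]mulrA -exprSr prednK ?subn_gt0//.
  apply: (mulIf u0); apply: (mulfI (expf_neq0 a pK)); rewrite mul1r -uE.
  rewrite mulrAC divfK// mulrCA; congr (_ * _); rewrite -exprD subnKC// ltnW//.
by apply: VM; [apply: VM => //; apply: VX|apply: VX; apply: (subring_nat Vr)].
Qed.

Let vorder_t : 0 < vorder y^-1.
Proof.
have t0 : y^-1 != 0 by rewrite invr_eq0.
rewrite lt0r vorder_ge0// andbT; apply/eqP => h0; apply: Vy.
have [a [c [b h]]] := vrel_exists t0; move: h0; rewrite (vorderE h).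
case: h => b0 [u [u0 uV uI] uE] /eqP.
rewrite mulf_eq0 invr_eq0 pnatr_eq0 (gtn_eqF b0) orbF subr_eq0 eqr_nat => /eqP ac.
have tu : y^-1 ^+ b = u by apply: (mulIf (expf_neq0 c pK)); rewrite uE ac mulrC.
have -> : y = u^-1 * y^-1 ^+ b.-1.
  by rewrite -tu -{1}(prednK b0) exprS invfM invrK -mulrA mulVf ?mulr1// expf_neq0.
by apply: VM => //; apply: VX.
Qed.

(** The place is p^(-[vorder]). For the triangle inequality one may assume that [x / z] is in [V];
    then so is [x / z + 1], whose value is at most 1. *)
Lemma valuation_place : exists q f, [/\ prime q, is_padic_place q (f : K -> R) & 1 < f y].
Proof.
have lnp : 0 < ln (p%:R : R) by rewrite ln_gt0// ltr1n prime_gt1.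
pose f x : R := if x == 0 then 0 else expR (- vorder x * ln p%:R).
have fM x z : f (x * z) = f x * f z.
  rewrite /f mulf_eq0; case: eqP => [_|/eqP x0] /=; first by rewrite mul0r.
  case: eqP => [_|/eqP z0] /=; first by rewrite mulr0.
  by rewrite vorderM// -expRD opprD mulrDl.
have f0 x : 0 <= f x by rewrite /f; case: eqP => // _; apply: expR_ge0.
have f1 x : V x -> f x <= 1.
  move=> Vx; rewrite /f; case: eqP => [|/eqP x0]; first by rewrite ler01.
  by rewrite expR_le1 mulNr oppr_le0 mulr_ge0 ?vorder_ge0// ltW.
have feq0 x : f x = 0 <-> x = 0.
  rewrite /f; split=> [|->]; last by rewrite eqxx.
  by case: eqP => // _ /eqP; rewrite gt_eqF// expR_gt0.
have fD x z : z != 0 -> V (x / z) -> f (x + z) <= f x + f z.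
  move=> z0 h; have -> : x + z = (x / z + 1) * z by rewrite mulrDl divfK// mul1r.
  rewrite fM; apply: (@le_trans _ _ (f z)); last by rewrite lerDr.
  by rewrite ler_piMl// f1//; apply: VD.
have fA : is_absval f.
  split=> //; split=> //; split=> // x z.
  have [->|z0] := eqVneq z 0; first by rewrite addr0 lerDl.
  have [->|x0] := eqVneq x 0; first by rewrite add0r lerDr.
  have [h|h] := Vval (x / z); first exact: fD.
  by rewrite addrC [X in _ <= X]addrC; apply: fD => //; rewrite invf_div in h.
have expR_pX k : expR (- (k%:R * ln p%:R)) = (p%:R ^+ k)^-1 :> R.
  by rewrite expRN expRM_natl lnK// posrE ltr0n prime_gt0.
have fnat n : (0 < n)%N -> f n%:R = (p%:R ^+ logn p n)^-1.
  move=> n0; have [u uU nE] := nat_unit n0; rewrite /f (negbTE (Kchar n0)).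
  have h : vrel n%:R (logn p n) 0 1 by split=> //; exists u => //; rewrite mulr1 nE.
  by rewrite (vorderE h) subr0 divr1 mulNr expR_pX.
have fint (z : int) : f z%:~R = f (absz z)%:R.
  by case: z => n //=; rewrite NegzE mulrNz (absvalN fA).
exists p, f; split=> //.
  split=> // q; rewrite /ratr (absval_div fA) /padic_abs.
  case: eqP => [->|/eqP q0]; first by rewrite /numq /= (absval0 fA) mul0r.
  rewrite !fint !fnat ?absz_gt0 ?numq_eq0 ?denq_eq0// invrK mulrC.
  by [].
have -> : f y = (f y^-1)^-1 by rewrite (absvalV fA) invrK.
rewrite invf_gt1.
  by rewrite /f invr_eq0 (negbTE y0) expR_lt1 mulNr oppr_lt0 mulr_gt0// vorder_t.
by rewrite (absval_gt0 fA) invr_eq0.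
Qed.

End ValuationPlace.

(** * Integrality from the p-adic places *)

Section Integrality.
Variables (R : realType) (K : fieldExtType rat).

Let int_gen (t : K) : set K := [set x | exists q : {poly int}, x = (map_poly intr q).[t]].

Let int_gen_subring t : subring_set (int_gen t).
Proof.
split; first by exists 1; rewrite rmorph1 hornerE.
split=> _ _ [q ->] [r ->].
  by exists (q - r); rewrite rmorphB /= hornerD hornerN.
by exists (q * r); rewrite rmorphM /= hornerM.
Qed.

(* If y = q(1/y) with q integral of size n, then y^n = sum_i q_i y^(n-1-i). *)
Let integral_of_int_gen (y : K) : y != 0 -> int_gen y^-1 y -> is_integral y.
Proof.
move=> y0 [q yE]; pose n := size q.
have n0 : (0 < n)%N.
  rewrite lt0n; apply/eqP => /eqP; rewrite size_poly_eq0 => /eqP q0.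
  by move: y0; rewrite yE q0 rmorph0 horner0 eqxx.
pose r : {poly int} := \sum_(i < n) q`_i *: 'X^(n.-1 - i).
have rs : (size r <= n)%N.
  apply: (leq_trans (size_sum _ _ _)); apply/bigmax_leqP => i _.
  apply: leq_trans (size_scale_leq _ _) _; rewrite size_polyXn.
  by rewrite -[X in (_ <= X)%N](prednK n0) ltnS leq_subr.
exists ('X^n - r); split.
  by rewrite monicE lead_coefDl ?lead_coefXn// size_polyN size_polyXn ltnS.
rewrite /root rmorphB /= map_polyXn !hornerE subr_eq0; apply/eqP.
rewrite -{1}(prednK n0) exprS {1}yE rmorph_sum /= horner_sum.
rewrite (horner_coef_wide (n := n) _ (size_poly _ _)) mulr_suml.
apply: eq_bigr => i _; rewrite map_polyZ /= map_polyXn !hornerE coef_map /= -mulrA.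
congr (_ * _); have im : (i <= n.-1)%N by rewrite -ltnS prednK.
by rewrite -[X in _ * y ^+ X](subnK im) exprD exprVn mulrCA mulVf ?mulr1// expf_neq0.
Qed.

Lemma integral_of_padic_le1 (y : K) :
  (forall p (f : K -> R), prime p -> is_padic_place p f -> f y <= 1) -> is_integral y.
Proof.
move=> h; have [->|y0] := eqVneq y 0.
  by exists 'X; split; [apply: monicX | rewrite map_polyX /root hornerX].
have [|ny] := pselect (int_gen y^-1 y); first exact: integral_of_int_gen.
have tV : int_gen y^-1 y^-1 by exists 'X; rewrite map_polyX hornerX.
have [V [Vr Vt Vy Vmax]] := maximal_subring_excluding (int_gen_subring _) tV ny.
have Vval := maximal_subring_valuation Vr y0 Vt Vy Vmax.
have [q [f [pq fP fy]]] := valuation_place R Vr Vval y0 Vt Vy.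
by have := h q f pq fP; rewrite leNgt fy.
Qed.
End Integrality.

(** * Linear algebra over a subfield given as a set *)

Section Elimination.
Variables (F : fieldType) (P : set F).
Hypotheses (Pr : subring_set P) (PV : forall x, P x -> P x^-1).

(** Gaussian elimination on the first column, keeping all scalars in [P]. It will be applied to Q_v,
    which exists only as a subset of K_v. If the first column vanishes, division by 0 gives [q = 0]
    and any row can play the pivot. *)
Lemma subfield_elimination r (C : 'I_r.+1 -> 'I_r -> F) : (forall i k, P (C i k)) ->
  exists c : 'I_r.+1 -> F, [/\ forall i, P (c i), exists i, c i != 0 &
    forall k, \sum_i c i * C i k = 0].
Proof.
elim: r C => [|r IH] C PC.
  exists (fun=> 1); split; [by move=> _; apply: subring1 | by exists ord0; rewrite oner_eq0 | by case].
have [i0 hi0] : exists i0, C i0 ord0 != 0 \/ forall i, C i ord0 = 0.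
  have [[i hi]|h] := pselect (exists i, C i ord0 != 0); first by exists i; left.
  exists ord0; right => i; apply/eqP; apply: contraT => hi; case: h; by exists i.
pose q i := C i ord0 / C i0 ord0.
have Pq i : P (q i) by apply: (subringM Pr) => //; apply: PV.
have [|c' [Pc' [j0 hj0] hc']] := IH (fun i k => C (lift i0 i) (lift ord0 k) - q (lift i0 i) * C i0 (lift ord0 k)).
  by move=> i k; apply: (subringB Pr) => //; apply: (subringM Pr).
pose s := \sum_i c' i * q (lift i0 i).
exists (fun i => if unlift i0 i is Some i' then c' i' else - s); split.
- move=> i; case: unliftP => [j _|_] //; apply: (subringN Pr); apply: (subring_sum Pr) => j _.
  exact: (subringM Pr).
- by exists (lift i0 j0); rewrite liftK.
move=> k; rewrite (bigD1_ord i0)//= unlift_none.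
under eq_bigr do rewrite liftK.
rewrite mulNr /s mulr_suml addrC -sumrB.
case: (unliftP ord0 k) => [k' ->|->].
  by rewrite -[RHS](hc' k'); apply: eq_bigr => i _; rewrite mulrBr !mulrA.
rewrite big1// => i _; rewrite -mulrA -mulrBr; case: hi0 => h.
  by rewrite /q divfK// subrr mulr0.
by rewrite !h mulr0 subr0 mulr0.
Qed.
End Elimination.

(** * Local degrees of completions: the closure of Q, and the p-adic case *)

Section LocalDegree.
Variables (R : realType) (K : fieldExtType rat) (f : K -> R).
Variables (Kv : fieldType) (iota : {rmorphism K -> Kv}) (nv : Kv -> R).
Hypotheses (compl : is_completion f iota nv).

Let nA : is_absval nv. Proof. by case: compl. Qed.
Let nE x : nv (iota x) = f x. Proof. by case: compl => _ []. Qed.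
Let dens y e : 0 < e -> exists x, nv (y - iota x) < e.
Proof. by case: compl => _ [_ [_ h]]; apply: h. Qed.

Lemma absval_of_completion : is_absval f.
Proof.
split; first by move=> x; rewrite -nE absval_ge0.
split.
  move=> x; rewrite -nE; split=> [/eqP|->]; last by rewrite rmorph0 (absval0 nA).
  by rewrite (absval_eq0 nA) fmorph_eq0 => /eqP.
by split=> x y; rewrite -!nE ?rmorphM ?(absvalM nA)// rmorphD ler_absvalD.
Qed.
Let fA := absval_of_completion.

Lemma in_QvE y : in_Qv nv y <-> forall e, 0 < e -> exists q : rat, nv (y - iota q%:A) < e.
Proof.
have E (q : rat) : iota q%:A = ratr q by rewrite alg_num_field fmorph_rat.
by split=> h e /h[q hq]; exists q; rewrite ?E// -E.
Qed.

Lemma in_Qv_rat (q : rat) : in_Qv nv (iota q%:A).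
Proof. by apply/in_QvE => e e0; exists q; rewrite subrr (absval0 nA). Qed.

Lemma in_Qv_lim y : (forall e, 0 < e -> exists2 z, in_Qv nv z & nv (y - z) < e) -> in_Qv nv y.
Proof.
move=> h; apply/in_QvE => e e0; have e2 : 0 < e / 2 by lra.
have [z /in_QvE/(_ _ e2)[q hq] hz] := h _ e2; exists q.
have -> : y - iota q%:A = (y - z) + (z - iota q%:A) by rewrite addrA subrK.
by have := ler_absvalD nA (y - z) (z - iota q%:A); lra.
Qed.

Lemma in_Qv_subring : subring_set (in_Qv nv).
Proof.
split; first by rewrite -(rmorph1 iota) -(scale1r 1); apply: in_Qv_rat.
split=> x y /in_QvE hx /in_QvE hy; apply/in_QvE => e e0.
  have e2 : 0 < e / 2 by lra.
  have [q hq] := hx _ e2; have [r hr] := hy _ e2; exists (q - r).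
  rewrite scalerBl rmorphB.
  have -> : x - y - (iota q%:A - iota r%:A) = (x - iota q%:A) - (y - iota r%:A) by ring.
  by have := ler_absvalB nA (x - iota q%:A) (y - iota r%:A); lra.
have nx := absval_ge0 nA x; have ny := absval_ge0 nA y.
pose M := nv x + nv y + 1; have M0 : 0 < M by rewrite /M; lra.
have e2 : 0 < Num.min 1 (e / (2 * M)) by rewrite lt_min ltr01 divr_gt0// mulr_gt0.
have [q] := hx _ e2; have [r] := hy _ e2; rewrite !lt_min !ltr_pdivlMr ?mulr_gt0//.
move=> /andP[r1 hr] /andP[q1 hq]; exists (q * r).
have -> : (q * r)%:A = q%:A * r%:A :> K by rewrite mulr_algl scalerA.
rewrite rmorphM.
have -> : x * y - iota q%:A * iota r%:A = (x - iota q%:A) * iota r%:A + x * (y - iota r%:A) by ring.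
apply: le_lt_trans (ler_absvalD nA _ _) _; rewrite !(absvalM nA).
have rb : nv (iota r%:A) <= M.
  have -> : iota r%:A = y - (y - iota r%:A) by ring.
  by apply: le_trans (ler_absvalB nA _ _) _; rewrite /M; lra.
have d1 := absval_ge0 nA (x - iota q%:A); have d2 := absval_ge0 nA (y - iota r%:A).
have : nv (x - iota q%:A) * nv (iota r%:A) <= nv (x - iota q%:A) * M by rewrite ler_wpM2l.
have : nv x * nv (y - iota r%:A) <= M * nv (y - iota r%:A) by rewrite ler_wpM2r// /M; lra.
by lra.
Qed.

Lemma in_QvV y : in_Qv nv y -> in_Qv nv y^-1.
Proof.
have [->|y0] := eqVneq y 0; first by rewrite invr0.
move=> /in_QvE hy; apply/in_QvE => e e0.
have ny : 0 < nv y by rewrite (absval_gt0 nA).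
have e2 : 0 < Num.min (nv y / 2) (e * nv y ^+ 2 / 2).
  by rewrite lt_min !divr_gt0// mulr_gt0// exprn_gt0.
have [q] := hy _ e2; rewrite lt_min => /andP[h1 h2]; exists q^-1.
have hq : nv y / 2 < nv (iota q%:A).
  by have := ler_absval_dist nA y (iota q%:A); lra.
have q0 : q != 0.
  by apply: contraTneq hq => ->; rewrite scale0r rmorph0 (absval0 nA) -leNgt; lra.
have iq0 : iota q%:A != 0 by rewrite -(absval_gt0 nA); lra.
have -> : iota (q^-1)%:A = (iota q%:A)^-1.
  apply: (mulfI iq0); rewrite divff// -rmorphM mulr_algl scalerA divff// scale1r.
  exact: rmorph1.
have -> : y^-1 - (iota q%:A)^-1 = (iota q%:A - y) / (y * iota q%:A) by field; rewrite y0 iq0.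
rewrite (absval_div nA) (absvalM nA) (absval_distC nA) ltr_pdivrMr; last by rewrite mulr_gt0//; lra.
have : nv y * (nv y / 2) < nv y * nv (iota q%:A) by rewrite ltr_pM2l.
by nra.
Qed.

Definition Qv_spans r (y : 'I_r -> Kv) : Prop := forall x, exists c : 'I_r -> Kv,
  (forall j, in_Qv nv (c j)) /\ x = \sum_j c j * y j.

Definition Qv_free r (y : 'I_r -> Kv) : Prop := forall c : 'I_r -> Kv,
  (forall j, in_Qv nv (c j)) -> \sum_j c j * y j = 0 -> forall j, c j = 0.

Lemma Qv_free_le_span d r (b : 'I_d -> Kv) (y : 'I_r -> Kv) : Qv_free b -> Qv_spans y -> (d <= r)%N.
Proof.
move=> bfree sp; rewrite leqNgt; apply/negP => rd.
pose w (i : 'I_r.+1) := b (widen_ord rd i).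
pose C i := projT1 (cid (sp (w i))).
have CP i : (forall j, in_Qv nv (C i j)) /\ w i = \sum_j C i j * y j := projT2 (cid (sp (w i))).
have [c [Pc [i0 ci0] hc]] := subfield_elimination in_Qv_subring in_QvV (fun i k => proj1 (CP i) k).
pose e (j : 'I_d) := if insub (val j) is Some i then c i else 0.
have eW i : e (widen_ord rd i) = c i by rewrite /e /= valK.
have := bfree e _ _ (widen_ord rd i0); rewrite eW => H.
move/eqP: ci0; apply; apply: H => [j|].
  by rewrite /e; case: insubP => // _; apply: (subring0 in_Qv_subring).
pose G k := if insub k is Some j then e j * b j else 0 : Kv.
transitivity (\sum_(i < d) G i).
  by apply: eq_bigr => i _; rewrite /G valK.
rewrite (bigID (fun i : 'I_d => (i < r.+1)%N)) /= [X in _ + X]big1 ?addr0; last first.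
  by move=> i hi; rewrite /G valK /e insubN ?mul0r.
rewrite -(big_ord_widen _ G rd).
transitivity (\sum_(i < r.+1) c i * w i).
  apply: eq_bigr => i _; rewrite /G; have -> : nat_of_ord i = val (widen_ord rd i) by [].
  by rewrite valK eW.
under eq_bigr => i _ do rewrite (proj2 (CP i)) mulr_sumr.
rewrite exchange_big big1//= => k _; under eq_bigr do rewrite mulrA.
by rewrite -mulr_suml hc mul0r.
Qed.

(** This identifies the given [dv i], which is known only through the existence of some basis, with
    the length of a basis constructed from K. *)
Lemma local_degreeE d r (y : 'I_r -> Kv) : local_degree nv d -> Qv_free y -> Qv_spans y -> d = r.
Proof.
move=> [b [bs bf]] yf ys; apply/eqP; rewrite eqn_leq.
by rewrite (Qv_free_le_span bf ys) (Qv_free_le_span yf bs).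
Qed.

Section PadicDegree.
Variables (p : nat).
Hypotheses (pr_p : prime p) (fP : is_padic_place p f).

Let p0 : 0 < (p%:R : R). Proof. by rewrite ltr0n prime_gt0. Qed.
Let p1 : 1 < (p%:R : R). Proof. by rewrite ltr1n prime_gt1. Qed.
Let pI0 : 0 < (p%:R^-1 : R). Proof. by rewrite invr_gt0. Qed.

Lemma completion_ultra x y : nv (x + y) <= Num.max (nv x) (nv y).
Proof.
apply: absval_ultrametric => // k.
by rewrite -(rmorph_nat iota) nE (padic_nat_le1 pr_p fP).
Qed.

Let addl x y (e : R) : nv x <= e -> nv y <= e -> nv (x + y) <= e.
Proof. by move=> hx hy; apply: le_trans (completion_ultra _ _) _; rewrite ge_max hx. Qed.

Let subl x y (e : R) : nv x <= e -> nv y <= e -> nv (x - y) <= e.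
Proof. by move=> hx hy; apply: addl; rewrite ?(absvalN nA). Qed.

Let suml (J : Type) (s : seq J) (Q : pred J) (u : J -> Kv) (e : R) : 0 <= e ->
  (forall j, Q j -> nv (u j) <= e) -> nv (\sum_(j <- s | Q j) u j) <= e.
Proof.
move=> e0 h; elim/big_ind : _ => //; first by rewrite (absval0 nA).
by move=> x y; apply: addl.
Qed.

(** In lowest terms the denominator of such a rational is prime to [p], so Bezout inverts it modulo
    [p]. *)
Lemma padic_rat_int (q : rat) : f q%:A <= 1 -> exists z : int, f (q%:A - z%:~R) <= p%:R^-1.
Proof.
move=> q1.
have qE : q%:A = (numq q)%:~R / (denq q)%:~R :> K by rewrite alg_num_field.
have dK : (denq q)%:~R != 0 :> K.
  by rewrite -(ratr_int K) -alg_num_field scaler_eq0 oner_eq0 orbF intr_eq0 denq_eq0.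
have fd : (f (denq q)%:~R <= p%:R^-1) = false.
  apply/negP => hd; have pd : (p %| absz (denq q))%N by rewrite -(padic_int_small pr_p fP).
  have pn : ~~ (p %| absz (numq q))%N.
    apply/negP => pn; have := coprime_num_den q; rewrite /coprime => /eqP h.
    have : (p %| gcdn (absz (numq q)) (absz (denq q)))%N by rewrite dvdn_gcd pn pd.
    by rewrite h dvdn1 => /eqP E; move: pr_p; rewrite E.
  have n0 : (0 < absz (numq q))%N by case: posnP pn => // ->; rewrite dvdn0.
  have nf : f (numq q)%:~R = 1.
    by rewrite (padic_intE fP) (padic_nat fP)// lognE pr_p n0 (negbTE pn) expr0 invr1.
  move: q1; rewrite qE (absval_div fA) nf div1r.
  have d0 : 0 < f (denq q)%:~R by rewrite (absval_gt0 fA).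
  rewrite invf_le1// => h; have := le_trans h hd; rewrite leNgt invf_lt1//.
  by rewrite p1.
have pd : ~~ (p %| absz (denq q))%N by rewrite -(padic_int_small pr_p fP) fd.
have cop : coprimez (denq q) p by rewrite coprimezE coprime_sym prime_coprime.
have [u [v uv]] := Bezoutz (denq q) p.
have uv1 : u * denq q + v * p = 1 by rewrite uv; apply/eqP.
have d0 : (0 < absz (denq q))%N by rewrite absz_gt0 denq_eq0.
have df : f (denq q)%:~R = 1.
  by rewrite (padic_intE fP) (padic_nat fP)// lognE pr_p d0 (negbTE pd) expr0 invr1.
exists (numq q * u).
have -> : q%:A - (numq q * u)%:~R = p%:R * ((numq q * v)%:~R / (denq q)%:~R) :> K.
  apply: (mulIf dK); rewrite qE mulrBl divfK// -!mulrA mulVf// mulr1.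
  rewrite -[X in _ = X * _]/(p%:~R) -!intrM -rmorphB; congr (_%:~R).
  rewrite -[X in X - _]mulr1 -uv1; ring.
rewrite (absvalM fA) (padic_p pr_p fP) (absval_div fA) df divr1 ler_piMr ?(ltW pI0)//.
exact: (padic_int_le1 pr_p fP).
Qed.

(** Dividing a relation by its largest coefficient makes all coefficients integral and one of them
    1. Integers congruent to them modulo [p] then contradict independence modulo [p]. *)
Lemma residue_free_Qv r (b : 'I_r -> K) : residue_free p f b -> Qv_free (iota \o b).
Proof.
move=> [b1 bf] c cQ cb j0; apply/eqP; apply: contraT => cj0.
have [j1 _ jmax] := @arg_maxP _ _ _ j0 predT (fun j => nv (c j)) isT.
have cj1 : 0 < nv (c j1) by apply: lt_le_trans (jmax j0 isT); rewrite (absval_gt0 nA).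
have cj1' : c j1 != 0 by rewrite -(absval_gt0 nA).
pose e j := c j / c j1.
have eQ j : in_Qv nv (e j) by apply: (subringM in_Qv_subring) => //; apply: in_QvV.
have e1 j : nv (e j) <= 1 by rewrite (absval_div nA) ler_pdivrMr// mul1r; apply: jmax.
have zP j : exists z : int, nv (e j - iota z%:~R) <= p%:R^-1.
  have /in_QvE/(_ _ pI0)[q hq] := eQ j.
  have q1 : f q%:A <= 1.
    rewrite -nE; have -> : iota q%:A = e j - (e j - iota q%:A) by ring.
    by apply: subl => //; apply: (le_trans (ltW hq)); rewrite invf_le1// ltW.
  have [z hz] := padic_rat_int q1; exists z.
  have -> : e j - iota z%:~R = (e j - iota q%:A) + iota (q%:A - z%:~R) by rewrite rmorphB; ring.
  by apply: addl; rewrite ?nE// ltW.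
pose z j := projT1 (cid (zP j)); have hz j := projT2 (cid (zP j)).
have sz : f (\sum_j (z j)%:~R * b j) <= p%:R^-1.
  rewrite -nE rmorph_sum; have -> : \sum_j iota ((z j)%:~R * b j) =
      - \sum_j (e j - iota (z j)%:~R) * iota (b j).
    have se : \sum_j e j * iota (b j) = 0.
      transitivity ((\sum_j c j * iota (b j)) / c j1); last by rewrite [X in X / _]cb mul0r.
      by rewrite mulr_suml; apply: eq_bigr => j _; rewrite /e mulrAC.
    rewrite -[LHS]subr0 -[X in _ - X = _]se -sumrB -sumrN; apply: eq_bigr => j _.
    by rewrite rmorphM; ring.
  rewrite (absvalN nA); apply: suml => [|j _]; first exact: ltW.
  rewrite (absvalM nA) -[X in _ <= X]mulr1.
  by apply: ler_pM; [apply: (absval_ge0 nA)|apply: (absval_ge0 nA)|apply: hz|rewrite nE].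
have := bf _ sz j1; rewrite -(padic_int_small pr_p fP) => h.
have := hz j1; rewrite -/(z j1) /e divff// => h'.
have : nv (1 - iota (z j1)%:~R + iota (z j1)%:~R) <= p%:R^-1 by apply: addl; rewrite ?nE.
by rewrite subrK (absval1 nA) leNgt invf_lt1// p1.
Qed.

(** Subtracting a combination of the [b j] and dividing by [p], again and again, gives a digit
    expansion; by completeness the digit sums at each [b j] converge, to a limit of natural numbers
    and so an element of Q_v. A power of [p] brings a general element into the unit ball. *)
Lemma residue_spans_Qv r (b : 'I_r -> K) : (forall j, f (b j) <= 1) ->
  residue_spans p f b -> Qv_spans (iota \o b).
Proof.
move=> b1 bs.
have pK : (p%:R : K) != 0 by rewrite -(absval_gt0 fA) (padic_p pr_p fP).
have pKv : iota p%:R != 0 by rewrite fmorph_eq0.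
(* Stated for all [y], with a default outside the unit ball, so that the choice function [S] can be
   iterated. *)
have step (y : Kv) : exists cy : ('I_r -> nat) * Kv, nv y <= 1 ->
    nv cy.2 <= 1 /\ y = \sum_j (cy.1 j)%:R * iota (b j) + iota p%:R * cy.2.
  have [y1|y1] := pselect (nv y <= 1); last by exists (fun=> 0%N, 0).
  have [x hx] := dens y pI0.
  have x1 : f x <= 1.
    rewrite -nE; have -> : iota x = y - (y - iota x) by ring.
    by apply: subl => //; apply: (le_trans (ltW hx)); rewrite invf_le1// ltW.
  have [c hc] := bs x x1.
  exists (fun j => c j : nat, (y - \sum_j (c j)%:R * iota (b j)) / iota p%:R) => _ /=.
  split; last by rewrite mulrCA divff// mulr1 addrC subrK.
  rewrite (absval_div nA) nE (padic_p pr_p fP) invrK -ler_pdivlMr// div1r.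
  have -> : y - \sum_j (c j)%:R * iota (b j) = (y - iota x) + iota (x - \sum_j (c j)%:R * b j).
    rewrite rmorphB rmorph_sum addrA subrK; congr (_ - _); apply: eq_bigr => j _.
    by rewrite rmorphM rmorph_nat.
  by apply: addl; rewrite ?nE// ltW.
pose S y := projT1 (cid (step y)).
have SP y : nv y <= 1 -> nv (S y).2 <= 1 /\
    y = \sum_j ((S y).1 j)%:R * iota (b j) + iota p%:R * (S y).2 := projT2 (cid (step y)).
have unit_ball y : nv y <= 1 -> exists c : 'I_r -> Kv,
    (forall j, in_Qv nv (c j)) /\ y = \sum_j c j * (iota \o b) j.
  move=> y1; pose Y n := iter n (fun y => (S y).2) y.
  have Y1 n : nv (Y n) <= 1 by elim: n => [//|n /SP[]].
  pose s j n : Kv := \sum_(i < n) iota p%:R ^+ i * ((S (Y i)).1 j)%:R.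
  have yE n : y = \sum_j s j n * iota (b j) + iota p%:R ^+ n * Y n.
    elim: n => [|n IH].
      by rewrite big1 ?add0r ?mul1r// => j _; rewrite /s big_ord0 mul0r.
    rewrite {1}IH {1}(proj2 (SP _ (Y1 n))) -/(Y n.+1) mulrDr addrA mulrA -exprSr; congr (_ + _).
    rewrite mulr_sumr -big_split /=; apply: eq_bigr => j _.
    by rewrite /s big_ord_recr /= mulrDl mulrA.
  have natl k : nv k%:R <= 1 by rewrite -(rmorph_nat iota) nE (padic_nat_le1 pr_p fP).
  have npX k : nv (iota p%:R ^+ k) = p%:R^-1 ^+ k by rewrite (absvalX nA) nE (padic_p pr_p fP).
  have sQ j n : in_Qv nv (s j n).
    apply: (subring_sum in_Qv_subring) => i _; apply: (subringM in_Qv_subring).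
      by apply: (subringX in_Qv_subring); rewrite rmorph_nat; apply: (subring_nat in_Qv_subring).
    exact: (subring_nat in_Qv_subring).
  have sd j n k : nv (s j (n + k)%N - s j n) <= p%:R^-1 ^+ n.
    rewrite /s big_split_ord /= addrAC subrr add0r.
    apply: suml => [|i _]; first by rewrite exprn_ge0// ltW.
    rewrite (absvalM nA) npX exprD -mulrA ler_piMr ?exprn_ge0 ?(ltW pI0)//.
    by rewrite mulr_ile1 ?(absval_ge0 nA) ?exprn_ge0 ?exprn_ile1 ?(ltW pI0)// invf_le1// ltW.
  have pI1 : 0 <= (p%:R^-1 : R) < 1 by rewrite (ltW pI0) invf_lt1.
  have cau j : forall e, 0 < e -> exists N, forall a c, (N <= a)%N -> (N <= c)%N ->
      nv (s j a - s j c) < e.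
    move=> e e0; have [N _ /(_ N (leqnn N)) /= hN] := expr_small pI1 e0.
    exists N => a c Na Nc; apply: le_lt_trans hN.
    have -> : s j a - s j c = (s j (N + (a - N))%N - s j N) - (s j (N + (c - N))%N - s j N).
      by rewrite !subnKC//; ring.
    exact: subl.
  have limP j : exists l, forall e, 0 < e -> exists N, forall a, (N <= a)%N -> nv (s j a - l) < e.
    by case: compl => _ [_ [h _]]; apply: h; apply: cau.
  pose l j := projT1 (cid (limP j)); have lP j := projT2 (cid (limP j)).
  exists l; split=> [j|].
    apply: in_Qv_lim => e e0; have [N hN] := lP j e e0; exists (s j N); first exact: sQ.
    by rewrite (absval_distC nA); apply: hN.
  apply/eqP; rewrite -subr_eq0 -(absval_eq0 nA) eq_le absval_ge0// andbT.
  apply/ler_addgt0Pr => e e0; rewrite add0r.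
  have [n0 _ hn0] := expr_small pI1 e0.
  pose N j := projT1 (cid (lP j e e0)); have NP j := projT2 (cid (lP j e e0)).
  pose n := (n0 + \sum_j N j)%N.
  rewrite {1}(yE n).
  have -> : \sum_j s j n * iota (b j) + iota p%:R ^+ n * Y n - \sum_j l j * (iota \o b) j =
     \sum_j (s j n - l j) * iota (b j) + iota p%:R ^+ n * Y n.
    by rewrite addrAC -sumrB; congr (_ + _); apply: eq_bigr => j _; rewrite mulrBl.
  apply: addl; last first.
    rewrite (absvalM nA) npX; apply: (@le_trans _ _ (p%:R^-1 ^+ n)).
      by rewrite ler_piMr// exprn_ge0// ltW.
    by apply/ltW/hn0; rewrite /= leq_addr.
  apply: suml => [|j _]; first exact: ltW.
  rewrite (absvalM nA) nE -[X in _ <= X]mulr1.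
  apply: ler_pM; [apply: (absval_ge0 nA)|apply: (absval_ge0 fA)| |by []].
  by apply/ltW/NP; rewrite /n (bigD1 j)//= addnCA leq_addr.
move=> x; have pI1 : 0 <= (p%:R^-1 : R) < 1 by rewrite (ltW pI0) invf_lt1.
have x0 : 0 < (nv x + 1)^-1 by rewrite invr_gt0; have := absval_ge0 nA x; lra.
have [k _ /(_ k (leqnn k)) /= hk] := expr_small pI1 x0.
have [|c [cQ cE]] := unit_ball (iota p%:R ^+ k * x).
  have nx := absval_ge0 nA x.
  rewrite (absvalM nA) (absvalX nA) nE (padic_p pr_p fP).
  apply: (@le_trans _ _ ((nv x + 1)^-1 * nv x)); first by rewrite ler_wpM2r// ltW.
  by rewrite mulrC ler_pdivrMr; lra.
exists (fun j => (iota p%:R ^+ k)^-1 * c j); split=> [j|].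
  apply: (subringM in_Qv_subring) => //; apply: in_QvV; apply: (subringX in_Qv_subring).
  by rewrite rmorph_nat; apply: (subring_nat in_Qv_subring).
under eq_bigr do rewrite -mulrA.
by rewrite -mulr_sumr -cE mulKf// expf_neq0.
Qed.

Lemma padic_local_degree d r (b : 'I_r -> K) : local_degree nv d ->
  residue_free p f b -> residue_spans p f b -> d = r.
Proof.
move=> hd bf bs; apply: (local_degreeE hd (residue_free_Qv bf)).
by apply: residue_spans_Qv bs; case: bf.
Qed.
End PadicDegree.
End LocalDegree.

(** * Local degrees at archimedean places *)

Section ArchimedeanDegree.
Variables (R : realType) (K : fieldExtType rat) (f : K -> R).
Variables (Kv : fieldType) (iota : {rmorphism K -> Kv}) (nv : Kv -> R).
Hypotheses (compl : is_completion f iota nv).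
Variables (re im : K -> R).
Hypotheses (fE : forall x, f x ^+ 2 = re x ^+ 2 + im x ^+ 2).
Hypotheses (reB : forall x y, re (x - y) = re x - re y) (imB : forall x y, im (x - y) = im x - im y).
Hypotheses (reZ : forall q x, re (q *: x) = ratr q * re x) (imZ : forall q x, im (q *: x) = ratr q * im x).
Hypotheses (re1 : re 1 = 1) (im1 : im 1 = 0).

Let nA : is_absval nv. Proof. by case: compl. Qed.
Let nE x : nv (iota x) = f x. Proof. by case: compl => _ []. Qed.
Let fA := absval_of_completion compl.

Lemma rat_near (x e : R) : 0 < e -> exists q : rat, `|x - ratr q| < e.
Proof.
move=> e0; have [|q] := @rat_in_itvoo R (x - e) (x + e); first by lra.
by rewrite in_itv /= => /andP[h1 h2]; exists q; rewrite ltr_norml; lra.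
Qed.

Let absE_le x (e : R) : 0 <= e -> (f x <= e) = (re x ^+ 2 + im x ^+ 2 <= e ^+ 2).
Proof. by move=> e0; rewrite -fE ler_pXn2r// nnegrE (absval_ge0 fA). Qed.

(** Here [f] is the absolute value of [re], so each element of K, hence of K_v, is a limit of
    rationals, and K_v = Q_v. *)
Lemma arch_degree_real d : (forall x, im x = 0) -> local_degree nv d -> d = 1%N.
Proof.
move=> im0 hd; apply: (local_degreeE compl (y := fun _ : 'I_1 => 1) hd).
  by move=> c _; rewrite big_ord1 mulr1 => h j; rewrite ord1.
move=> y; exists (fun=> y); split; last by rewrite big_ord1 mulr1.
move=> _ /=; apply/(in_QvE iota) => e e0; have e2 : 0 < e / 3 by lra.
have [x hx] : exists x, nv (y - iota x) < e / 3 by case: compl => _ [_ [_ h]]; apply: h.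
have [q hq] := rat_near (re x) e2; exists q.
have -> : y - iota q%:A = (y - iota x) + iota (x - q%:A) by rewrite rmorphB; ring.
apply: le_lt_trans (ler_absvalD nA _ _) _; rewrite nE.
have : f (x - q%:A) <= e / 3.
  rewrite absE_le ?(ltW e2)// im0 reB reZ re1 mulr1 expr0n addr0 -real_normK ?num_real//.
  by rewrite ler_pXn2r// ?nnegrE ?(ltW e2)// ltW.
lra.
Qed.

(** The basis is 1, [theta]. It is free because every rational is at distance at least |im theta|
    from [theta]. It spans because [z] is a limit of q_n + r_n theta with rational coefficients, and
    |im theta| > 0 makes both coefficient sequences Cauchy. *)
Lemma arch_degree_complex d theta : im theta != 0 -> local_degree nv d -> d = 2%N.
Proof.
move=> it0 hd; pose y (j : 'I_2) := if j == ord0 then 1 else iota theta.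
have dens z e : 0 < e -> exists x, nv (z - iota x) < e by case: compl => _ [_ [_ h]]; apply: h.
have it : 0 < `|im theta| by rewrite normr_gt0.
have im_le x : `|im x| <= f x.
  rewrite -(@ler_pXn2r _ 2)// ?nnegrE ?(absval_ge0 fA)// fE real_normK ?num_real//.
  by rewrite lerDr sqr_ge0.
apply: (local_degreeE compl (y := y) hd).
  move=> c cQ; rewrite big_ord_recl big_ord1 /y /= mulr1 => h.
  have c1 : c (lift ord0 ord0) = 0.
    apply/eqP; apply: contraT => c10.
    have : in_Qv nv (iota theta).
      have -> : iota theta = - c ord0 / c (lift ord0 ord0).
        apply: (mulIf c10); rewrite divfK// mulrC; apply/eqP.
        by rewrite -subr_eq0 opprK addrC h.
      apply: (subringM (in_Qv_subring compl)); last by apply: (in_QvV compl).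
      exact: (subringN (in_Qv_subring compl)).
    move=> /(in_QvE iota)/(_ _ it)[q]; rewrite -rmorphB nE ltNge => /negP[].
    by apply: le_trans (im_le _); rewrite imB imZ im1 mulr0 subr0.
  move=> j; have [->|] := eqVneq j ord0; first by move: h; rewrite c1 mul0r addr0.
  by case: (unliftP ord0 j) => [j' ->|->//]; rewrite ord1.
move=> z; have ft := absval_ge0 fA theta.
pose dl n : R := n.+1%:R^-1.
have dl0 n : 0 < dl n by rewrite invr_gt0.
(* One [dl n] pays for replacing [z] by an element of K, one for rounding its real part, and
   [f theta * dl n] for rounding the multiple of [theta]. *)
have ap n : exists qr : rat * rat, nv (z - iota (qr.1%:A + qr.2 *: theta)) <= (2 + f theta) * dl n.
  have [x hx] := dens z _ (dl0 n).
  have [r hr] := rat_near (im x / im theta) (dl0 n).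
  have [q hq] := rat_near (re x - ratr r * re theta) (dl0 n).
  exists (q, r) => /=; set w := q%:A + r *: theta.
  have -> : z - iota w = (z - iota x) + iota (x - w) by rewrite rmorphB; ring.
  apply: le_trans (ler_absvalD nA _ _) _; rewrite nE.
  suff : f (x - w) <= (1 + f theta) * dl n by lra.
  have e0 : 0 <= (1 + f theta) * dl n by rewrite mulr_ge0 ?ltW//; lra.
  have addE (g : K -> R) : (forall x y, g (x - y) = g x - g y) -> forall x y, g (x + y) = g x + g y.
    move=> gB x' y'; have g0 : g 0 = 0 by rewrite -(subrr 0) gB subrr.
    by rewrite -[y' in LHS]opprK gB -sub0r gB g0 sub0r opprK.
  have reW : re (x - w) = re x - ratr r * re theta - ratr q.
    by rewrite reB /w (addE _ reB) !reZ re1; ring.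
  have imW : im (x - w) = (im x / im theta - ratr r) * im theta.
    by rewrite imB /w (addE _ imB) !imZ im1 mulrBl divfK//; ring.
  rewrite absE_le// reW imW; set u := re x - _ - _ in hq *; set t := im x / _ - _ in hr *.
  have h1 : u ^+ 2 <= dl n ^+ 2.
    by rewrite -[u ^+ 2]real_normK ?num_real// ler_pXn2r ?nnegrE// ltW.
  have h2 : t ^+ 2 <= dl n ^+ 2.
    by rewrite -[t ^+ 2]real_normK ?num_real// ler_pXn2r ?nnegrE// ltW.
  have h3 : im theta ^+ 2 <= f theta ^+ 2 by rewrite fE lerDr sqr_ge0.
  have h4 : (t * im theta) ^+ 2 <= dl n ^+ 2 * f theta ^+ 2.
    by rewrite exprMn ler_pM ?sqr_ge0.
  have : 0 <= f theta * dl n ^+ 2 by rewrite mulr_ge0// sqr_ge0.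
  by rewrite exprMn; nra.
pose q n := (projT1 (cid (ap n))).1; pose r n := (projT1 (cid (ap n))).2.
pose w n := (q n)%:A + r n *: theta.
have wP n : nv (z - iota (w n)) <= (2 + f theta) * dl n := projT2 (cid (ap n)).
have wd a b : f (w a - w b) <= (2 + f theta) * (dl a + dl b).
  rewrite -nE; have -> : iota (w a - w b) = (z - iota (w b)) - (z - iota (w a)) by rewrite rmorphB; ring.
  by apply: le_trans (ler_absvalB nA _ _) _; have := wP a; have := wP b; lra.
have fq s : f s%:A = `|ratr s|.
  apply/eqP; rewrite -(@eqrXn2 _ 2) ?normr_ge0 ?(absval_ge0 fA)// fE reZ imZ re1 im1 mulr1 mulr0 expr0n addr0.
  by rewrite real_normK ?num_real.
pose M := (2 + f theta) / `|im theta|.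
have M0 : 0 <= M by rewrite divr_ge0//; lra.
have rd a b : f (r a - r b)%:A <= M * (dl a + dl b).
  rewrite fq /M mulrAC ler_pdivlMr// -normrM; apply: le_trans (wd a b).
  have -> : ratr (r a - r b) * im theta = im (w a - w b); last exact: im_le.
  have -> : w a - w b = (r a - r b) *: theta - (q b - q a)%:A.
    by rewrite /w !scalerBl; ring.
  by rewrite imB !imZ im1 mulr0 subr0.
have qd a b : f (q a - q b)%:A <= ((2 + f theta) + M * f theta) * (dl a + dl b).
  have -> : (q a - q b)%:A = (w a - w b) - (r a - r b)%:A * theta :> K.
    by rewrite mulr_algl /w !scalerBl; ring.
  apply: le_trans (ler_absvalB fA _ _) _; rewrite (absvalM fA).
  have := wd a b; have : f (r a - r b)%:A * f theta <= M * (dl a + dl b) * f theta.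
    by rewrite ler_wpM2r.
  by lra.
have lim_exists (u : nat -> rat) (C : R) : 0 <= C -> (forall a b, f (u a - u b)%:A <= C * (dl a + dl b)) ->
    exists l, in_Qv nv l /\ forall e, 0 < e -> exists N, forall a, (N <= a)%N -> nv (iota (u a)%:A - l) < e.
  move=> C0 hu.
  have [l hl] : exists l, forall e, 0 < e -> exists N, forall a, (N <= a)%N -> nv (iota (u a)%:A - l) < e.
    case: compl => _ [_ [h _]]; apply: h => e e0.
    pose N := Num.bound (2 * C / e).
    have hN : 2 * C / e < N%:R by apply: archi_boundP; rewrite divr_ge0 ?mulr_ge0// ltW.
    exists N => a b Na Nb; rewrite -rmorphB -scalerBl nE.
    have dN a' : (N <= a')%N -> C * dl a' < e / 2.
      move=> Na'; rewrite /dl ltr_pdivrMr//.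
      have : (N%:R : R) <= a'.+1%:R by rewrite ler_nat ltnW.
      by move: hN; rewrite ltr_pdivrMr//; nra.
    by have := hu a b; have := dN a Na; have := dN b Nb; lra.
  exists l; split=> //; apply: (in_Qv_lim compl) => e e0; have [N hN] := hl e e0.
  exists (iota (u N)%:A); first exact: (in_Qv_rat compl).
  by rewrite (absval_distC nA); apply: hN.
have C0 : 0 <= 2 + f theta + M * f theta by have := mulr_ge0 M0 ft; lra.
have [l0 [Ql0 hl0]] := lim_exists q _ C0 qd; have [l1 [Ql1 hl1]] := lim_exists r _ M0 rd.
exists (fun j => if j == ord0 then l0 else l1); split=> [j|]; first by case: ifP.
rewrite big_ord_recl big_ord1 /y /= mulr1.
apply/eqP; rewrite -subr_eq0 -(absval_eq0 nA) eq_le absval_ge0// andbT.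
apply/ler_addgt0Pr => e e0; rewrite add0r.
have e1 : 0 < e / 3 / (1 + f theta) by rewrite !divr_gt0//; lra.
have e3 : 0 < e / 3 by lra.
have [N0 h0] := hl0 _ e3; have [N1 h1] := hl1 _ e1.
pose N := Num.bound ((2 + f theta) / (e / 3)).
have hN : (2 + f theta) / (e / 3) < N%:R by apply: archi_boundP; rewrite divr_ge0 ?(ltW e3)//; lra.
pose a := maxn N (maxn N0 N1).
have -> : z - (l0 + l1 * iota theta) =
    (z - iota (w a)) + (iota (q a)%:A - l0) + (iota (r a)%:A - l1) * iota theta.
  by rewrite /w -[r a *: theta]mulr_algl rmorphD rmorphM; ring.
apply: le_trans (ler_absvalD nA _ _) _; rewrite (absvalM nA) nE.
have b1 := ler_absvalD nA (z - iota (w a)) (iota (q a)%:A - l0).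
have b2 := wP a.
have b3 : nv (iota (q a)%:A - l0) < e / 3 by apply: h0; rewrite /a !leq_max leqnn !orbT.
have b4 : nv (iota (r a)%:A - l1) * f theta <= e / 3.
  have : nv (iota (r a)%:A - l1) < e / 3 / (1 + f theta) by apply: h1; rewrite /a !leq_max leqnn !orbT.
  rewrite ltr_pdivlMr; last lra.
  by have := absval_ge0 nA (iota (r a)%:A - l1); lra.
have b5 : (2 + f theta) * dl a <= e / 3.
  rewrite /dl ler_pdivrMr//.
  have : (N%:R : R) <= a.+1%:R by rewrite ler_nat ltnW// ltnS /a leq_maxl.
  by move: hN; rewrite ltr_pdivrMr//; nra.
by lra.
Qed.
End ArchimedeanDegree.

(** * The complex embeddings of K *)

Section Embeddings.
Variables (R : realType) (K : fieldExtType rat).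
Local Notation C := R[i].
Local Notation inK := (map_poly (GRing.in_alg K)).
Local Notation inC := (map_poly (ratr : rat -> C)).

Lemma primitive_element_poly : exists (theta : K) (p : {poly rat}),
  [/\ separable_poly p, size p = (\dim {:K}).+1,
    forall x, exists q, x = (inK q).[theta],
    (inK p).[theta] = 0 & forall q, (inK q).[theta] = 0 -> p %| q].
Proof.
have ch0 : [pchar K] =i pred0 by move=> x; rewrite (pchar_lalg K) pchar_num.
have sep : separable 1 {:K} by apply/separableP => x _; apply: pcharf0_separable.
have gen := eq_adjoin_separable_generator sep (sub1v _).
set theta := separable_generator _ _ in gen.
have /polyOver1P[p pE'] := minPolyOver 1%AS theta.
exists theta, p; split.
- have : separable_element 1%AS theta by apply: pcharf0_separable.
  by rewrite /separable_element pE' separable_map.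
- rewrite -(size_map_poly (GRing.in_alg K)) -pE' size_minPoly.
  by rewrite [in RHS]gen dim_Fadjoin dimv1 muln1.
- move=> x; have /Fadjoin_polyP[q /polyOver1P[r ->] ->] : x \in <<1; theta>>%VS by rewrite -gen memvf.
  by exists r.
- by have := root_minPoly 1%AS theta; rewrite pE' => /eqP.
- move=> q q0; have : minPoly 1%AS theta %| inK q.
    by apply: minPoly_dvdp; [apply/polyOver1P; exists q | apply/eqP].
  by rewrite pE' dvdp_map.
Qed.

(** Two polynomials representing the same element differ by a multiple of [p], so evaluation at the
    root [al] does not depend on the choice made by [rep]. *)
Lemma embedding_of_root (theta : K) (p : {poly rat}) (al : C) :
  (forall x, exists q, x = (inK q).[theta]) -> (forall q, (inK q).[theta] = 0 -> p %| q) ->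
  root (inC p) al -> exists s : {rmorphism K -> C}, forall q, s (inK q).[theta] = (inC q).[al].
Proof.
move=> gen pmin pal.
pose rep x := projT1 (cid (gen x)); have repP x : x = (inK (rep x)).[theta] := projT2 (cid (gen x)).
pose s x := (inC (rep x)).[al].
have wd q : s (inK q).[theta] = (inC q).[al].
  apply/eqP; rewrite -subr_eq0 /s -hornerN -hornerD -rmorphB /=.
  have /pmin : (inK (rep (inK q).[theta] - q)).[theta] = 0.
    by rewrite rmorphB hornerD hornerN -repP subrr.
  by move=> /dvdpP[c ->]; rewrite rmorphM hornerM (eqP pal) mulr0.
have sB x y : s (x - y) = s x - s y.
  rewrite {1}(repP x) {1}(repP y) -hornerN -hornerD -rmorphB wd.
  by rewrite rmorphB hornerD hornerN.
have sM x y : s (x * y) = s x * s y.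
  by rewrite {1}(repP x) {1}(repP y) -hornerM -rmorphM wd rmorphM hornerM.
have s1 : s 1 = 1 by have := wd 1; rewrite !rmorph1 !hornerC.
exists (HB.pack_for {rmorphism K -> C} s (GRing.isZmodMorphism.Build K C s sB)
  (GRing.isMonoidMorphism.Build K C s (s1, sM))) => /=.
exact: wd.
Qed.

Definition cabs (s : K -> C) (x : K) : R := Normc.normc (s x).

Lemma normc_sqr (z : C) : Normc.normc z ^+ 2 = complex.Re z ^+ 2 + complex.Im z ^+ 2.
Proof. by case: z => a b /=; rewrite sqr_sqrtr// addr_ge0 ?sqr_ge0. Qed.

Lemma normc_ge0 (z : C) : 0 <= Normc.normc z.
Proof. by case: z => a b; apply: sqrtr_ge0. Qed.

Lemma ratr_complex (q : rat) : (ratr q : C) = complex.Complex (ratr q) 0.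
Proof.
exact: (esym (fmorph_rat (real_complex R) q)).
Qed.

Section OneEmbedding.
Variable s : {rmorphism K -> C}.

Lemma embedding_rat (q : rat) : s (ratr q) = ratr q. Proof. exact: fmorph_rat. Qed.

Lemma embeddingZ (q : rat) x : s (q *: x) = ratr q * s x.
Proof. by rewrite -mulr_algl rmorphM alg_num_field fmorph_rat. Qed.

Lemma Re_embeddingZ (q : rat) x : complex.Re (s (q *: x)) = ratr q * complex.Re (s x).
Proof. by rewrite embeddingZ ratr_complex; case: (s x) => a b /=; rewrite mul0r subr0. Qed.

Lemma Im_embeddingZ (q : rat) x : complex.Im (s (q *: x)) = ratr q * complex.Im (s x).
Proof. by rewrite embeddingZ ratr_complex; case: (s x) => a b /=; rewrite mul0r addr0. Qed.

Lemma cabs_arch : is_arch_place (cabs s).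
Proof.
split; last first.
  move=> q; rewrite /cabs embedding_rat ratr_complex /= expr0n addr0.
  by rewrite sqrtr_sqr.
split; first by move=> x; apply: normc_ge0.
split.
  move=> x; split=> [/Normc.eq0_normc/eqP|->]; first by rewrite fmorph_eq0 => /eqP.
  by rewrite /cabs rmorph0 Normc.normc0.
split=> x y; rewrite /cabs ?rmorphM ?Normc.normcM// rmorphD.
exact: le_normcD.
Qed.
End OneEmbedding.

Lemma normc_conj (z : C) : Normc.normc (conjc z) = Normc.normc z.
Proof. by case: z => a b /=; rewrite sqrrN. Qed.

(* |s(x) + q| = |t(x) + q| for all rational q determines Re, and then |Im|. *)
Lemma cabs_inj (s t : {rmorphism K -> C}) x : cabs s = cabs t -> t x = s x \/ t x = conjc (s x).
Proof.
move=> st; have h y : normc_sqr (s y) = normc_sqr (s y) by [].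
have sq y : complex.Re (s y) ^+ 2 + complex.Im (s y) ^+ 2 = complex.Re (t y) ^+ 2 + complex.Im (t y) ^+ 2.
  by rewrite -!normc_sqr; congr (_ ^+ 2); apply: (congr1 (@^~ y) st).
have h1 := sq x; have h2 := sq (x + 1).
rewrite !rmorphD !rmorph1 in h2.
case: (s x) (t x) h1 h2 => [a b] [a' b'] /=; rewrite !addr0 => h1 h2.
have aE : a = a' by nra.
rewrite {}aE in h1 *.
have : (b' - b) * (b' + b) == 0 by apply/eqP; nra.
rewrite mulf_eq0 subr_eq0 addr_eq0 => /orP[/eqP ->|/eqP ->]; [by left | by right].
Qed.

Lemma conj_embedding (s : {rmorphism K -> C}) :
  exists t : {rmorphism K -> C}, forall x, t x = conjc (s x).
Proof. by exists (conjc \o s : {rmorphism K -> C}). Qed.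

(** Embeddings correspond to the roots of the separable polynomial [p]. Independence, tested on the
    powers of [theta], is the Vandermonde determinant of these roots; and an embedding is known up
    to conjugation from its value at the one element [theta], to which [cabs_inj] applies. *)
Lemma all_embeddings : exists s : 'I_(\dim {:K}) -> {rmorphism K -> C},
  [/\ forall t : {rmorphism K -> C}, exists i, forall x, t x = s i x,
     forall i j, (forall x, s i x = s j x) -> i = j,
     (forall i (t : {rmorphism K -> C}) , cabs t = cabs (s i) ->
        (forall x, t x = s i x) \/ (forall x, t x = conjc (s i x))) &
     forall u : 'rV[C]_(\dim {:K}), (forall x, \sum_i u 0 i * s i x = 0) -> u = 0].
Proof.
have [theta [p [psep psz gen p0 pmin]]] := primitive_element_poly.
have [rs rsE] := closed_field_poly_normal (inC p).
have lc : lead_coef (inC p) != 0.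
  by rewrite lead_coef_eq0 map_poly_eq0 -size_poly_eq0 psz.
have urs : uniq rs.
  rewrite -separable_prod_XsubC.
  have : separable_poly (inC p) by rewrite separable_map.
  by rewrite rsE (eqp_separable (eqp_scale _ lc)).
have srs : size rs = \dim {:K}.
  have : size (inC p) = (\dim {:K}).+1 by rewrite size_map_poly psz.
  by rewrite rsE size_scale// size_prod_XsubC => -[].
have rsP al : (al \in rs) = root (inC p) al.
  by rewrite rsE rootZ// root_prod_XsubC.
pose al (i : 'I_(\dim {:K})) := rs`_i.
have alP i : root (inC p) (al i) by rewrite -rsP mem_nth// srs.
have alI : injective al.
  by move=> i j /eqP; rewrite nth_uniq ?srs// => /eqP/val_inj.
have emb i := embedding_of_root gen pmin (alP i).
pose s i := projT1 (cid (emb i)); have sP i q : s i (inK q).[theta] = (inC q).[al i] := projT2 (cid (emb i)) q.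
have sth i : s i theta = al i.
  by have := sP i 'X; rewrite !map_polyX !hornerX.
have tE (t : {rmorphism K -> C}) q : t (inK q).[theta] = (inC q).[t theta].
  rewrite -horner_map /= -map_poly_comp; congr (_.[_]); apply: eq_map_poly => a /=.
  by rewrite embeddingZ rmorph1 mulr1.
have text (t u : {rmorphism K -> C}) : t theta = u theta -> forall x, t x = u x.
  by move=> h x; have [q ->] := gen x; rewrite !tE h.
exists s; split.
- move=> t; have : t theta \in rs.
    by rewrite rsP /root -tE p0 rmorph0.
  move=> /(nthP 0) [i ]; rewrite srs => hi h; exists (Ordinal hi); apply: text.
  by rewrite sth -h.
- by move=> i j /(_ theta); rewrite !sth => /alI.
- move=> i t /esym/(cabs_inj theta)[h|h]; [by left; apply: text | right].
  have [u uE] := conj_embedding (s i) => x; rewrite -uE; apply: text.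
  by rewrite uE.
- move=> u hu; pose V := Vandermonde (\dim {:K}) (\row_i al i).
  have : u *m V^T = 0.
    apply/rowP => k; rewrite !mxE -[RHS](hu (theta ^+ k)); apply: eq_bigr => i _.
    by rewrite !mxE rmorphXn /= sth.
  have Vu : V^T \in unitmx.
    rewrite unitmx_tr unitmxE unitfE det_Vandermonde; apply/prodf_neq0 => i _.
    apply/prodf_neq0 => j ij; rewrite !mxE subr_eq0; apply: contraTneq ij => /alI ->.
    by rewrite ltnn.
  by move=> h; rewrite -[u](mulmxK Vu) h mul0mx.
Qed.
End Embeddings.

(** * The embedding matrix: coordinates, archimedean places, trace and discriminant *)

Section EmbeddingMatrix.
Variables (R : realType) (K : fieldExtType rat).
Local Notation C := R[i].
Local Notation d := (\dim {:K}).

Definition rat_spans (w : 'I_d -> K) : Prop :=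
  forall x, exists q : 'I_d -> rat, x = \sum_k q k *: w k.

Lemma vbasis_spans : rat_spans (fun k => (vbasis {:K})`_k).
Proof.
by move=> x; exists (fun k => coord (vbasis {:K}) k x); rewrite -coord_vbasis ?memvf.
Qed.

(** The multiplier is the leading coefficient [l] of an integer equation of degree n: multiplied by
    l^(n-1), the equation becomes monic in [l x]. *)
Lemma integral_multiple (x : K) : exists2 a : int, a != 0 & is_integral (a%:~R * x).
Proof.
have [q q0 qx] := alg_relation x.
have [p [a a0 qE]] := rat_poly_scale q.
have p0 : p != 0.
  by apply: contraNneq q0 => p0; rewrite qE p0 rmorph0 scaler0.
have sp : (0 < size p)%N by rewrite size_poly_gt0.
have px : \sum_(i < size p) (p`_i)%:~R * x ^+ i = 0.
  have sE : size q = size p.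
    by rewrite qE size_scale ?size_map_poly_id0 ?invr_eq0 ?intr_eq0 ?lead_coef_eq0.
  have aK : (a%:~R : rat)%:A != 0 :> K by rewrite scaler_eq0 oner_eq0 orbF intr_eq0.
  apply: (mulfI (invr_neq0 aK)); rewrite mulr0 -[RHS]qx sE mulr_sumr.
  apply: eq_bigr => i _; rewrite qE coefZ coef_map /= mulrA; congr (_ * _).
  apply: (mulfI aK); rewrite mulVKf//.
  by rewrite mulr_algl scalerA mulrA divff ?intr_eq0// mul1r alg_num_field ratr_int.
pose n := (size p).-1; have sE : size p = n.+1 by rewrite prednK.
pose l := lead_coef p; have l0 : l != 0 by rewrite lead_coef_eq0.
case: (posnP n) => n0.
  move: px; rewrite sE n0 big_ord1 mulr1 => px.
  have : p`_0 != 0 by rewrite -[p`_0]/(p`_(1.-1)) -n0 -sE -lead_coefE.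
  rewrite -(intr_eq0 rat) => h; have : ((p`_0)%:~R : rat)%:A == 0 :> K.
    by rewrite alg_num_field ratr_int px.
  by rewrite scaler_eq0 oner_eq0 orbF (negbTE h).
exists l => //; pose r : {poly int} := \sum_(i < n) (p`_i * l ^+ (n.-1 - i)) *: 'X^i.
have rs : (size r <= n)%N.
  apply: (leq_trans (size_sum _ _ _)); apply/bigmax_leqP => i _.
  by apply: leq_trans (size_scale_leq _ _) _; rewrite size_polyXn.
exists ('X^n + r); split.
  by rewrite monicE lead_coefDl ?lead_coefXn// size_polyXn ltnS.
rewrite /root rmorphD /= map_polyXn !hornerE rmorph_sum /= horner_sum addr_eq0.
rewrite exprMn -{1}(prednK n0) exprSr -mulrA.
have -> : l%:~R * x ^+ n = - \sum_(i < n) (p`_i)%:~R * x ^+ i.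
  by apply/eqP; rewrite -addr_eq0 addrC -[X in _ == X]px sE big_ord_recr.
rewrite mulrN eqr_opp mulr_sumr; apply/eqP; apply: eq_bigr => i _.
have im : (i <= n.-1)%N by rewrite -ltnS prednK.
rewrite map_polyZ /= map_polyXn !hornerE rmorphM rmorphXn /= exprMn.
by rewrite -{1}(subnK im) exprD; ring.
Qed.

Lemma integral_basis_spans (w : 'I_d -> K) :
  (forall x, is_integral x -> exists c : 'I_d -> int, x = \sum_j (c j)%:~R * w j) -> rat_spans w.
Proof.
move=> wZ x; have [a a0 /wZ[c cE]] := integral_multiple x.
exists (fun k => (c k)%:~R / a%:~R).
have aK : (a%:~R : rat)%:A != 0 :> K by rewrite scaler_eq0 oner_eq0 orbF intr_eq0.
have zE (z : int) : z%:~R = (z%:~R : rat)%:A :> K by rewrite alg_num_field ratr_int.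
apply: (mulfI aK); rewrite -zE cE mulr_sumr; apply: eq_bigr => k _.
by rewrite !zE !mulr_algl scalerA mulrC divfK ?intr_eq0.
Qed.

Section Family.
Variable s : 'I_d -> {rmorphism K -> C}.
Hypothesis s_indep : forall u : 'rV[C]_d, (forall x, \sum_i u 0 i * s i x = 0) -> u = 0.

Definition embedding_mx (w : 'I_d -> K) : 'M[C]_d := \matrix_(i, k) s i (w k).

Lemma embedding_mx_unit w : rat_spans w -> embedding_mx w \in unitmx.
Proof.
move=> wQ; rewrite -row_free_unit -kermx_eq0; apply/negP => /negP/rowV0Pn[u /sub_kermxP uM].
move/negP; apply; apply/eqP/s_indep => x; have [q ->] := wQ x.
under eq_bigr do rewrite rmorph_sum mulr_sumr.
rewrite exchange_big big1//= => k _.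
under eq_bigr do rewrite embeddingZ mulrCA.
rewrite -mulr_sumr; move/rowP: uM => /(_ k); rewrite !mxE => h.
rewrite [X in _ * X](_ : _ = 0) ?mulr0// -[RHS]h.
by apply: eq_bigr => i _; rewrite mxE.
Qed.

Lemma normc_ratr (q : rat) : Normc.normc (ratr q : C) = `|ratr q|.
Proof. by rewrite ratr_complex /= expr0n addr0 sqrtr_sqr. Qed.

Lemma ler_normc_sum (J : Type) (r : seq J) (P : pred J) (F : J -> C) :
  Normc.normc (\sum_(j <- r | P j) F j) <= \sum_(j <- r | P j) Normc.normc (F j).
Proof.
elim/big_ind2 : _ => //; first by rewrite Normc.normc0.
by move=> x a y b hx hy; apply: le_trans (le_normcD _ _) (lerD hx hy).
Qed.

(** The inverse of the embedding matrix recovers coordinates from conjugates; the bound is the sum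
    of the moduli of its entries. *)
Lemma coordinate_bound w : rat_spans w -> exists2 M : R, 0 <= M &
  forall (q : 'I_d -> rat) k, `|ratr (q k)| <= M * \sum_i cabs (s i) (\sum_k q k *: w k).
Proof.
move=> wQ; have Mu := embedding_mx_unit wQ; set Z := invmx (embedding_mx w).
have Z0 k i : 0 <= Normc.normc (Z k i) by apply: normc_ge0.
exists (\sum_k \sum_i Normc.normc (Z k i)).
  by apply: sumr_ge0 => k _; apply: sumr_ge0.
move=> q k; set x : K := \sum_k q k *: w k.
have qE : (ratr (q k) : C) = \sum_i Z k i * s i x.
  have h : embedding_mx w *m (\col_k ratr (q k)) = \col_i s i x.
    apply/colP => i; rewrite !mxE rmorph_sum; apply: eq_bigr => j _.
    by rewrite !mxE embeddingZ mulrC.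
  have := congr1 (mulmx Z) h; rewrite mulKmx// => /colP/(_ k); rewrite !mxE => ->.
  by apply: eq_bigr => i _; rewrite mxE.
rewrite -normc_ratr qE; apply: le_trans (ler_normc_sum _ _ _) _.
rewrite mulr_sumr; apply: ler_sum => i _; rewrite Normc.normcM.
apply: ler_wpM2r; first exact: normc_ge0.
apply: (@ler_term_sum _ _ k) => [k'|]; first by apply: sumr_ge0.
exact: (@ler_term_sum _ _ i).
Qed.

(** If [f] differed from every [cabs (s i)], some [e] would have [f e > 1] and all conjugates below
    1. The coordinates of [e ^+ k] would then tend to 0, hence also [f (e ^+ k)], although it is at
    least 1. *)
Lemma arch_place_embedding (f : K -> R) : is_arch_place f -> exists i, f = cabs (s i).
Proof.
move=> [fA fQ]; apply: contrapT => nf.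
have sA i := cabs_arch (s i).
have two (g : K -> R) : is_arch_place g -> g 2%:R = 2.
  by move=> [_ gQ]; rewrite -(ratr_nat K) gQ ratr_nat normr_nat.
have f2 : 1 < f 2%:R by rewrite two//; lra.
have [e [e1 eP]] := @absval_separate_family R K f 2%:R _ (fun i => cabs (s i)) fA f2
  (fun i => proj1 (sA i)) (fun i => etrans (two _ (sA i)) (esym (two _ (conj fA fQ))))
  (fun i h => nf (ex_intro _ i (esym h))).
pose w (k : 'I_d) := (vbasis {:K})`_k; have [M M0 MP] := coordinate_bound vbasis_spans.
pose B := \sum_k f (w k).
have B0 : 0 <= B by apply: sumr_ge0 => k _; apply: absval_ge0.
have bd x : f x <= M * B * \sum_i cabs (s i) x.
  have [q qE] := vbasis_spans x; rewrite {1}qE; apply: le_trans (ler_absval_sum fA _ _ _) _.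
  rewrite mulrAC mulr_sumr; apply: ler_sum => k _.
  rewrite -mulr_algl (absvalM fA) alg_num_field fQ; apply: ler_wpM2r; first exact: absval_ge0.
  by have := MP q k; rewrite -qE.
have y0 : 0 < (M * B + 1)^-1 / (d%:R + 1).
  by rewrite divr_gt0 ?invr_gt0// ltr_wpDl// mulr_ge0.
have small i : \forall k \near \oo, cabs (s i) e ^+ k < (M * B + 1)^-1 / (d%:R + 1).
  by apply: expr_small => //; rewrite eP andbT; apply: (absval_ge0 (proj1 (sA i))).
have [k _ /(_ k (leqnn k)) /= hk] := @filter_forall _ _ _ \oo _ small.
have := bd (e ^+ k); rewrite (absvalX fA).
have : 1 <= f e ^+ k by rewrite exprn_ege1// ltW.
have MB : 0 <= M * B by rewrite mulr_ge0.
have : \sum_i cabs (s i) (e ^+ k) <= \sum_(i < d) (M * B + 1)^-1 / (d%:R + 1).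
  by apply: ler_sum => i _; rewrite (absvalX (proj1 (sA i))); apply/ltW/hk.
rewrite sumr_const card_ord -[X in _ <= X]mulr_natr => h1 h2 h3.
have : M * B * \sum_i cabs (s i) (e ^+ k) <= M * B * ((M * B + 1)^-1 / (d%:R + 1) * d%:R) by rewrite ler_wpM2l.
have h4 : M * B * (M * B + 1)^-1 < 1 by rewrite ltr_pdivrMr ?mul1r ?ltrDl ?ltr_wpDl.
have h5 : (d%:R + 1 : R)^-1 * d%:R <= 1 by rewrite mulrC ler_pdivrMr ?mul1r ?lerDl// ltr_wpDl.
have h6 : 0 <= M * B * (M * B + 1)^-1 by rewrite divr_ge0// addr_ge0.
have h7 : 0 <= (d%:R + 1 : R)^-1 * d%:R by rewrite mulr_ge0// invr_ge0 addr_ge0.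
have : M * B * (M * B + 1)^-1 * ((d%:R + 1 : R)^-1 * d%:R) <= M * B * (M * B + 1)^-1 by rewrite ler_piMr.
rewrite !mulrA; lra.
Qed.

(** The embedding matrix conjugates multiplication by [x] into the diagonal matrix of the conjugates
    of [x]. *)
Lemma trace_embeddings (x : K) : (ratr (ftrace x) : C) = \sum_i s i x.
Proof.
pose E := embedding_mx (fun k => (vbasis {:K})`_k).
have Eu : E \in unitmx := embedding_mx_unit vbasis_spans.
pose Mx : 'M[C]_d := \matrix_(l, k) ratr (coord (vbasis {:K}) l (x * (vbasis {:K})`_k)).
have EM : diag_mx (\row_i s i x) *m E = E *m Mx.
  apply/matrixP => i k; rewrite mul_diag_mx !mxE -rmorphM.
  rewrite {1}(coord_vbasis (memvf (x * (vbasis {:K})`_k))) rmorph_sum; apply: eq_bigr => l _.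
  by rewrite !mxE embeddingZ mulrC.
have : \tr (diag_mx (\row_i s i x)) = \tr Mx.
  by rewrite -[Mx](mulKmx Eu) -EM mxtrace_mulC -mulmxA mulmxV// mulmx1.
rewrite mxtrace_diag => h; rewrite /ftrace rmorph_sum /=.
transitivity (\tr Mx); last by rewrite -h; apply: eq_bigr => i _; rewrite mxE.
by apply: eq_bigr => k _; rewrite mxE (tnth_nth 0).
Qed.

Lemma disc_embeddings (w : 'I_d -> K) :
  (ratr (\det (\matrix_(j, k) ftrace (w j * w k))) : C) = \det (embedding_mx w) ^+ 2.
Proof.
rewrite -det_map_mx expr2 -[X in _ = X * _]det_tr -det_mulmx; congr (\det _).
apply/matrixP => j k; rewrite !mxE [LHS]trace_embeddings; apply: eq_bigr => i _.
by rewrite ?mxE rmorphM ?mxE.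
Qed.
End Family.
End EmbeddingMatrix.

(** * Archimedean places, real coordinates and the covolume of the integers *)

Section ArchimedeanPlaces.
Variables (R : realType) (K : fieldExtType rat).
Variables (I : finType) (v : I -> K -> R) (v_inj : injective v).
Hypothesis S_arch : forall f : K -> R, is_arch_place f -> exists i, v i = f.
Variables (Kv : I -> fieldType) (iota : forall i, {rmorphism K -> Kv i}) (nv : forall i, Kv i -> R).
Hypothesis Kv_compl : forall i, is_completion (v i) (iota i) (@nv i).
Variables (dv : I -> nat) (dv_def : forall i, local_degree (@nv i) (dv i)).
Local Notation C := R[i].
Local Notation d := (\dim {:K}).
Local Notation arch := (fun i => `[< is_arch_place (v i) >]).

Let dimK_gt0 : (0 < d)%N. Proof. exact: adim_gt0. Qed.

(* Embeddings s_r are indexed by pairs t r = (place, conjugation flag): s_r is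
   sigma of the place, conjugated when the flag is set. *)
Definition embedding_pairing (s : 'I_d -> {rmorphism K -> C}) (t : 'I_d -> I * bool)
    (sigma : I -> {rmorphism K -> C}) : Prop :=
  [/\ injective t,
    forall i b, (exists r, t r = (i, b)) <-> arch i /\ (b -> dv i = 2%N),
    forall i, arch i -> v i = cabs (sigma i) /\
      (dv i = 2%N \/ (dv i = 1%N /\ forall x, complex.Im (sigma i x) = 0)),
    forall r x, s r x = if (t r).2 then conjc (sigma (t r).1 x) else sigma (t r).1 x &
    forall u : 'rV[C]_d, (forall x, \sum_i u 0 i * s i x = 0) -> u = 0].

Let conjc_real (z : C) : conjc z = z -> complex.Im z = 0.
Proof. by case: z => a b [] /=; lra. Qed.

(** [sigma i] is one chosen embedding over the place, and the flag marks the other one, which is its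
    conjugate since both have the same absolute value. The two degree computations show that
    [dv i = 2] exactly when [sigma i] is not real. *)
Lemma embedding_pairing_exists : exists s t sigma, embedding_pairing s t sigma.
Proof.
have [s [s_all s_inj s_conj s_ind]] := all_embeddings R K.
have r0P i : exists r, arch i -> v i = cabs (s r).
  case: (boolP (arch i)) => [/asboolP|_]; last by exists (Ordinal dimK_gt0).
  by move=> /(arch_place_embedding s_ind)[r]; exists r.
pose r0 i := projT1 (cid (r0P i)); have r0E i : arch i -> v i = cabs (s (r0 i)) := projT2 (cid (r0P i)).
have plP r : exists i, v i = cabs (s r) by apply: S_arch; apply: cabs_arch.
pose pl r := projT1 (cid (plP r)); have plE r : v (pl r) = cabs (s r) := projT2 (cid (plP r)).
have arch_pl r : arch (pl r) by apply/asboolP; rewrite plE; apply: cabs_arch.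
pose sigma i := s (r0 i); pose t r := (pl r, r != r0 (pl r)).
have deg i : arch i -> dv i = 2%N \/ (dv i = 1%N /\ forall x, complex.Im (sigma i x) = 0).
  move=> ai; have fE x : v i x ^+ 2 = complex.Re (sigma i x) ^+ 2 + complex.Im (sigma i x) ^+ 2.
    by rewrite (r0E _ ai) /cabs normc_sqr.
  have ReB (x y : K) : complex.Re (sigma i (x - y)) = complex.Re (sigma i x) - complex.Re (sigma i y).
    by rewrite rmorphB; case: (sigma i x) (sigma i y) => ? ? [].
  have ImB (x y : K) : complex.Im (sigma i (x - y)) = complex.Im (sigma i x) - complex.Im (sigma i y).
    by rewrite rmorphB; case: (sigma i x) (sigma i y) => ? ? [].
  have Re1 : complex.Re (sigma i 1) = 1 by rewrite rmorph1.
  have Im1 : complex.Im (sigma i 1) = 0 by rewrite rmorph1.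
  have [im0|] := pselect (forall x, complex.Im (sigma i x) = 0).
    right; split=> //.
    exact: (arch_degree_real (Kv_compl i) fE ReB (Re_embeddingZ _) Re1 im0 (dv_def i)).
  move=> nim; left; have [x xP] : exists x, complex.Im (sigma i x) != 0.
    apply: contrapT => h; apply: nim => x; apply/eqP; apply: contraT => hx.
    by case: h; exists x.
  exact: (arch_degree_complex (Kv_compl i) fE ReB ImB (Re_embeddingZ _) (Im_embeddingZ _) Re1 Im1 xP (dv_def i)).
have sE r x : s r x = if (t r).2 then conjc (sigma (t r).1 x) else sigma (t r).1 x.
  rewrite /t /=; have [e|ne] := eqVneq r (r0 (pl r)); first by rewrite /= /sigma -e.
  have := s_conj (r0 (pl r)) (s r); rewrite -(r0E _ (arch_pl r)) plE => /(_ erefl)[h|//].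
  by move/eqP: ne; case; apply: s_inj.
have tinj : injective t.
  by move=> r r' tE; apply: s_inj => x; rewrite (sE r) (sE r') tE.
exists s, t, sigma; split=> //; last by move=> i ai; split; [apply: r0E | apply: deg].
have pl_r0 i : arch i -> pl (r0 i) = i.
  by move=> ai; apply: v_inj; rewrite plE -(r0E _ ai).
move=> i b; split=> [[r [<- <-]]|[ai hb]].
  split=> // ne; case: (deg _ (arch_pl r)) => [//|[_ im0]].
  move/eqP: ne; case; apply: s_inj => x; rewrite -/(sigma (pl r)).
  have := sE r x; rewrite /=; case: ifP => // _ ->.
  by have := im0 x; case: (sigma (pl r) x) => a' b' /= ->; rewrite oppr0.
case: b hb => [/(_ isT) d2|_]; last by exists (r0 i); rewrite /t pl_r0// eqxx.
have [u uE] := conj_embedding (sigma i); have [r rE] := s_all u.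
have pr : pl r = i.
  apply: v_inj; rewrite plE (r0E _ ai); apply/funext => x.
  by rewrite /cabs -rE uE normc_conj.
exists r; rewrite /t pr; congr (_, _); apply/eqP => rr.
have im0 x : complex.Im (sigma i x) = 0.
  by apply: conjc_real; rewrite -uE rE rr.
have fE x : v i x ^+ 2 = complex.Re (sigma i x) ^+ 2 + complex.Im (sigma i x) ^+ 2.
  by rewrite (r0E _ ai) /cabs normc_sqr.
have ReB (x y : K) : complex.Re (sigma i (x - y)) = complex.Re (sigma i x) - complex.Re (sigma i y).
  by rewrite rmorphB; case: (sigma i x) (sigma i y) => ? ? [].
have Re1 : complex.Re (sigma i 1) = 1 by rewrite rmorph1.
have := arch_degree_real (Kv_compl i) fE ReB (Re_embeddingZ _) Re1 im0 (dv_def i).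
by rewrite d2.
Qed.

Section Pairing.
Variables (s : 'I_d -> {rmorphism K -> C}) (t : 'I_d -> I * bool) (sigma : I -> {rmorphism K -> C}).
Hypothesis st : embedding_pairing s t sigma.

Let pairing_fst i : arch i -> exists r, t r = (i, false).
Proof. by move=> ai; have [_ tim _ _ _] := st; apply/tim. Qed.

Lemma prod_pairing (F : comPzSemiRingType) (G : I -> bool -> F) :
  \prod_r G (t r).1 (t r).2 = \prod_(i | arch i) (if dv i == 2%N then G i false * G i true else G i false).
Proof.
have [tinj tim _ _ _] := st.
transitivity (\prod_(p in [set t r | r : 'I_d]) G p.1 p.2).
  by rewrite big_imset //= => x y _ _; apply: tinj.
transitivity (\prod_(p | arch p.1 && (p.2 ==> (dv p.1 == 2%N))) G p.1 p.2).
  apply: eq_bigl => -[i b] /=; apply/imsetP/idP => [[r _ rE]|/andP[ai /implyP hb]].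
    have [] := (proj1 (tim i b) (ex_intro _ r (esym rE))) => -> h.
    by apply/implyP => /h ->.
  have [r rE] := proj2 (tim i b) (conj ai (fun h => eqP (hb h))).
  by exists r.
rewrite -(pair_big_dep arch (fun i b => b ==> (dv i == 2%N)) G) /=.
apply: eq_bigr => i _; rewrite big_mkcond big_bool /=.
by case: ifP => _; rewrite ?mul1r// mulrC.
Qed.

Lemma prod_pairing_place (G : I -> R) :
  \prod_r G (t r).1 = \prod_(i | arch i) G i ^+ dv i.
Proof.
have [_ _ deg _ _] := st.
rewrite (prod_pairing (fun i _ => G i)); apply: eq_bigr => i ai.
by case: (deg i ai) => _ [->|[-> _]].
Qed.

Definition complex_part (b : bool) (z : C) : R := if b then complex.Im z else complex.Re z.

(** The flag that marks conjugation in [s] here selects the imaginary part, so that a complex place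
    supplies Re and Im and a real place only Re. *)
Definition real_coordinate (r : 'I_d) (x : K) : R := complex_part (t r).2 (sigma (t r).1 x).

Lemma complex_partB b x y : complex_part b (x - y) = complex_part b x - complex_part b y.
Proof. by case: x y b => ? ? [? ?] []. Qed.

Lemma complex_partD b x y : complex_part b (x + y) = complex_part b x + complex_part b y.
Proof. by case: x y b => ? ? [? ?] []. Qed.

Lemma complex_part_sum b (J : Type) (l : seq J) (P : pred J) (F : J -> C) :
  complex_part b (\sum_(j <- l | P j) F j) = \sum_(j <- l | P j) complex_part b (F j).
Proof.
by elim/big_rec2 : _ => [|j x y _ <-]; [case: b | rewrite complex_partD].
Qed.

Lemma complex_part_int b (k : int) x : complex_part b (k%:~R * x) = k%:~R * complex_part b x.
Proof.
rewrite -(ratr_int C) ratr_complex ratr_int; case: x b => x1 x2 [] /=.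
  by rewrite mul0r addr0.
by rewrite mul0r subr0.
Qed.

Lemma normc_pairing i z : arch i -> (dv i = 1%N -> complex.Im z = 0) ->
  Normc.normc z ^+ 2 = \sum_(r | (t r).1 == i) complex_part (t r).2 z ^+ 2.
Proof.
move=> ai zr; have [tinj tim deg _ _] := st.
have [_ dE] := deg _ ai; rewrite normc_sqr.
have [r0 r0E] := pairing_fst ai.
rewrite /complex_part (bigD1 r0) ?r0E//=; congr (_ + _).
case: dE => [d2|[d1 _]].
  have [r1 r1E] := proj2 (tim i true) (conj ai (fun _ => d2)).
  rewrite (bigD1 r1) /= ?r1E ?eqxx/=; last by apply/eqP => e; move: r1E; rewrite e r0E.
  rewrite big1 ?addr0// => r /andP[/andP[/eqP ri n0] n1].
  case rE : (t r) ri => [j b] /= ji; rewrite ji in rE.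
  case: b rE => rE; first by move/eqP: n1; case; apply: tinj; rewrite rE r1E.
  by move/eqP: n0; case; apply: tinj; rewrite rE r0E.
rewrite zr// expr0n big1// => r /andP[/eqP ri n0].
case rE : (t r) ri => [j b] /= ji; rewrite ji in rE.
have [_ hb] := proj1 (tim i b) (ex_intro _ r rE).
case: b rE hb => rE hb; first by have := hb isT; rewrite d1.
by move/eqP: n0; case; apply: tinj; rewrite rE r0E.
Qed.

Definition coordinate_mx (w : 'I_d -> K) : 'M[R]_d := \matrix_(r, k) real_coordinate r (w k).

(** The change of coordinates from (Re z, Im z) to z and its conjugate, place by place. *)
Definition pairing_mx : 'M[C]_d := \matrix_(r, r')
  if (t r).1 == (t r').1 then
    (if (t r').2 then (if (t r).2 then - 'i%C else 'i%C) else 1) else 0.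

Lemma embedding_mx_coordinate w :
  embedding_mx s w = pairing_mx *m map_mx (real_complex R) (coordinate_mx w).
Proof.
have [tinj tim deg sE _] := st; apply/matrixP => r k; rewrite !mxE sE.
under eq_bigr do rewrite !mxE.
set i := (t r).1; set z := sigma i (w k).
have ti : exists r, t r = (i, (t r).2) by exists r; rewrite -surjective_pairing.
have [ai _] := proj1 (tim i (t r).2) (ex_intro _ r (surjective_pairing _)).
have [_ dE] := deg _ ai.
have [r0 r0E] := pairing_fst ai.
rewrite (bigD1 r0)//= r0E /= eqxx mul1r /real_coordinate /complex_part r0E /= -/z.
case: dE => [d2|[d1 im0]].
  have [r1 r1E] := proj2 (tim i true) (conj ai (fun _ => d2)).
  rewrite (bigD1 r1) /=; last by apply/eqP => e; move: r1E; rewrite e r0E.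
  rewrite r1E /= eqxx -/z big1 ?addr0; last first.
    move=> r' /andP[n0 n1]; case: eqP => [ri|_]; last by rewrite mul0r.
    case rE : (t r') ri => [j b] /= ji; rewrite -ji in rE.
    case: b rE => rE; first by move/eqP: n1; case; apply: tinj; rewrite rE r1E.
    by move/eqP: n0; case; apply: tinj; rewrite rE r0E.
  by case: (t r).2; rewrite ?mulNr [z in LHS]complexE ?rmorphD ?rmorphM //=; case: z => a b; simpc.
rewrite big1 ?addr0; last first.
  move=> r' n0; case: eqP => [ri|_]; last by rewrite mul0r.
  case rE : (t r') ri => [j b] /= ji; rewrite -ji in rE.
  have [_ hb] := proj1 (tim i b) (ex_intro _ r' rE).
  case: b rE hb => rE hb; first by have := hb isT; rewrite d1.
  by move/eqP: n0; case; apply: tinj; rewrite rE r0E.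
have := im0 (w k); rewrite -/z; case: (z) => a b /= ->.
by case: ifP; rewrite ?oppr0.
Qed.

(** The rows are orthogonal, of squared length 2 at complex and 1 at real places; a complex place
    occupies two rows, hence the factor 4. *)
Lemma normc_det_pairing : Normc.normc (\det pairing_mx) ^+ 2 =
  \prod_(i | arch i) (if dv i == 2%N then 4 else 1).
Proof.
have [tinj tim deg _ _] := st.
pose Dg : 'rV[C]_d := \row_r (if dv (t r).1 == 2%N then 2 else 1).
have UU : pairing_mx *m (map_mx conjc pairing_mx)^T = diag_mx Dg.
  apply/matrixP => r r'; rewrite !mxE.
  under eq_bigr do rewrite !mxE.
  set i := (t r).1.
  have [ai hb] := proj1 (tim i (t r).2) (ex_intro _ r (surjective_pairing _)).
  have [_ dE] := deg _ ai.
  have [r0 r0E] := pairing_fst ai.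
  have [ri|rne] := eqVneq (t r').1 i; last first.
    rewrite big1; last first.
      move=> k _; case: (eqVneq i (t k).1) => [<-|_]; last by rewrite mul0r.
      by rewrite (negbTE rne) conjc0 mulr0.
    have -> : (r == r') = false by apply/eqP => e; rewrite -e /i eqxx in rne.
    by rewrite mulr0n.
  rewrite (bigD1 r0)//= r0E /= eqxx ri eqxx conjc1 mul1r.
  case: dE => [d2|[d1 im0]].
    have [r1 r1E] := proj2 (tim i true) (conj ai (fun _ => d2)).
    rewrite (bigD1 r1) /=; last by apply/eqP => e; move: r1E; rewrite e r0E.
    rewrite r1E /= eqxx big1 ?addr0; last first.
      move=> k /andP[n0 n1]; case: (eqVneq i (t k).1) => [ki|_]; last by rewrite mul0r.
      case kE : (t k) ki => [j b] /= ji; rewrite -ji in kE.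
      case: b kE => kE; first by move/eqP: n1; case; apply: tinj; rewrite kE r1E.
      by move/eqP: n0; case; apply: tinj; rewrite kE r0E.
    have -> : (r == r') = ((t r).2 == (t r').2).
      apply/eqP/eqP => [->//|e]; apply: tinj.
      by rewrite [LHS]surjective_pairing [RHS]surjective_pairing e ri.
    rewrite d2 /=; case: (t r).2; case: (t r').2 => /=; rewrite ?mulr1n ?mulr0n; apply/eqP; rewrite eq_complex /=;
      apply/andP; split; apply/eqP; lra.
  rewrite big1 ?addr0; last first.
    move=> k n0; case: (eqVneq i (t k).1) => [ki|_]; last by rewrite mul0r.
    case kE : (t k) ki => [j b] /= ji; rewrite -ji in kE.
    have [_ hb'] := proj1 (tim i b) (ex_intro _ k kE).
    case: b kE hb' => kE hb'; first by have := hb' isT; rewrite d1.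
    by move/eqP: n0; case; apply: tinj; rewrite kE r0E.
  have -> : r = r'.
    apply: tinj; rewrite [LHS]surjective_pairing [RHS]surjective_pairing ri -/i; congr (_, _).
    have tr' : t r' = (i, (t r').2) by rewrite -ri -surjective_pairing.
    have [_ hb'] := proj1 (tim i (t r').2) (ex_intro _ r' tr').
    by case: (t r).2 hb => [/(_ isT)|_]; case: (t r').2 hb' => [/(_ isT)|_]; rewrite ?d1.
  by rewrite eqxx /i d1 mulr1n.
have := congr1 (fun A : 'M[C]_d => \det A) UU.
rewrite det_mulmx det_tr det_map_mx det_diag -sqr_normc -add_Re2_Im2 -normc_sqr.
under eq_bigr do rewrite mxE.
rewrite (prod_pairing (fun i _ => if dv i == 2%N then 2 else 1)) => h.
apply: (fmorph_inj (real_complex R)); rewrite [LHS]h rmorph_prod; apply: eq_bigr => i _.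
by case: (dv i == 2%N) => /=; apply/eqP; rewrite eq_complex /=; apply/andP; split; apply/eqP; lra.
Qed.

(** The origin of the factor 2^s between |D_K|^(1/2) and the covolume of O_K in the coordinates Re,
    Im. *)
Lemma abs_disc_coordinate (w : 'I_d -> K) :
  `|ratr (\det (\matrix_(j, k) ftrace (w j * w k))) : R| =
  4 ^+ #|finset (fun i => arch i && (dv i == 2%N))| * \det (coordinate_mx w) ^+ 2.
Proof.
have [_ _ _ _ ind] := st.
rewrite -normc_ratr (disc_embeddings ind) embedding_mx_coordinate det_mulmx det_map_mx.
rewrite exprMn Normc.normcM.
have sq (z : C) : Normc.normc (z ^+ 2) = Normc.normc z ^+ 2 by rewrite !expr2 Normc.normcM.
rewrite !sq normc_det_pairing -big_mkcondr /= prodr_const.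
have -> : #|[pred i | arch i && (dv i == 2%N)]| = #|finset (fun i => arch i && (dv i == 2%N))|.
  by apply: eq_card => i; rewrite !inE.
by congr (_ * _); rewrite /= expr0n addr0 sqrtr_sqr real_normK ?num_real.
Qed.

Lemma coordinate_mx_unit w : rat_spans w -> coordinate_mx w \in unitmx.
Proof.
move=> wQ; have [_ _ _ _ ind] := st.
have := embedding_mx_unit ind wQ.
rewrite !unitmxE !unitfE embedding_mx_coordinate det_mulmx mulf_eq0 negb_or => /andP[_].
by rewrite det_map_mx fmorph_eq0.
Qed.

(** The limit is the supremum of the lower estimates u_a - 1/(a+1), each of which lies below every
    upper estimate u_b + 1/(b+1). *)
Lemma real_sup_lim (u : nat -> R) : (forall a b, `|u a - u b| <= a.+1%:R^-1 + b.+1%:R^-1) ->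
  exists l, forall a, `|u a - l| <= a.+1%:R^-1.
Proof.
move=> h; pose E : set R := [set u a - a.+1%:R^-1 | a in setT].
have ubE b : ubound E (u b + b.+1%:R^-1).
  move=> _ [a _ <-]; have := h a b; rewrite ler_norml => /andP[_ h2]; rewrite lerBlDr; apply: le_trans (_ : u b + (a.+1%:R^-1 + b.+1%:R^-1) <= _); [by rewrite -lerBlDl | by rewrite addrA addrAC].
have E0 : E !=set0 by exists (u 0%N - 1%:R^-1); exists 0%N.
have hE : has_sup E by split=> //; exists (u 0%N + 1%:R^-1); apply: ubE.
exists (sup E) => a; rewrite ler_norml.
have h1 : sup E <= u a + a.+1%:R^-1 by apply: sup_le_ub.
have h2 : u a - a.+1%:R^-1 <= sup E by apply: sup_upper_bound => //; exists a.
by set q : R := a.+1%:R^-1 in h1 h2 *; lra.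
Qed.

Lemma normc_le_parts (z : C) : Normc.normc z <= `|complex.Re z| + `|complex.Im z|.
Proof.
rewrite -(@ler_pXn2r _ 2)// ?nnegrE ?normc_ge0 ?addr_ge0// normc_sqr.
rewrite -[X in X + _ <= _]real_normK ?num_real// -[X in _ + X <= _]real_normK ?num_real//.
by have := mulr_ge0 (normr_ge0 (complex.Re z)) (normr_ge0 (complex.Im z)); nra.
Qed.

(** The number [al] is the image of [a] under the isometric extension of [sigma i] to K_v, obtained
    as the limit of [sigma i (x n)] for [x n] in K tending to [a]. *)
Lemma completion_element_complex i (a : Kv i) : arch i -> exists al : C, forall e : R, 0 < e ->
  exists2 x : K, nv (a - iota i x) < e & Normc.normc (al - sigma i x) < e.
Proof.
move=> ai; have [_ _ deg _ _] := st; have [vE _] := deg _ ai.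
have [nA [nE [_ dens]]] := Kv_compl i.
have xP n : exists x, nv (a - iota i x) < n.+1%:R^-1 / 2 by apply: dens; rewrite divr_gt0 ?invr_gt0.
pose x n := projT1 (cid (xP n)); have xE n : nv (a - iota i (x n)) < n.+1%:R^-1 / 2 := projT2 (cid (xP n)).
have xd p q : Normc.normc (sigma i (x p) - sigma i (x q)) <= p.+1%:R^-1 + q.+1%:R^-1.
  rewrite -rmorphB -[Normc.normc _]/(cabs (sigma i) _) -vE -nE.
  have -> : iota i (x p - x q) = (a - iota i (x q)) - (a - iota i (x p)) by rewrite rmorphB; ring.
  apply: le_trans (ler_absvalB nA _ _) _.
  have := xE p; have := xE q.
  have : 0 < (p.+1%:R : R)^-1 by rewrite invr_gt0.
  have : 0 < (q.+1%:R : R)^-1 by rewrite invr_gt0.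
  by set P : R := p.+1%:R^-1; set Q : R := q.+1%:R^-1; lra.
have parts (z : C) : `|complex.Re z| <= Normc.normc z /\ `|complex.Im z| <= Normc.normc z.
  by split; rewrite -(@ler_pXn2r _ 2)// ?nnegrE ?normc_ge0// normc_sqr real_normK ?num_real//
    ?lerDl ?lerDr sqr_ge0.
have [l1 h1] : exists l, forall n, `|complex.Re (sigma i (x n)) - l| <= n.+1%:R^-1.
  apply: real_sup_lim => p q; apply: le_trans (xd p q).
  have := proj1 (parts (sigma i (x p) - sigma i (x q))).
  by case: (sigma i (x p)) (sigma i (x q)) => ? ? [].
have [l2 h2] : exists l, forall n, `|complex.Im (sigma i (x n)) - l| <= n.+1%:R^-1.
  apply: real_sup_lim => p q; apply: le_trans (xd p q).
  have := proj2 (parts (sigma i (x p) - sigma i (x q))).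
  by case: (sigma i (x p)) (sigma i (x q)) => ? ? [].
exists (complex.Complex l1 l2) => e e0.
pose n := Num.bound (2 / e).
have hn : 2 / e < n%:R by apply: archi_boundP; rewrite divr_ge0// ltW.
have n0 : (0 : R) < n.+1%:R by [].
have ne : 2 * (n.+1%:R : R)^-1 < e.
  rewrite ltr_pdivrMr//; have : (n%:R : R) <= n.+1%:R by rewrite ler_nat.
  by move: hn; rewrite ltr_pdivrMr//; nra.
have ni : 0 < (n.+1%:R : R)^-1 by rewrite invr_gt0.
set Y : R := n.+1%:R^-1 in ni ne *.
exists (x n); first by have := xE n; rewrite -/Y; lra.
apply: le_lt_trans (normc_le_parts _) _.
have := h1 n; have := h2 n; rewrite -/Y; case: (sigma i (x n)) => b c /=.
rewrite -[`|l1 - b|]normrN -[`|l2 - c|]normrN !opprB; lra.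
Qed.

(** Replacing [a j] and [al j] by a common approximation [b j] in K changes either side by at most
    [e * M], and for coefficients in K the two sides coincide; [e] is arbitrary. *)
Lemma completion_form_complex i n (a : 'I_n -> Kv i) : arch i -> exists al : 'I_n -> C,
  (forall (x : 'I_n -> K) y, nv (\sum_j a j * iota i (x j) - iota i y) =
     Normc.normc (\sum_j al j * sigma i (x j) - sigma i y)) /\
  (dv i = 1%N -> forall j, complex.Im (al j) = 0).
Proof.
move=> ai; have [_ _ deg _ _] := st; have [vE dE] := deg _ ai.
have [nA [nE _]] := Kv_compl i.
have alP j := completion_element_complex (a j) ai.
pose al j := projT1 (cid (alP j)); have alE j := projT2 (cid (alP j)).
exists al; split; last first.
  move=> d1; case: dE => [|[_ im0]]; first by rewrite d1.
  move=> j; apply/eqP; rewrite -normr_eq0 eq_le normr_ge0 andbT; apply/ler_addgt0Pr => e e0.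
  rewrite add0r; have [x _ hx] := alE j e e0; apply: le_trans (ltW hx).
  rewrite -(@ler_pXn2r _ 2)// ?nnegrE ?normc_ge0// normc_sqr real_normK ?num_real//.
  by have := im0 x; rewrite -/(al j); case: (al j) (sigma i x) => ? ? [? ?] /= ->; rewrite subr0 lerDr sqr_ge0.
move=> x y; pose M := 1 + \sum_j v i (x j).
have vA : is_absval (v i) by rewrite vE; case: (cabs_arch (sigma i)).
have M0 : 0 < M by rewrite ltr_pwDl//; apply: sumr_ge0 => j _; apply: absval_ge0.
have cA := proj1 (cabs_arch (sigma i)).
have near e : 0 < e -> `|nv (\sum_j a j * iota i (x j) - iota i y) -
     Normc.normc (\sum_j al j * sigma i (x j) - sigma i y)| <= 2 * e * M.
  move=> e0.
  pose b j := projT1 (cid2 (alE j e e0)).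
  have b1 j : nv (a j - iota i (b j)) < e by rewrite /b; case: cid2.
  have b2 j : Normc.normc (al j - sigma i (b j)) < e by rewrite /b; case: cid2.
  pose z := \sum_j b j * x j - y.
  have zE : nv (iota i z) = Normc.normc (sigma i z) by rewrite nE vE.
  have s1 : nv (\sum_j a j * iota i (x j) - iota i y - iota i z) <= e * M.
    have -> : \sum_j a j * iota i (x j) - iota i y - iota i z = \sum_j (a j - iota i (b j)) * iota i (x j).
      rewrite /z rmorphB rmorph_sum opprB addrA subrK -sumrB.
      by apply: eq_bigr => j _; rewrite rmorphM mulrBl.
    apply: le_trans (ler_absval_sum nA _ _ _) _.
    apply: (@le_trans _ _ (\sum_j e * v i (x j))); last by rewrite -mulr_sumr ler_pM2l// /M lerDr.
    apply: ler_sum => j _; rewrite (absvalM nA) nE; apply: ler_wpM2r; first exact: absval_ge0.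
    exact: ltW.
  have s2 : Normc.normc (\sum_j al j * sigma i (x j) - sigma i y - sigma i z) <= e * M.
    have -> : \sum_j al j * sigma i (x j) - sigma i y - sigma i z = \sum_j (al j - sigma i (b j)) * sigma i (x j).
      rewrite /z rmorphB rmorph_sum opprB addrA subrK -sumrB.
      by apply: eq_bigr => j _; rewrite rmorphM mulrBl.
    apply: le_trans (ler_normc_sum _ _ _) _.
    apply: (@le_trans _ _ (\sum_j e * v i (x j))); last by rewrite -mulr_sumr ler_pM2l// /M lerDr.
    apply: ler_sum => j _; rewrite Normc.normcM vE; apply: ler_wpM2r; first exact: normc_ge0.
    exact: ltW.
  set A := \sum_j a j * iota i (x j) - iota i y in s1 *.
  set B := \sum_j al j * sigma i (x j) - sigma i y in s2 *.
  have t1 : nv A <= nv (A - iota i z) + nv (iota i z) by have := ler_absvalD nA (A - iota i z) (iota i z); rewrite subrK.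
  have t2 : nv (iota i z) <= nv A + nv (A - iota i z) by have := ler_absvalB nA A (A - iota i z); rewrite opprB addrC subrK.
  have t3 : Normc.normc B <= Normc.normc (B - sigma i z) + Normc.normc (sigma i z).
    by have := le_normcD (B - sigma i z) (sigma i z); rewrite subrK.
  have t4 : Normc.normc (sigma i z) <= Normc.normc B + Normc.normc (B - sigma i z).
    have := le_normcD B (- (B - sigma i z)); rewrite opprB addrC subrK.
    by rewrite -[Normc.normc (sigma i z - B)]normcN opprB.
  by rewrite ler_norml; lra.
apply/eqP; rewrite -subr_eq0 -normr_eq0 eq_le normr_ge0 andbT; apply/ler_addgt0Pr => e e0.
rewrite add0r; have e1 : 0 < e / (2 * M) by rewrite divr_gt0// mulr_gt0.
apply: le_trans (near _ e1) _.
have Mn : M != 0 by rewrite gt_eqF.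
by rewrite (_ : 2 * (e / (2 * M)) * M = e)//; field.
Qed.
End Pairing.
End ArchimedeanPlaces.

(** * Lattice points in discs and intervals *)

Section DiscCount.
Variable R : realType.

(* The sector between angles b < a of the quarter disc, compared with the
   rectangle on the base [cos a, cos b] whose height is sin a. *)
Lemma sector_le_rectangle (a b : R) : 0 <= b -> b < a -> a <= pi / 2 ->
  (a - sin a * cos a) / 2 - (b - sin b * cos b) / 2 <= (cos b - cos a) * sin a.
Proof.
(* [H a - H b] is the difference of the two sides, and the derivative sin x (sin a - sin x) is
   nonnegative between [b] and [a]. *)
move=> b0 ba a2; pose H x : R := - (cos x * sin a) - (x - sin x * cos x) / 2.
pose dH x : R := sin x * sin a - (1 - (cos x * cos x - sin x * sin x)) / 2.
have Hd (x : R) : is_derive x 1 H (dH x).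
  by apply: is_derive_eq; rewrite /dH /GRing.scale /=; ring.
have [c|] := @MVT R H dH b a ba (fun x _ => Hd x).
  apply: derivable_within_continuous => x _; exact: ex_derive.
move=> c; rewrite in_itv /= => /andP[bc ca] E.
have sc : sin c <= sin a.
  apply/ltW; rewrite ltr_sin// in_itv /=; lra.
have s0 : 0 <= sin c by apply: sin_ge0_pi; lra.
have := cos2Dsin2 c; rewrite !expr2 => cs.
have : 0 <= dH c * (a - b).
  apply: mulr_ge0; last lra.
  by rewrite /dH; nra.
by rewrite -E /H; lra.
Qed.

(** [G (acos x)] is the area under the unit quarter circle to the right of [x]; the sum over the
    grid a/T telescopes to the whole area pi/4. *)
Lemma quarter_disc_riemann (T : nat) : (0 < T)%N ->
  pi / 4 * T%:R ^+ 2 <= \sum_(a < T) Num.sqrt (T%:R ^+ 2 - a%:R ^+ 2) :> R.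
Proof.
move=> T0; have TR : 0 < (T%:R : R) by rewrite ltr0n.
pose x a : R := a%:R / T%:R.
have x01 a : (a <= T)%N -> 0 <= x a <= 1.
  by move=> aT; rewrite /x divr_ge0//= ler_pdivrMr// mul1r ler_nat.
have xm a : (a <= T)%N -> -1 <= x a <= 1 by move=> /x01; lra.
pose G (y : R) := (y - sin y * cos y) / 2.
have co a : (a <= T)%N -> cos (acos (x a)) = x a by move=> /xm /acos_def[].
have step (a : 'I_T) : G (acos (x a)) - G (acos (x a.+1)) <= T%:R^-1 * sin (acos (x a)).
  have aT : (a <= T)%N := ltnW (ltn_ord a).
  have a1T : (a.+1 <= T)%N := ltn_ord a.
  have [/andP[p0 p1] _] := acos_def (xm _ aT); have [/andP[q0 q1] _] := acos_def (xm _ a1T).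
  have lt : acos (x a.+1) < acos (x a).
    rewrite -ltr_cos ?in_itv /= ?p0 ?q0// !co// /x ltr_pM2r ?invr_gt0// ltr_nat//.
  have le2 : acos (x a) <= pi / 2.
    rewrite leNgt; apply/negP => h.
    have : cos (acos (x a)) < cos (pi / 2).
      rewrite ltr_cos// in_itv /= ?p0//; have := @pi_ge0 R; lra.
    by rewrite cos_pihalf co// ltNge; have /andP[-> _] := x01 _ aT.
  have := sector_le_rectangle q0 lt le2; rewrite -/(G _) -/(G _) !co//.
  have xd : x a.+1 - x a = T%:R^-1 by rewrite /x -natr1; ring.
  by rewrite xd.
have tel : \sum_(0 <= a < T) (- G (acos (x a.+1)) - - G (acos (x a))) = G (acos (x 0%N)) - G (acos (x T)).
  by rewrite (telescope_sumr (fun a => - G (acos (x a)))) // opprK addrC.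
have : G (acos (x 0%N)) - G (acos (x T)) <= \sum_(a < T) T%:R^-1 * sin (acos (x a)).
  rewrite -tel big_mkord; apply: ler_sum => a _; rewrite opprK addrC; exact: step.
rewrite /x mul0r divff ?gt_eqF// acos0 acos1 /G sin_pihalf cos_pihalf sin0 mulr0 mul0r !subr0 mul0r subr0.
rewrite -mulr_sumr [X in _ <= X]mulrC ler_pdivlMr// => h.
have -> : pi / 4 * T%:R ^+ 2 = pi / 2 / 2 * T%:R * T%:R :> R by field.
apply: (@le_trans _ _ ((\sum_(i < T) sin (acos (x i))) * T%:R)); first by rewrite ler_pM2r.
rewrite mulr_suml; apply: ler_sum => a _.
have aT : (a <= T)%N := ltnW (ltn_ord a).
rewrite sin_acos ?xm//.
rewrite -[X in _ * X](ger0_norm (ltW TR)) -sqrtr_sqr -sqrtrM; last first.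
  have := x01 _ aT => /andP[x0 x1]; rewrite subr_ge0 exprn_ile1//.
by rewrite mulrBl mul1r -exprMn /x divfK ?gt_eqF.
Qed.

(** Rounding each of the [T] rows down costs at most [T] in all, and passing from the heights [g a]
    to [g a.+1] costs at most [g 0 = T]. *)
Lemma quarter_disc_count (T : nat) :
  pi / 4 * T%:R ^+ 2 - 2 * T%:R <=
  #|finset (fun ab : 'I_T * 'I_T => (ab.1.+1 ^ 2 + ab.2.+1 ^ 2 <= T ^ 2)%N)|%:R :> R.
Proof.
case: (posnP T) => [->|T0]; first by rewrite expr0n /= !mulr0 subr0 ler0n.
pose g a : R := Num.sqrt (T%:R ^+ 2 - a%:R ^+ 2).
have TR : 0 <= (T%:R : R) by [].
have gle a : g a <= T%:R.
  rewrite /g -[X in _ <= X](ger0_norm TR) -sqrtr_sqr ler_wsqrtr// gerBl sqr_ge0//.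
have row (a : 'I_T) : g a.+1 - 1 <= (#|finset (fun b : 'I_T => (a.+1 ^ 2 + b.+1 ^ 2 <= T ^ 2)%N)|%:R : R).
  pose k := Num.truncn (g a.+1).
  have g0 : 0 <= g a.+1 by apply: sqrtr_ge0.
  have /andP[k1 k2] := truncn_itv g0.
  have kT : (k <= T)%N by rewrite -(ler_nat R); apply: le_trans (gle a.+1).
  apply: (@le_trans _ _ k%:R); first by rewrite -/k -natr1 in k2; lra.
  have wI : injective (widen_ord kT) by move=> b b' [] e; apply: val_inj.
  rewrite ler_nat -[X in (X <= _)%N]card_ord -(card_imset _ wI).
  apply: subset_leq_card; apply/fintype.subsetP => _ /imsetP[b _ ->]; rewrite inE /=.
  have bk : (b.+1%:R : R) <= g a.+1 by apply: le_trans k1; rewrite ler_nat.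
  have aT : (a.+1 <= T)%N := ltn_ord a.
  rewrite -(ler_nat R) natrD !natrX.
  have : (b.+1%:R : R) ^+ 2 <= g a.+1 ^+ 2 by rewrite ler_pXn2r// nnegrE.
  rewrite /g sqr_sqrtr; first by rewrite lerBrDl.
  by rewrite subr_ge0 ler_pXn2r ?nnegrE// ler_nat.
have -> : #|finset (fun ab : 'I_T * 'I_T => (ab.1.+1 ^ 2 + ab.2.+1 ^ 2 <= T ^ 2)%N)| =
   (\sum_(a < T) #|finset (fun b : 'I_T => (a.+1 ^ 2 + b.+1 ^ 2 <= T ^ 2)%N)|)%N.
  pose c (a b : 'I_T) := if (a.+1 ^ 2 + b.+1 ^ 2 <= T ^ 2)%N then 1%N else 0%N.
  transitivity (\sum_(p : 'I_T * 'I_T) c p.1 p.2)%N.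
    by rewrite -sum1_card big_mkcond; apply: eq_bigr => p _; rewrite inE.
  rewrite -(pair_bigA _ c); apply: eq_bigr => a _.
  by rewrite -[RHS]sum1_card [RHS]big_mkcond; apply: eq_bigr => b _; rewrite inE.
rewrite natr_sum; apply: (@le_trans _ _ (\sum_(a < T) (g a.+1 - 1))); last exact: ler_sum.
have := quarter_disc_riemann T0; rewrite -/g.
have -> : \sum_(a < T) Num.sqrt (T%:R ^+ 2 - a%:R ^+ 2) = \sum_(a < T) g a :> R by [].
rewrite sumrB sumr_const card_ord.
have -> : \sum_(a < T) g a = \sum_(a < T) g a.+1 + g 0%N - g T.
  have : \sum_(a < T.+1) g a = \sum_(a < T) g a + g T by rewrite big_ord_recr.
  have : \sum_(a < T.+1) g a = g 0%N + \sum_(a < T) g a.+1 by rewrite big_ord_recl.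
  by move=> -> /eqP; rewrite -subr_eq => /eqP <-; ring.
have := gle 0%N; have : 0 <= g T by apply: sqrtr_ge0.
rewrite -[_ *+ T]/(T%:R : R); lra.
Qed.

(** Four reflected copies of the quarter disc around the centre (T - 1/2, T - 1/2): the entries
    [T + a] and [T - a.+1] are both at distance a + 1/2 from T - 1/2. All points lie within [T] of
    the centre, hence within [2 T] of each other. *)
Lemma disc_codes (T M : nat) : (2 * T <= M)%N -> exists A : {set 'I_M * 'I_M},
  pi * T%:R ^+ 2 - 8 * T%:R <= #|A|%:R :> R /\
  forall x y, x \in A -> y \in A ->
   ((x.1 : int) - (y.1 : int))%:~R ^+ 2 + ((x.2 : int) - (y.2 : int))%:~R ^+ 2 <= (2 * T%:R) ^+ 2 :> R.
Proof.
move=> TM; pose c (s : bool) (a : 'I_T) := if s then (T + a)%N else (T - a.+1)%N.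
have cM s a : (c s a < M)%N.
  apply: leq_trans TM; rewrite mul2n -addnn /c; case: s; first by rewrite ltn_add2l.
  by apply: (@leq_trans T); [rewrite ltn_subrL /=; apply: leq_ltn_trans (ltn_ord a) | apply: leq_addr].
pose h (u : (bool * bool) * ('I_T * 'I_T)) : 'I_M * 'I_M :=
  (Ordinal (cM u.1.1 u.2.1), Ordinal (cM u.1.2 u.2.2)).
have cI s s' (a a' : 'I_T) : c s a = c s' a' -> s = s' /\ a = a'.
  have := ltn_ord a; have := ltn_ord a'; rewrite /c.
  by case: s; case: s' => ? ? e; split; try apply: val_inj => /=; lia.
have hI : injective h.
  move=> [[s1 s2] [a1 a2]] [[s1' s2'] [a1' a2']] [/= /cI[-> ->] /cI[-> ->]] //.
pose Q := finset (fun ab : 'I_T * 'I_T => (ab.1.+1 ^ 2 + ab.2.+1 ^ 2 <= T ^ 2)%N).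
pose U := finset.setX [set: bool * bool]%SET Q.
exists (h @: U)%SET; split.
  rewrite (card_imset _ hI) cardsX cardsT card_prod card_bool !natrM.
  have := quarter_disc_count T; rewrite -/Q; set q : R := #|Q|%:R; set u : R := T%:R; lra.
have bnd s (a : 'I_T) : `|(c s a)%:R - T%:R + 2^-1| <= a.+1%:R :> R.
  have aT : (a.+1 <= T)%N := ltn_ord a.
  have a0 : 0 <= (a%:R : R) by [].
  have a1E : (a.+1%:R : R) = a%:R + 1 by rewrite natr1.
  by rewrite /c; case: s; rewrite ?natrD ?natrB// ?a1E ler_norml;
    set x : R := a%:R in a0 *; set y : R := T%:R; lra.
have key u : u \in U -> ((h u).1%:R - T%:R + 2^-1) ^+ 2 + ((h u).2%:R - T%:R + 2^-1) ^+ 2 <= T%:R ^+ 2 :> R.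
  case: u => -[s1 s2] [a1 a2]; rewrite !inE /= => q.
  have q' : (a1.+1%:R ^+ 2 + a2.+1%:R ^+ 2 <= T%:R ^+ 2 :> R) by rewrite -!natrX -natrD ler_nat.
  apply: le_trans q'; apply: lerD; rewrite -real_normK ?num_real// ler_pXn2r ?nnegrE//; exact: bnd.
move=> _ _ /imsetP[u uQ ->] /imsetP[w wQ ->].
have := key u uQ; have := key w wQ; rewrite !rmorphB /= -!pmulrn.
set a : R := ((h u).1 : nat)%:R; set b : R := ((h u).2 : nat)%:R; set a' : R := ((h w).1 : nat)%:R; set b' : R := ((h w).2 : nat)%:R.
set t : R := T%:R; move=> h1 h2.
have s1 := sqr_ge0 (a - t + 2^-1 + (a' - t + 2^-1)); have s2 := sqr_ge0 (b - t + 2^-1 + (b' - t + 2^-1)).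
nra.
Qed.

(** The second coordinate is frozen at 0, so that real and complex places share one type of
    codes. *)
Lemma interval_codes (T M : nat) : (2 * T <= M)%N -> (0 < M)%N -> exists A : {set 'I_M * 'I_M},
  2 * T%:R <= #|A|%:R :> R /\ (forall x y, x \in A -> y \in A -> x.2 = y.2) /\
  forall x y, x \in A -> y \in A ->
   ((x.1 : int) - (y.1 : int))%:~R ^+ 2 + ((x.2 : int) - (y.2 : int))%:~R ^+ 2 <= (2 * T%:R) ^+ 2 :> R.
Proof.
move=> TM M0; exists ((fun a : 'I_(2 * T) => (widen_ord TM a, Ordinal M0)) @: [set: 'I_(2 * T)])%SET; split.
  rewrite card_imset ?cardsT ?card_ord ?natrM//.
  by move=> a b [] h; apply: val_inj.
split; first by move=> _ _ /imsetP[? _ ->] /imsetP[? _ ->].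
move=> _ _ /imsetP[a _ ->] /imsetP[b _ ->] /=; rewrite subrr expr0n addr0 rmorphB /= -!pmulrn.
have : (a%:R : R) <= (2 * T)%:R by rewrite ler_nat ltnW.
have : (b%:R : R) <= (2 * T)%:R by rewrite ler_nat ltnW.
have : 0 <= (a%:R : R) by []; have : 0 <= (b%:R : R) by [].
rewrite natrM; set x : R := a%:R; set y : R := b%:R; set t : R := T%:R; nra.
Qed.
End DiscCount.

(** * Pigeonhole modulo an integer lattice *)

Section IntegerLattice.
Variable d : nat.
Implicit Types (B : 'M[int]_d) (z : 'cV[int]_d).

Lemma card_dffun_prod (aT : finType) (T : aT -> finType) :
  #|{dffun forall x, T x}| = (\prod_x #|T x|)%N.
Proof. by rewrite card_dep_ffun foldrE big_map big_enum. Qed.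

(* Smith normal form turns Z^d / B Z^d into a product of cyclic groups. *)
Lemma lattice_labels B : \det B != 0 -> exists (F : finType) (phi : 'cV[int]_d -> F),
  #|F| = absz (\det B) /\
  forall z z', phi z = phi z' -> exists X, z - z' = B *m X.
Proof.
move=> detB; have [L Lu [Q Qu [e _ BE]]] := int_Smith_normal_form B.
pose Dg : 'rV[int]_d := \row_i e`_i.
have DE : (\matrix_(i, j) (e`_i *+ (i == j :> nat))) = diag_mx Dg :> 'M[int]_d.
  by apply/matrixP => i j; rewrite !mxE.
rewrite DE in BE.
have absu (M : 'M[int]_d) : M \in unitmx -> absz (\det M) = 1%N.
  rewrite unitmxE => /mulrV/(congr1 absz)/eqP.
  by rewrite abszM muln_eq1 => /andP[/eqP].
have detE : absz (\det B) = (\prod_(i < d) absz (e`_i)%R)%N.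
  rewrite BE !det_mulmx !abszM (absu _ Lu) (absu _ Qu) mul1n muln1 det_diag.
  rewrite (big_morph absz abszM (id1 := 1%N)) //.
  by apply: eq_bigr => i _; rewrite mxE.
have e0 (i : 'I_d) : e`_i != 0.
  apply: contraNneq detB => ei; rewrite -absz_eq0 detE (bigD1 i)//= ei mul0n //.
have lt (i : 'I_d) (x : int) : (absz (x %% (e`_i)%R)%Z < absz (e`_i)%R)%N.
  by rewrite -ltz_nat gez0_abs ?modz_ge0// abszE ltz_mod.
exists {dffun forall i : 'I_d, 'I_(absz e`_i)}.
exists (fun z => [ffun i => Ordinal (lt i ((invmx L *m z) i ord0))]); split.
  by rewrite card_dffun_prod detE; apply: eq_bigr => i _; rewrite card_ord.
move=> z z' zz'.
have md i : ((invmx L *m z) i ord0 %% e`_i)%Z = ((invmx L *m z') i ord0 %% e`_i)%Z.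
  move/ffunP: zz' => /(_ i); rewrite !ffunE => /(congr1 val) /= h.
  by rewrite -[LHS]gez0_abs ?modz_ge0// -[RHS]gez0_abs ?modz_ge0// h.
pose W : 'cV[int]_d := \col_i (((invmx L *m z) i ord0 - (invmx L *m z') i ord0) %/ e`_i)%Z.
have WE : invmx L *m (z - z') = diag_mx Dg *m W.
  apply/colP => i; rewrite mulmxBr mul_diag_mx !mxE mulrC divzK.
    by [].
  by rewrite -eqz_mod_dvd; apply/eqP; have := md i; rewrite !mxE.
exists (invmx Q *m W); rewrite BE -!mulmxA mulKVmx// -WE mulKVmx//.
Qed.

(** Each class gets a fixed representative, and [red z] holds the lattice coordinates of [z] minus
    the representative of its class; this term cancels between points of one class. *)
Lemma lattice_reduction B : \det B != 0 -> exists (F : finType) (phi : 'cV[int]_d -> F)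
  (red : 'cV[int]_d -> 'cV[int]_d), #|F| = absz (\det B) /\
  forall z z', phi z = phi z' -> z - z' = B *m (red z - red z').
Proof.
move=> /lattice_labels[F [phi [cF hphi]]]; exists F, phi.
have repP f : exists z, forall z', phi z' = f -> phi z = f.
  have [[z zf]|h] := pselect (exists z, phi z = f); first by exists z.
  by exists 0 => z' zf; case: h; exists z'.
pose rep f := projT1 (cid (repP f)); have repE z : phi (rep (phi z)) = phi z := projT2 (cid (repP (phi z))) z erefl.
have redP z := hphi z (rep (phi z)) (esym (repE z)).
exists (fun z => projT1 (cid (redP z))); split=> // z z' zz'.
have h := projT2 (cid (redP z)); have h' := projT2 (cid (redP z')).
by rewrite mulmxBr -h -h' zz' opprB addrA subrK.
Qed.

(** The lattice has the block triangular matrix with diagonal blocks [B] and [- B] and lower block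
    [Q]: first [zx] is reduced, then [zy] after comparison with [Q X]. The labels [psi] are put on
    the lattice coordinates [X], [Y] of the points, so the conditions at the finite places need no
    sublattice of their own. *)
Lemma lattice_pigeonhole n m B (Q : 'I_m -> 'I_n -> 'M[int]_d) (F : finType)
    (psi : ('I_n -> 'cV[int]_d) -> ('I_m -> 'cV[int]_d) -> F)
    (E : finType) (zx : E -> 'I_n -> 'cV[int]_d) (zy : E -> 'I_m -> 'cV[int]_d) (Z : {set E}) :
  \det B != 0 ->
  {in Z &, forall e e', zx e =1 zx e' -> zy e =1 zy e' -> e = e'} ->
  (absz (\det B) ^ (n + m) * #|F| < #|Z|)%N ->
  exists e e' X X' Y Y', [/\ e \in Z /\ e' \in Z, psi X Y = psi X' Y',
    ((exists l, X l != X' l) \/ (exists k, Y k != Y' k)),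
    forall l, zx e l - zx e' l = B *m (X l - X' l) &
    forall k, zy e k - zy e' k = \sum_l Q k l *m (X l - X' l) - B *m (Y k - Y' k)].
Proof.
move=> /lattice_reduction[Phi [phi [red [cPhi hred]]]] Zinj cZ.
pose X e l := red (zx e l).
pose u e k := \sum_l Q k l *m X e l - zy e k.
pose Y e k := red (u e k).
pose lab e := ([ffun l => phi (zx e l)], [ffun k => phi (u e k)], psi (X e) (Y e)) :
  {ffun 'I_n -> Phi} * {ffun 'I_m -> Phi} * F.
have [e [e' [eZ e'Z ee' labE]]] : exists e e', [/\ e \in Z, e' \in Z, e != e' & lab e = lab e'].
  apply: contrapT => h; move: cZ; rewrite ltnNge => /negP[].
  have linj : {in Z &, injective lab}.
    move=> e e' eZ e'Z le; apply/eqP; apply: contraT => ne; case: h; by exists e, e'.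
  rewrite -(card_in_imset linj); apply: leq_trans (max_card _) _.
  by rewrite !card_prod !card_ffun !card_ord cPhi expnD.
move: labE => [/ffunP h1 /ffunP h2 h3].
have hX l : zx e l - zx e' l = B *m (X e l - X e' l).
  by apply: hred; have := h1 l; rewrite !ffunE.
have hY k : u e k - u e' k = B *m (Y e k - Y e' k).
  by apply: hred; have := h2 k; rewrite !ffunE.
have hy k : zy e k - zy e' k = \sum_l Q k l *m (X e l - X e' l) - B *m (Y e k - Y e' k).
  rewrite -hY /u; under eq_bigr do rewrite mulmxBr.
  have alg (V : zmodType) (S S' a b : V) : a - b = S - S' - (S - a - (S' - b)).
    by rewrite opprB addrA [S - S' + _]addrA subrK opprB [S - b + _]addrC addrA subrK.
  by rewrite sumrB; apply: alg.
exists e, e', (X e), (X e'), (Y e), (Y e'); split=> //.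
apply: contrapT => /not_orP[nX nY]; move/eqP: ee'; case; apply: Zinj => //.
  move=> l; apply/eqP; rewrite -subr_eq0 hX; apply/eqP.
  have -> : X e l = X e' l by apply/eqP; apply: contraT => ne; case: nX; exists l.
  by rewrite subrr mulmx0.
move=> k; apply/eqP; rewrite -subr_eq0 hy; apply/eqP.
have -> : Y e k = Y e' k by apply/eqP; apply: contraT => ne; case: nY; exists k.
rewrite subrr mulmx0 subr0 big1// => l _.
have -> : X e l = X e' l by apply/eqP; apply: contraT => ne; case: nX; exists l.
by rewrite subrr mulmx0.
Qed.
End IntegerLattice.

(** * Minkowski's theorem with labels, for the closed body at critical volume *)

Section Minkowski.
Variables (R : realType) (d n m : nat) (I : finType) (a : pred I) (e : I -> nat) (t : 'I_d -> I * bool).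
Hypotheses (tinj : injective t) (ta : forall r, a (t r).1).
Hypotheses (t0 : forall i, a i -> exists r, t r = (i, false)).
Hypotheses (t1 : forall i, a i -> e i = 2%N -> exists r, t r = (i, true)).
Hypothesis e12 : forall i, a i -> e i = 2%N \/ e i = 1%N.
Hypothesis dim_e : forall x : R, x ^+ d = \prod_(i | a i) x ^+ e i.
Variables (F : finType) (psi : ('I_n -> 'cV[int]_d) -> ('I_m -> 'cV[int]_d) -> F).
Local Notation L := ('I_n + 'I_m)%type.

Definition fiber_norm (i : I) (u : 'I_d -> R) : R := \sum_(r | (t r).1 == i) u r ^+ 2.

Let fiber_sum_le i (g : bool -> R) : (forall b, 0 <= g b) ->
  \sum_(r | (t r).1 == i) g (t r).2 <= g false + g true.
Proof.
move=> g0; rewrite -[X in _ <= X]addrC -(big_bool _ g).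
rewrite (partition_big (fun r => (t r).2) xpredT) //=; apply: ler_sum => b _.
have [[r /eqP rE]|h] := pselect (exists r, t r == (i, b)).
  rewrite (bigD1 r) /= ?rE ?eqxx// big1 ?addr0// => r' /andP[/andP[/eqP h1 /eqP h2] /eqP[]].
  by apply: tinj; rewrite rE [LHS]surjective_pairing h1 h2.
rewrite big1// => r /andP[/eqP h1 /eqP h2]; case: h; exists r.
by rewrite [t r]surjective_pairing h1 h2.
Qed.

(* A lower bound for the number of lattice points in a ball of radius T. *)
Definition code_count (i : I) (T : nat) : R :=
  if e i == 2%N then pi * T%:R ^+ 2 - 8 * T%:R else 2 * T%:R.

Let codes i T M : a i -> (2 * T <= M)%N -> (0 < M)%N -> exists A : {set 'I_M * 'I_M},
  code_count i T <= #|A|%:R /\ (e i != 2%N -> forall x y, x \in A -> y \in A -> x.2 = y.2) /\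
  forall x y, x \in A -> y \in A ->
   ((x.1 : int) - (y.1 : int))%:~R ^+ 2 + ((x.2 : int) - (y.2 : int))%:~R ^+ 2 <= (2 * T%:R) ^+ 2 :> R.
Proof.
move=> ai TM M0; rewrite /code_count; case: eqP => ei.
  by have [A [h1 h2]] := disc_codes R TM; exists A.
by have [A [h1 [h2 h3]]] := interval_codes R TM M0; exists A.
Qed.

(** One code per form and place is assembled into integer vectors; since [t] reaches both
    coordinates of a complex place, different choices of codes give different vectors, and the
    product of the code counts bounds their number from below. *)
Lemma minkowski_step (B : 'M[int]_d) (Q : 'I_m -> 'I_n -> 'M[int]_d) (T : L -> I -> nat) :
  \det B != 0 -> (forall l i, a i -> 0 <= code_count i (T l i)) ->
  `|(\det B)%:~R| ^+ (n + m) * #|F|%:R < \prod_(l : L) \prod_(i | a i) code_count i (T l i) ->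
  exists X X' Y Y', [/\ psi X Y = psi X' Y',
    ((exists l, X l != X' l) \/ (exists k, Y k != Y' k)),
    forall l i, a i -> fiber_norm i (fun r => ((B *m (X l - X' l)) r 0)%:~R) <= (2 * (T (inl l) i)%:R) ^+ 2 &
    forall k i, a i -> fiber_norm i (fun r =>
      ((\sum_l Q k l *m (X l - X' l) - B *m (Y k - Y' k)) r 0)%:~R) <= (2 * (T (inr k) i)%:R) ^+ 2].
Proof.
move=> detB c0 hc.
pose M := (\sum_(l : L) \sum_i 2 * T l i).+1.
have TM l i : (2 * T l i <= M)%N.
  by rewrite /M (bigD1 l)//= (bigD1 i)//= ltnW// ltnS -addnA leq_addr.
pose E := ('I_M * 'I_M)%type.
(* Indices outside [a] get a single code, so that they contribute a factor 1 to the count. *)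
pose good l i (A : {set E}) : Prop := if a i then
   code_count i (T l i) <= #|A|%:R /\ (e i != 2%N -> forall x y, x \in A -> y \in A -> x.2 = y.2) /\
    forall x y, x \in A -> y \in A ->
    ((x.1 : int) - (y.1 : int))%:~R ^+ 2 + ((x.2 : int) - (y.2 : int))%:~R ^+ 2 <= (2 * (T l i)%:R) ^+ 2 :> R
   else A = [set (ord0, ord0)]%SET.
have AP l i : exists A, good l i A.
  rewrite /good; case ai: (a i); last by exists [set (ord0, ord0)]%SET.
  exact: (codes ai (TM l i) (ltn0Sn _)).
pose A l i := projT1 (cid (AP l i)); have AE l i : good l i (A l i) := projT2 (cid (AP l i)).
pose fam : L * I -> pred E := fun li => mem (A li.1 li.2).
pose Z : {set {ffun L * I -> E}} := finset (family fam).
pose dec (c : E) (b : bool) : int := if b then (c.2 : nat) else (c.1 : nat).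
pose z (c : {ffun L * I -> E}) (l : L) : 'cV[int]_d := \col_r dec (c (l, (t r).1)) (t r).2.
have inZ c l i : c \in Z -> c (l, i) \in A l i.
  by rewrite inE => /familyP/(_ (l, i)).
have Zinj : {in Z &, forall c c', z c \o inl =1 z c' \o inl -> z c \o inr =1 z c' \o inr -> c = c'}.
  move=> c c' cZ c'Z hl hr.
  have zz l : z c l = z c' l by case: l => l; [apply: hl|apply: hr].
  apply/ffunP => -[l i]; have := AE l i; have := inZ c l i cZ; have := inZ c' l i c'Z.
  rewrite /good; case: ifP => [ai|_] cA cA' h; last by move: cA cA'; rewrite h !inE => /eqP-> /eqP->.
  have dE b r : t r = (i, b) -> dec (c (l, i)) b = dec (c' (l, i)) b.
    by move=> rE; have /colP/(_ r) := zz l; rewrite !mxE rE.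
  case: h => _ [h2 _].
  have E1 : (c (l, i)).1 = (c' (l, i)).1.
    by have [r rE] := t0 ai; have := dE false r rE; rewrite /dec => -[] h; apply: val_inj.
  have E2 : (c (l, i)).2 = (c' (l, i)).2.
    have [ei|ei] := eqVneq (e i) 2%N; last by apply: h2.
    by have [r rE] := t1 ai ei; have := dE true r rE; rewrite /dec => -[] h; apply: val_inj.
  by rewrite [LHS]surjective_pairing [RHS]surjective_pairing E1 E2.
have cZ : #|Z| = (\prod_(l : L) \prod_i #|A l i|)%N.
  rewrite cardsE card_family foldrE big_map big_enum /=.
  by rewrite (pair_bigA _ (fun l i => #|A l i|)).
have big : (absz (\det B) ^ (n + m) * #|F| < #|Z|)%N.
  rewrite -(ltr_nat R) natrM natrX natr_absz intr_norm; apply: lt_le_trans hc _.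
  rewrite cZ natr_prod; apply: ler_prod => l _; apply/andP; split.
    by apply: prodr_ge0 => i ai; apply: c0.
  rewrite natr_prod [X in _ <= X](bigID a) /= [X in _ * X]big1 ?mulr1; last first.
    move=> i nai. have ai : a i = false by apply/negbTE. have := AE l i; rewrite /good ai => ->; by rewrite cards1.
  apply: ler_prod => i ai; rewrite c0//=.
  by have := AE l i; rewrite /good ai => -[].
have [c [c' [X [X' [Y [Y' [[cA cA'] pE nt hx hy]]]]]]] :=
  @lattice_pigeonhole d n m B Q F psi _ (fun c => z c \o inl) (fun c => z c \o inr) Z detB Zinj big.
have nrm l i (u : 'I_d -> R) : a i -> (forall r, u r = ((z c l - z c' l) r 0)%:~R) ->
    fiber_norm i u <= (2 * (T l i)%:R) ^+ 2.
  move=> ai uE; pose g (b : bool) : R := (dec (c (l, i)) b - dec (c' (l, i)) b)%:~R ^+ 2.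
  have -> : fiber_norm i u = \sum_(r | (t r).1 == i) g (t r).2.
    by apply: eq_bigr => r /eqP ri; rewrite uE !mxE ri.
  apply: (le_trans (fiber_sum_le i _)); first by move=> b; apply: sqr_ge0.
  have := AE l i; rewrite /good ai => -[_ [_ h]]; apply: h; exact: inZ.
exists X, X', Y, Y'; split=> //.
  by move=> l i ai; apply: nrm => // r; rewrite -hx.
by move=> k i ai; apply: nrm => // r; rewrite -hy.
Qed.

(* The volume of a ball of radius r / 2: two of its points are at distance at most r. *)
Definition half_volume (i : I) (r : R) : R := if e i == 2%N then pi / 4 * r ^+ 2 else r.

(** Enlarging the radius by [1 + y] pays for truncating [T] and for the error [8 T] of the disc
    count, and still leaves the factor [1 + y / 2]. *)
Lemma code_count_asymptotic i r y : a i -> 0 < r -> 0 < y <= 1 -> \forall q \near \oo,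
  half_volume i r * (1 + y / 2) * q%:R ^+ e i <= code_count i (Num.truncn (q%:R * (1 + y) * r / 2)).
Proof.
move=> ai r0 /andP[y0 y1].
(* With u = q r / 2 this choice gives u y > 5: truncation uses 1, and the error [8 T] uses 4 because
   8 T <= 4 pi T. *)
exists (Num.bound (10 / (r * y))) => // q /= hq.
have q0 : 10 / (r * y) < q%:R.
  apply: lt_le_trans (archi_boundP _) _; first by rewrite divr_ge0// mulr_ge0// ltW.
  by rewrite ler_nat.
have ry : 0 < r * y by rewrite mulr_gt0.
rewrite ltr_pdivrMr// in q0.
have qp : 0 <= (q%:R : R) by [].
set s := q%:R * (1 + y) * r / 2.
have s0 : 0 <= s by rewrite /s divr_ge0// mulr_ge0 ?mulr_ge0 ?(ltW r0)//; lra.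
have /andP[T1 T2] := truncn_itv s0; rewrite -natr1 in T2.
rewrite /half_volume /code_count.
set T : R := (Num.truncn s)%:R in T1 T2 *; set Q : R := q%:R in q0 qp *.
have sE : s = Q * r / 2 + Q * (r * y) / 2 by rewrite /s /Q; field.
pose u := Q * r / 2.
have u0 : 0 <= u by rewrite /u divr_ge0// mulr_ge0// ltW.
have vE : Q * (r * y) / 2 = u * y by rewrite /u; field.
have uy : 5 < u * y by rewrite -vE; lra.
rewrite sE vE -/u in T1 T2.
case: (e12 ai) => -> /=; last first.
  rewrite expr1; have -> : r * (1 + y / 2) * Q = 2 * u + u * y by rewrite /u; field.
  lra.
have -> : pi / 4 * r ^+ 2 * (1 + y / 2) * Q ^+ 2 = pi * (u * (u + u * y / 2)) by rewrite /u; field.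
have p2 : 2 <= pi :> R by apply: pi_ge2.
have -> : pi * T ^+ 2 - 8 * T = pi * (T * T) - 8 * T by ring.
have h : u * (u + u * y / 2) <= (T - 4) * T by apply: ler_pM; lra.
have : pi * (u * (u + u * y / 2)) <= pi * ((T - 4) * T) by rewrite ler_pM2l//; lra.
have T0 : 0 <= T by lra.
nra.
Qed.

Definition floor_mx p q (k : nat) (M : 'M[R]_(p, q)) : 'M[int]_(p, q) :=
  \matrix_(i, j) Num.floor (k%:R * M i j).

Definition norm1 (z : 'cV[int]_d) : R := \sum_j `|(z j 0)%:~R : R|.

Definition real_mul (M : 'M[R]_d) (z : 'cV[int]_d) : 'cV[R]_d := M *m map_mx intr z.

Lemma norm1_ge0 z : 0 <= norm1 z. Proof. exact: sumr_ge0. Qed.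

Lemma floor_mx_approx k (M : 'M[R]_d) z r : (0 < k)%N ->
  `|((floor_mx k M *m z) r 0)%:~R / k%:R - real_mul M z r 0| <= norm1 z / k%:R.
Proof.
move=> k0; have kR : 0 < (k%:R : R) by rewrite ltr0n.
rewrite ler_pdivlMr// -[X in _ * X](ger0_norm (ltW kR)) -normrM mulrBl divfK ?gt_eqF//.
rewrite !mxE rmorph_sum mulr_suml -sumrB; apply: le_trans (ler_norm_sum _ _ _) _.
apply: ler_sum => j _; rewrite !mxE rmorphM /=.
have -> : (Num.floor (k%:R * M r j))%:~R * (z j 0)%:~R - M r j * (z j 0)%:~R * k%:R =
   ((Num.floor (k%:R * M r j))%:~R - k%:R * M r j) * (z j 0)%:~R :> R by ring.
rewrite normrM ler_piMl// ler_norml.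
by have /andP[h1 h2] := floor_itv (k%:R * M r j); rewrite intrD in h2; lra.
Qed.

Lemma real_mul_le (M : 'M[R]_d) : exists2 g, 0 <= g & forall z r, `|real_mul M z r 0| <= g * norm1 z.
Proof.
exists (\sum_i \sum_j `|M i j|); first by apply: sumr_ge0 => i _; apply: sumr_ge0.
move=> z r; rewrite mxE /norm1 mulr_sumr; apply: le_trans (ler_norm_sum _ _ _) _.
apply: ler_sum => j _; rewrite mxE normrM; apply: ler_wpM2r => //.
apply: (@ler_term_sum R _ r) => [i|]; first by apply: sumr_ge0.
exact: (@ler_term_sum R _ j).
Qed.

Lemma norm1_le_real_mul (M : 'M[R]_d) : M \in unitmx -> exists2 g, 0 <= g &
  forall z rho, 0 <= rho -> (forall r, `|real_mul M z r 0| <= rho) -> norm1 z <= g * rho.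
Proof.
move=> Mu; exists (\sum_i \sum_j `|invmx M i j|); first by apply: sumr_ge0 => i _; apply: sumr_ge0.
move=> z rho rho0 h; rewrite mulr_suml; apply: ler_sum => j _.
have : map_mx intr z = invmx M *m real_mul M z by rewrite /real_mul mulKmx.
move=> /colP/(_ j); rewrite !mxE => ->; rewrite mulr_suml.
apply: le_trans (ler_norm_sum _ _ _) _; apply: ler_sum => k _.
by rewrite normrM; apply: ler_wpM2l => //; have := h k; rewrite !mxE.
Qed.

Lemma det_floor_mx (M : 'M[R]_d) :
  (fun k : nat => (\det (floor_mx k M))%:~R / k%:R ^+ d) @ \oo --> \det M.
Proof.
have E (k : nat) : (0 < k)%N -> (\det (floor_mx k M))%:~R / k%:R ^+ d =
    \det (\matrix_(i, j) ((floor_mx k M i j)%:~R / k%:R)) :> R.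
  move=> k0; have -> : (\matrix_(i, j) ((floor_mx k M i j)%:~R / k%:R)) =
      k%:R^-1 *: map_mx intr (floor_mx k M) :> 'M[R]_d.
    by apply/matrixP => i j; rewrite !mxE mulrC.
  by rewrite detZ det_map_mx exprVn mulrC.
have ent i j : (fun k : nat => (floor_mx k M i j)%:~R / k%:R) @ \oo --> M i j.
  apply/cvgrPdist_le => y y0.
  exists (Num.bound y^-1).+1 => // k /= hk; rewrite mxE.
  have kR : 0 < (k%:R : R) by rewrite ltr0n (leq_trans _ hk).
  have ky : y^-1 < k%:R.
    apply: lt_le_trans (archi_boundP _) _; first by rewrite invr_ge0 ltW.
    by rewrite ler_nat ltnW.
  have /andP[h1 h2] := floor_itv (k%:R * M i j); rewrite intrD in h2.
  have yk : 1 < y * k%:R by rewrite mulrC -ltr_pdivrMr// div1r.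
  rewrite -(ler_pM2r kR) -[X in _ * X <= _](ger0_norm (ltW kR)) -normrM mulrBl divfK ?gt_eqF//.
  by rewrite ler_norml [M i j * _]mulrC; lra.
have : (fun k : nat => \det (\matrix_(i, j) ((floor_mx k M i j)%:~R / k%:R) : 'M[R]_d)) @ \oo --> \det M.
  rewrite /determinant.
  apply: (cvg_big (op := +%R)) => [|s _]; first exact: add_continuous.
  apply: cvgM; first exact: cvg_cst.
  apply: (@cvg_big R _ _ _ _ (@mul_continuous R)) => j _.
  by under eq_fun do rewrite mxE; exact: ent.
apply: cvg_trans; apply: near_eq_cvg; exists 1%N => // k /= hk.
by rewrite E.
Qed.

(** The term 3 Rho^2 comes from (1 + y)^2 <= 1 + 3 y, the rest from a shift of at most [W * y] in
    each of the [d] coordinates. *)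
Let fiber_perturb i (u w : 'I_d -> R) (y rho Rho W : R) : 0 < y <= 1 -> 0 <= rho <= Rho -> 0 <= W ->
  (forall r, `|w r - u r| <= W * y) -> (forall r, `|u r| <= Rho) ->
  fiber_norm i u <= ((1 + y) * rho) ^+ 2 ->
  fiber_norm i w <= rho ^+ 2 + y * (3 * Rho ^+ 2 + d%:R * (2 * Rho * W + W ^+ 2)).
Proof.
move=> /andP[y0 y1] /andP[r0 rR] W0 hw hu h.
have R0 : 0 <= Rho by apply: le_trans rR.
have D0 : 0 <= y * (2 * Rho * W + W ^+ 2) by rewrite mulr_ge0 ?(ltW y0)// addr_ge0 ?sqr_ge0// !mulr_ge0.
have : fiber_norm i w <= fiber_norm i u + \sum_(r < d) y * (2 * Rho * W + W ^+ 2).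
  rewrite /fiber_norm [X in _ <= _ + X](bigID (fun r => (t r).1 == i)) /= addrA -big_split /=.
  apply: ler_wpDr; first exact: sumr_ge0.
  apply: ler_sum => r _; have /ler_normlP[h1 h2] := hw r; have /ler_normlP[h3 h4] := hu r.
  set p := w r - u r in h1 h2; have -> : w r = u r + p by rewrite /p; ring.
  have pp : p ^+ 2 <= (W * y) ^+ 2.
    by rewrite -real_normK ?num_real// ler_pXn2r ?nnegrE ?mulr_ge0 ?(ltW y0)//; apply: hw.
  have up : u r * p <= Rho * (W * y).
    apply: le_trans (ler_norm _) _; rewrite normrM; apply: ler_pM => //; exact: hw.
  have yy : W ^+ 2 * y ^+ 2 <= W ^+ 2 * y by rewrite ler_wpM2l ?sqr_ge0// expr2 ler_piMr// ltW.
  rewrite exprMn in pp; rewrite sqrrD mulr2n; lra.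
rewrite sumr_const card_ord -[_ *+ d]mulr_natl => h5.
apply: (le_trans h5); apply: le_trans (lerD h (lexx _)) _.
have r2 : rho ^+ 2 <= Rho ^+ 2 by rewrite ler_pXn2r ?nnegrE.
have : y * (y * rho ^+ 2) <= y * rho ^+ 2 by rewrite ler_wpM2l ?(ltW y0)// ler_piMl ?sqr_ge0.
have : y * rho ^+ 2 <= y * Rho ^+ 2 by rewrite ler_wpM2l ?(ltW y0).
rewrite exprMn; lra.
Qed.

(** If every candidate failed at some positive [y], the least of these finitely many values would
    defeat all candidates at once. *)
Let finite_uniform (C : finType) (P : C -> R -> Prop) :
  (forall c y y', 0 < y -> y <= y' -> P c y -> P c y') ->
  (forall y, 0 < y <= 1 -> exists c, P c y) -> exists c, forall y, 0 < y -> P c y.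
Proof.
move=> mono ex; apply: contrapT => h.
have bad c : exists2 y, 0 < y & ~ P c y.
  apply: contrapT => h'; apply: h; exists c => y y0; apply: contrapT => nP.
  by apply: h'; exists y.
pose g c := s2val (cid2 (bad c)).
have g0 c : 0 < g c := s2valP (cid2 (bad c)); have gP c : ~ P c (g c) := s2valP' (cid2 (bad c)).
pose y := \big[Num.min/1]_c g c.
have y0 : 0 < y by rewrite /y; elim/big_ind : _ => // a' b' ha hb; rewrite lt_min ha.
have yg c : y <= g c by rewrite /y (bigD1 c)//= ge_min lexx.
have y1 : y <= 1.
  rewrite /y; elim/big_rec : _ => // c z _ hz; rewrite ge_min hz orbT//.
have [c hc] := ex y ltac:(by rewrite y0).
by apply: (gP c); apply: mono (yg c) hc.
Qed.

Section ConvexBody.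
Variables (B : 'M[R]_d) (Q : 'I_m -> 'I_n -> 'M[R]_d) (rad : L -> I -> R).
Hypotheses (Bu : B \in unitmx) (rad0 : forall l i, 0 < rad l i).
Hypotheses (nm0 : (0 < n + m)%N) (exa : exists i, a i).
Hypothesis hvol : `|\det B| ^+ (n + m) * #|F|%:R <= \prod_(l : L) \prod_(i | a i) half_volume i (rad l i).

Let half_volume_ge0 i r : 0 <= r -> 0 <= half_volume i r.
Proof.
move=> r0; rewrite /half_volume; case: ifP => // _.
by rewrite mulr_ge0 ?sqr_ge0// divr_ge0// pi_ge0.
Qed.

(** [hvol] allows equality while pigeonhole needs a strict inequality. For large [q] the normalised
    determinant of the integer approximation exceeds its limit by less than the factor [1 + y / 2],
    and the enlarged radii gain this factor at least once. *)
Lemma minkowski_scaled y (q0 : nat) : 0 < y <= 1 -> exists2 q, (q0 <= q)%N &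
  exists X X' Y Y', [/\ psi X Y = psi X' Y',
    ((exists l, X l != X' l) \/ (exists k, Y k != Y' k)),
    forall l i, a i -> fiber_norm i (fun r => ((floor_mx q B *m (X l - X' l)) r 0)%:~R)
      <= (q%:R * (1 + y) * rad (inl l) i) ^+ 2 &
    forall k i, a i -> fiber_norm i (fun r =>
      ((\sum_l floor_mx q (Q k l) *m (X l - X' l) - floor_mx q B *m (Y k - Y' k)) r 0)%:~R)
      <= (q%:R * (1 + y) * rad (inr k) i) ^+ 2].
Proof.
move=> y01; have /andP[y0 y1] := y01.
have D0 : 0 < `|\det B| by rewrite normr_gt0 -unitfE -unitmxE.
have F0 : 0 < (#|F|%:R : R).
  by rewrite ltr0n; apply/card_gt0P; exists (psi (fun=> 0) (fun=> 0)).
have DN : 0 < `|\det B| ^+ (n + m) by rewrite exprn_gt0.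
have lim : (fun k : nat => `|(\det (floor_mx k B))%:~R / k%:R ^+ d| ^+ (n + m)) @ \oo -->
    `|\det B| ^+ (n + m).
  apply: (@continuous_cvg nat R R \oo _ (fun k : nat => `|(\det (floor_mx k B))%:~R / k%:R ^+ d| : R)
    (fun x : R => x ^+ (n + m)) `|\det B|); first exact: exprn_continuous.
  by apply: cvg_norm; apply: det_floor_mx.
have near1 : \forall k \near \oo, `|(\det (floor_mx k B))%:~R / k%:R ^+ d| ^+ (n + m) <
    (1 + y / 2) * `|\det B| ^+ (n + m).
  by apply: (cvgr_lt _ lim); rewrite ltr_pMl// ltrDl divr_gt0.
have near2 : \forall k \near \oo, 0 < `|(\det (floor_mx k B))%:~R / k%:R ^+ d : R| ^+ (n + m).
  by apply: (cvgr_gt _ lim).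
have near3 : \forall k \near \oo, forall li : L * I, a li.2 ->
    half_volume li.2 (rad li.1 li.2) * (1 + y / 2) * k%:R ^+ e li.2 <=
    code_count li.2 (Num.truncn (k%:R * (1 + y) * rad li.1 li.2 / 2)).
  apply: filter_forall => -[l i]; have [ai|nai] := boolP (a i).
    by have := code_count_asymptotic ai (rad0 l i) y01; apply: filterS => k h _.
  by apply: nearW.
have [N1 _ h1] := near1; have [N2 _ h2] := near2; have [N3 _ h3] := near3.
pose q := (maxn (maxn N1 N2) (maxn N3 (maxn q0 1)))%N.
have {h1} h1 := h1 q ltac:(by rewrite /= /q !leq_max leqnn).
have {h2} h2 := h2 q ltac:(by rewrite /= /q !leq_max leqnn orbT).
have {h3} h3 := h3 q ltac:(by rewrite /= /q !leq_max leqnn !orbT).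
have q00 : (q0 <= q)%N by rewrite /q !leq_max leqnn !orbT.
have qp : (0 < q)%N by rewrite /q !leq_max leqnn !orbT.
have qR : 0 < (q%:R : R) by rewrite ltr0n.
exists q => //.
pose T (l : L) i := Num.truncn (q%:R * (1 + y) * rad l i / 2).
have TE l i : (2 * (T l i)%:R) ^+ 2 <= (q%:R * (1 + y) * rad l i) ^+ 2 :> R.
  have s0 : 0 <= q%:R * (1 + y) * rad l i / 2.
    by rewrite divr_ge0// !mulr_ge0 ?(ltW (rad0 _ _)) ?(ltW qR)//; lra.
  have /andP[t1' _] := truncn_itv s0.
  have h : 2 * (T l i)%:R <= q%:R * (1 + y) * rad l i by rewrite mulrC -ler_pdivlMr.
  rewrite ler_pXn2r// nnegrE; first exact: mulr_ge0.
  by apply: le_trans h; apply: mulr_ge0.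
have detq : \det (floor_mx q B) != 0.
  by apply: contraTneq h2 => ->; rewrite mul0r normr0 expr0n eqn0Ngt nm0 ltxx.
have c0 (l : L) i : a i -> 0 <= code_count i (T l i).
  move=> ai; apply: le_trans (h3 (l, i) ai); rewrite !mulr_ge0 ?exprn_ge0 ?(ltW qR)//.
    exact/half_volume_ge0/ltW.
  lra.
have big : `|(\det (floor_mx q B))%:~R| ^+ (n + m) * #|F|%:R <
    \prod_(l : L) \prod_(i | a i) code_count i (T l i).
  have qd : 0 < (q%:R : R) ^+ d by rewrite exprn_gt0.
  apply: (@lt_le_trans _ _ ((1 + y / 2) * `|\det B| ^+ (n + m) * #|F|%:R * (q%:R ^+ d) ^+ (n + m))).
    rewrite [X in _ < X]mulrAC ltr_pM2r//; move: h1; rewrite normrM normfV [`|_ ^+ d|]ger0_norm ?(ltW qd)//.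
    by rewrite expr_div_n ltr_pdivrMr ?exprn_gt0.
  apply: (@le_trans _ _ (\prod_(l : L) \prod_(i | a i) (half_volume i (rad l i) * (1 + y / 2) * q%:R ^+ e i))); last first.
    apply: ler_prod => l _; apply/andP; split.
      apply: prodr_ge0 => i ai; rewrite !mulr_ge0 ?exprn_ge0 ?(ltW qR)//; last lra.
      exact/half_volume_ge0/ltW.
    apply: ler_prod => i ai; apply/andP; split; last exact: (h3 (l, i) ai).
    rewrite !mulr_ge0 ?exprn_ge0 ?(ltW qR)//; last lra.
    exact/half_volume_ge0/ltW.
  have [i0 ai0] := exa.
  have y21 : 1 <= 1 + y / 2 by lra.
  have c1 : 1 + y / 2 <= \prod_(l : L) \prod_(i | a i) (1 + y / 2).
    have cst : \prod_(i | a i) (1 + y / 2) = (1 + y / 2) ^+ #|a| by rewrite prodr_const.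
    rewrite cst prodr_const -exprM -[X in X <= _]expr1 ler_eXn2l; last lra.
    rewrite muln_gt0; apply/andP; split; first by apply/card_gt0P; exists i0.
    by rewrite cardT -cardE card_sum !card_ord.
  under eq_bigr do rewrite !big_split /= -dim_e.
  rewrite !big_split /= [X in _ <= _ * X]prodr_const card_sum !card_ord.
  rewrite ler_pM2r ?exprn_gt0// -mulrA mulrC.
  apply: ler_pM => //; last lra.
  by rewrite mulr_ge0// ltW.
have [X [X' [Y [Y' [pE nt hx hy]]]]] := minkowski_step (fun k l => floor_mx q (Q k l)) detq c0 big.
exists X, X', Y, Y'; split=> //.
  by move=> l i ai; apply: le_trans (hx l i ai) (TE _ _).
by move=> k i ai; apply: le_trans (hy k i ai) (TE _ _).
Qed.

(* minkowski_scaled gives a solution with relative error y for every y > 0, always inside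
   one fixed finite set, so that some solution works for all y. *)
Lemma minkowski : exists X X' Y Y', [/\ psi X Y = psi X' Y',
    ((exists l, X l != X' l) \/ (exists k, Y k != Y' k)),
    forall l i, a i -> fiber_norm i (fun r => real_mul B (X l - X' l) r 0) <= rad (inl l) i ^+ 2 &
    forall k i, a i -> fiber_norm i (fun r =>
      \sum_l real_mul (Q k l) (X l - X' l) r 0 - real_mul B (Y k - Y' k) r 0) <= rad (inr k) i ^+ 2].
Proof.
have [be be0 hbe] := norm1_le_real_mul Bu.
(* Bounds all rescaled coordinates, since the enlarged radii are at most twice the original ones. *)
pose Rho := 2 * \sum_l \sum_i rad l i.
have radR l i : 2 * rad l i <= Rho.
  rewrite /Rho ler_pM2l//; apply: (@ler_term_sum R _ l) => [l'|].
    by apply: sumr_ge0 => i' _; apply: ltW.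
  by apply: (@ler_term_sum R _ i) => // i'; apply: ltW.
have Rho0 : 0 <= Rho by rewrite mulr_ge0//; apply: sumr_ge0 => l _; apply: sumr_ge0 => i _; apply: ltW.
pose ga k l := s2val (cid2 (real_mul_le (Q k l))).
have ga0 k l : 0 <= ga k l := s2valP (cid2 (real_mul_le (Q k l))).
have hga k l z r : `|real_mul (Q k l) z r 0| <= ga k l * norm1 z := s2valP' (cid2 (real_mul_le (Q k l))) z r.
pose G := \sum_k \sum_l ga k l.
have G0 : 0 <= G by apply: sumr_ge0 => k _; apply: sumr_ge0.
(* An estimate norm1 z <= be (Rho + norm1 z / q) with q >= 2 be yields norm1 z <= 2 be Rho. [Rho2]
   adds the size of the part with [Q], and [M2] follows in the same way. *)
pose M1 := 2 * be * Rho; pose Rho2 := G * M1 + n%:R * M1 + Rho; pose M2 := 2 * be * Rho2.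
have M10 : 0 <= M1 by do 2 apply: mulr_ge0 => //.
have Rho20 : 0 <= Rho2 by rewrite /Rho2 !addr_ge0// mulr_ge0.
have M20 : 0 <= M2 by do 2 apply: mulr_ge0 => //.
(* Bounds q times the error made when the floor matrices replace the real ones, in every
   coordinate. *)
pose W := M1 + n%:R * M1 + M2.
have W0 : 0 <= W by rewrite /W !addr_ge0// mulr_ge0.
pose V := 3 * Rho ^+ 2 + d%:R * (2 * Rho * W + W ^+ 2).
have approx y : 0 < y <= 1 -> exists X X' Y Y', [/\ psi X Y = psi X' Y',
    ((exists l, X l != X' l) \/ (exists k, Y k != Y' k)),
    (forall l, norm1 (X l - X' l) <= M1) /\ (forall k, norm1 (Y k - Y' k) <= M2),
    forall l i, a i -> fiber_norm i (fun r => real_mul B (X l - X' l) r 0) <= rad (inl l) i ^+ 2 + y * V &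
    forall k i, a i -> fiber_norm i (fun r =>
      \sum_l real_mul (Q k l) (X l - X' l) r 0 - real_mul B (Y k - Y' k) r 0) <= rad (inr k) i ^+ 2 + y * V].
  move=> y01; have /andP[y0 y1] := y01.
  pose q0 := (maxn 1 (maxn (Num.bound (2 * be)) (Num.bound y^-1))).
  have [q qq [X [X' [Y [Y' [pE nt hx hy]]]]]] := minkowski_scaled q0 y01.
  have q_gt0 : (0 < q)%N by apply: leq_trans qq; rewrite /q0 leq_max.
  have qR : 0 < (q%:R : R) by rewrite ltr0n.
  have qbe : 2 * be <= q%:R.
    apply/ltW; apply: lt_le_trans (archi_boundP _) _; first by rewrite mulr_ge0.
    by rewrite ler_nat; apply: leq_trans qq; rewrite /q0 !leq_max leqnn orbT.
  have qy : q%:R^-1 <= y.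
    rewrite -[y]invrK lef_pV2 ?posrE ?invr_gt0//; apply/ltW; apply: lt_le_trans (archi_boundP _) _; first by rewrite invr_ge0 ltW.
    by rewrite ler_nat; apply: leq_trans qq; rewrite /q0 !leq_max leqnn !orbT.
  have coord (l : L) (u : 'I_d -> R) :
      (forall i, a i -> fiber_norm i u <= (q%:R * (1 + y) * rad l i) ^+ 2) ->
      (forall r, `|u r / q%:R| <= Rho) /\
      forall i, a i -> fiber_norm i (fun r => u r / q%:R) <= ((1 + y) * rad l i) ^+ 2.
    move=> h; split=> [r|i ai]; last first.
      have -> : fiber_norm i (fun r => u r / q%:R) = fiber_norm i u / q%:R ^+ 2.
        by rewrite /fiber_norm mulr_suml; apply: eq_bigr => r _; rewrite expr_div_n.
      rewrite ler_pdivrMr ?exprn_gt0// -exprMn; apply: le_trans (h i ai) _.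
      by have -> : (1 + y) * rad l i * q%:R = q%:R * (1 + y) * rad l i by ring.
    have := h _ (ta r); rewrite /fiber_norm (bigD1 r)//= => h1.
    have : u r ^+ 2 <= (q%:R * (1 + y) * rad l (t r).1) ^+ 2.
      by apply: le_trans h1; rewrite lerDl; apply: sumr_ge0 => ? _; apply: sqr_ge0.
    have rd := rad0 l (t r).1.
    have y2 : 0 <= 1 + y by lra.
    rewrite -[u r ^+ 2]real_normK ?num_real// ler_pXn2r ?nnegrE ?mulr_ge0 ?(ltW qR) ?(ltW rd)// => h2.
    rewrite normrM normfV [`|q%:R|]ger0_norm ?(ltW qR)// ler_pdivrMr//.
    apply: (le_trans h2); rewrite -mulrA [X in _ <= X]mulrC ler_pM2l//.
    apply: le_trans (radR l (t r).1); rewrite ler_pM2r//; lra.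
  have cx l := coord (inl l) _ (fun i ai => hx l i ai).
  have cy k := coord (inr k) _ (fun i ai => hy k i ai).
  have bx l : norm1 (X l - X' l) <= M1.
    set z := X l - X' l.
    have n0 := norm1_ge0 z.
    have nq : 0 <= norm1 z / q%:R by rewrite divr_ge0// ltW.
    have := hbe z (Rho + norm1 z / q%:R) ltac:(by rewrite addr_ge0).
    move=> /(_ _) h; have {h} := h _.
    have hr r : `|real_mul B z r 0| <= Rho + norm1 z / q%:R.
      have := floor_mx_approx B z r q_gt0; have := proj1 (cx l) r; rewrite -/z.
      rewrite !ler_norml => /andP[? ?] /andP[? ?]; lra.
    move=> /(_ hr); rewrite mulrDr => h.
    have : be * (norm1 z / q%:R) <= norm1 z / 2.
      by rewrite mulrCA ler_wpM2l// ler_pdivrMr//; lra.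
    rewrite /M1; lra.
  have by' k : norm1 (Y k - Y' k) <= M2.
    set z := Y k - Y' k.
    have n0 := norm1_ge0 z.
    have nq : 0 <= norm1 z / q%:R by rewrite divr_ge0// ltW.
    have := hbe z (Rho2 + norm1 z / q%:R) ltac:(by rewrite addr_ge0).
    move=> h; have hr r : `|real_mul B z r 0| <= Rho2 + norm1 z / q%:R.
      have h1 := floor_mx_approx B z r q_gt0.
      have h2 := proj1 (cy k) r.
      set S := \sum_l floor_mx q (Q k l) *m (X l - X' l) in h2.
      have h3 : `|(S r 0)%:~R / q%:R| <= G * M1 + n%:R * M1 :> R.
        rewrite /S summxE rmorph_sum mulr_suml; apply: le_trans (ler_norm_sum _ _ _) _.
        apply: (@le_trans _ _ (\sum_l (ga k l * M1 + M1))).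
          apply: ler_sum => l _; have := floor_mx_approx (Q k l) (X l - X' l) r q_gt0.
          have := hga k l (X l - X' l) r; have b1 := bx l.
          have : ga k l * norm1 (X l - X' l) <= ga k l * M1 by rewrite ler_wpM2l.
          have : norm1 (X l - X' l) / q%:R <= M1.
            rewrite ler_pdivrMr//; apply: (le_trans b1); rewrite ler_peMr// ler1n//.
          rewrite !ler_norml => c1 c2 /andP[? ?] /andP[? ?]; apply/andP; split; lra.
        rewrite big_split /= -mulr_suml sumr_const card_ord mulr_natl lerD2r ler_wpM2r//.
        by apply: (@ler_term_sum R _ k) => // k'; apply: sumr_ge0.
      rewrite !mxE rmorphB /= mulrBl in h2.
      have E : (floor_mx q B *m z) r 0 = \sum_j floor_mx q B r j * z j 0 by rewrite mxE.
      rewrite E in h1; rewrite -/z in h2.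
      set p := (S r 0)%:~R / q%:R in h2 h3; set p' := (\sum_j _)%:~R / q%:R in h1 h2.
      move: h1 h2 h3; rewrite !ler_norml /Rho2 => /andP[? ?] /andP[? ?] /andP[? ?].
      apply/andP; split; lra.
    move: h => /(_ hr); rewrite mulrDr => h.
    have : be * (norm1 z / q%:R) <= norm1 z / 2.
      by rewrite mulrCA ler_wpM2l// ler_pdivrMr//; lra.
    rewrite /M2; lra.
  have errq (x N : R) : x <= N / q%:R -> 0 <= N -> x <= N * y.
    by move=> h N0; apply: (le_trans h); rewrite ler_wpM2l.
  exists X, X', Y, Y'; split=> //.
    move=> l i ai; have [c1 c2] := cx l.
    apply: (fiber_perturb (u := fun r => ((floor_mx q B *m (X l - X' l)) r 0)%:~R / q%:R) y01 _ W0 _ c1 (c2 i ai)).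
      by rewrite ltW//=; have := radR (inl l) i; have := rad0 (inl l) i; lra.
    move=> r; apply: errq => //; rewrite distrC.
    apply: le_trans (floor_mx_approx _ _ _ q_gt0) _; rewrite ler_pM2r ?invr_gt0//.
    by apply: (le_trans (bx l)); rewrite /W -addrA lerDl addr_ge0// mulr_ge0.
  move=> k i ai; have [c1 c2] := cy k.
  apply: (fiber_perturb (u := fun r => ((\sum_l floor_mx q (Q k l) *m (X l - X' l) - floor_mx q B *m (Y k - Y' k)) r 0)%:~R / q%:R) y01 _ W0 _ c1 (c2 i ai)).
    by rewrite ltW//=; have := radR (inr k) i; have := rad0 (inr k) i; lra.
  move=> r; apply: errq => //.
  have -> : ((\sum_l floor_mx q (Q k l) *m (X l - X' l) - floor_mx q B *m (Y k - Y' k)) r 0)%:~R =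
     \sum_l ((floor_mx q (Q k l) *m (X l - X' l)) r 0)%:~R - ((floor_mx q B *m (Y k - Y' k)) r 0)%:~R :> R.
    by rewrite [X in X%:~R]mxE [X in (_ + X)%:~R]mxE rmorphB summxE rmorph_sum.
  have -> (A1 A2 : 'I_n -> R) (b1 b2 : R) : \sum_l A1 l - b1 - (\sum_l A2 l - b2) / q%:R =
     \sum_l (A1 l - A2 l / q%:R) - (b1 - b2 / q%:R).
    by rewrite sumrB -mulr_suml; ring.
  apply: le_trans (ler_normB _ _) _.
  have e1 := floor_mx_approx B (Y k - Y' k) r q_gt0; rewrite distrC in e1.
  have e2 : norm1 (Y k - Y' k) / q%:R <= M2 / q%:R by rewrite ler_pM2r ?invr_gt0.
  have e3 : `|\sum_l (real_mul (Q k l) (X l - X' l) r 0 - ((floor_mx q (Q k l) *m (X l - X' l)) r 0)%:~R / q%:R)|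
     <= n%:R * M1 / q%:R.
    apply: le_trans (ler_norm_sum _ _ _) _.
    apply: (@le_trans _ _ (\sum_(l < n) M1 / q%:R)); last first.
      by rewrite sumr_const card_ord -[_ *+ n]mulr_natl mulrA.
    apply: ler_sum => l _; rewrite distrC; apply: le_trans (floor_mx_approx _ _ _ q_gt0) _.
    by rewrite ler_pM2r ?invr_gt0.
  have e4 : 0 <= M1 / q%:R by rewrite divr_ge0// ltW.
  rewrite /W !mulrDl; lra.
(* Integer vectors of [norm1] at most [M1 + M2] have entries between -b and b; this makes the set of
   candidate differences finite. *)
pose b := (Num.bound (M1 + M2)).
pose dec (c : 'I_(2 * b).+1) : int := (c : int) - b%:Z.
have decP (z : int) : `|z%:~R : R| <= M1 + M2 -> exists c, dec c = z.
  move=> hz; have zb : (absz z <= b)%N.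
    rewrite -(ler_nat R) natr_absz intr_norm; apply: (le_trans hz).
    by apply/ltW/archi_boundP; rewrite addr_ge0.
  have lt : (absz (z + b%:Z)%R < (2 * b).+1)%N by clear -zb; lia.
  by exists (Ordinal lt); rewrite /dec /=; clear -zb; lia.
pose C := ({ffun 'I_n * 'I_d -> 'I_(2 * b).+1} * {ffun 'I_m * 'I_d -> 'I_(2 * b).+1})%type.
pose dx (c : C) l : 'cV[int]_d := \col_j dec (c.1 (l, j)).
pose dy (c : C) k : 'cV[int]_d := \col_j dec (c.2 (k, j)).
(* Only the differences are frozen in [c]. The labels depend on [X] and [X'] separately, so these
   remain quantified for each [y]. *)
pose P (c : C) (y : R) := exists X X' Y Y', [/\ psi X Y = psi X' Y',
    ((exists l, X l != X' l) \/ (exists k, Y k != Y' k)),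
    (forall l, X l - X' l = dx c l) /\ (forall k, Y k - Y' k = dy c k),
    forall l i, a i -> fiber_norm i (fun r => real_mul B (dx c l) r 0) <= rad (inl l) i ^+ 2 + y * V &
    forall k i, a i -> fiber_norm i (fun r =>
      \sum_l real_mul (Q k l) (dx c l) r 0 - real_mul B (dy c k) r 0) <= rad (inr k) i ^+ 2 + y * V].
have V0 : 0 <= V.
  apply: addr_ge0; first by apply: mulr_ge0 => //; apply: sqr_ge0.
  by apply: mulr_ge0 => //; apply: addr_ge0; [do 2 apply: mulr_ge0 => // | apply: sqr_ge0].
have [c cP] : exists c, forall y, 0 < y -> P c y.
  apply: finite_uniform.
    move=> c y y' _ yy [X [X' [Y [Y' [h1 h2 h3 h4 h5]]]]]; exists X, X', Y, Y'.
    have yV : y * V <= y' * V by rewrite ler_wpM2r.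
    split=> //.
      by move=> l i ai; apply: le_trans (h4 l i ai) _; rewrite lerD2l.
    by move=> k i ai; apply: le_trans (h5 k i ai) _; rewrite lerD2l.
  move=> y /approx[X [X' [Y [Y' [h1 h2 [h3 h3'] h4 h5]]]]].
  have entry z j : norm1 z <= M1 + M2 -> exists c, dec c = z j 0.
    by move=> hz; apply: decP; apply: le_trans hz; apply: (@ler_term_sum R _ j).
  have cxP (lj : 'I_n * 'I_d) : exists c, dec c = (X lj.1 - X' lj.1) lj.2 0.
    by apply: entry; apply: (le_trans (h3 _)); rewrite lerDl.
  have cyP (kj : 'I_m * 'I_d) : exists c, dec c = (Y kj.1 - Y' kj.1) kj.2 0.
    by apply: entry; apply: (le_trans (h3' _)); rewrite lerDr.
  pose c : C := ([ffun lj => projT1 (cid (cxP lj))], [ffun kj => projT1 (cid (cyP kj))]).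
  have ex l : X l - X' l = dx c l.
    by apply/colP => j; rewrite [RHS]mxE ffunE (projT2 (cid (cxP (l, j)))).
  have ey k : Y k - Y' k = dy c k.
    by apply/colP => j; rewrite [RHS]mxE ffunE (projT2 (cid (cyP (k, j)))).
  exists c, X, X', Y, Y'; split=> //.
    by move=> l i ai; rewrite -ex; apply: h4.
  move=> k i ai; rewrite -ey; under eq_fun do under eq_bigr do rewrite -ex.
  exact: h5.
have [X [X' [Y [Y' [h1 h2 [h3 h3'] _ _]]]]] := cP 1 ltr01.
have lim (x z : R) : (forall y, 0 < y -> x <= z + y * V) -> x <= z.
  move=> h; apply/ler_addgt0Pr => y y0.
  have V1 : 0 < V + 1 by lra.
  apply: (le_trans (h (y / (V + 1)) _)); first by rewrite divr_gt0.
  by rewrite lerD2l mulrAC ler_pdivrMr// ler_pM2l// lerDl.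
exists X, X', Y, Y'; split=> //.
  move=> l i ai; rewrite h3; apply: lim => y y0.
  by have [? [? [? [? [_ _ _ h _]]]]] := cP y y0; apply: h.
move=> k i ai; rewrite h3'; under eq_fun do under eq_bigr do rewrite h3.
apply: lim => y y0.
by have [? [? [? [? [_ _ _ _ h]]]]] := cP y y0; apply: h.
Qed.
End ConvexBody.
End Minkowski.

(** * Labels at one finite place *)

Section Labels.
Variable R : realType.

Lemma label_product (T : Type) (J : finType) (rel : J -> T -> T -> Prop) (c : J -> R) :
  (forall j, exists (F : finType) (phi : T -> F), #|F|%:R <= c j /\
     forall x y, phi x = phi y -> rel j x y) ->
  exists (F : finType) (phi : T -> F), #|F|%:R <= \prod_j c j /\
     forall x y, phi x = phi y -> forall j, rel j x y.
Proof.
move=> h; pose F j := projT1 (cid (h j)).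
have hF j : exists phi : T -> F j, #|F j|%:R <= c j /\
    forall x y, phi x = phi y -> rel j x y := projT2 (cid (h j)).
pose phi j := projT1 (cid (hF j)); have phiP j := projT2 (cid (hF j)).
exists {dffun forall j, F j}, (fun x => [ffun j => phi j x]); split.
  rewrite card_dffun_prod natr_prod; apply: ler_prod => j _; rewrite ler0n.
  exact: (proj1 (phiP j)).
move=> x y /ffunP e j; apply: (proj2 (phiP j)).
by have := e j; rewrite !ffunE.
Qed.

Variable K : fieldExtType rat.

(** First [x] is labelled modulo [de], then the linear form modulo [ep]. The form itself need not be
    integral, so the representative of the class of [x] is subtracted first: the remainder has size
    at most |al de| <= 1. For equal labels the representatives agree and cancel. *)
Lemma place_labels p (f : K -> R) r (b : 'I_r -> K) n m
    (al : 'I_m -> 'I_n -> K) (de : 'I_n -> K) (ep : 'I_m -> K) :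
  prime p -> is_padic_place p f -> residue_spans p f b ->
  (forall l, de l != 0 /\ f (de l) <= 1) -> (forall k, ep k != 0 /\ f (ep k) <= 1) ->
  (forall k l, f (al k l * de l) <= 1) ->
  exists (F : finType) (psi : ('I_n -> K) * ('I_m -> K) -> F),
    #|F|%:R <= ((\prod_l (f (de l))^-1) * (\prod_k (f (ep k))^-1)) ^+ r /\
    forall u v, (forall l, f (u.1 l) <= 1) -> (forall k, f (u.2 k) <= 1) ->
      (forall l, f (v.1 l) <= 1) -> (forall k, f (v.2 k) <= 1) -> psi u = psi v ->
      (forall l, f (u.1 l - v.1 l) <= f (de l)) /\
      (forall k, f (\sum_l al k l * (u.1 l - v.1 l) - (u.2 k - v.2 k)) <= f (ep k)).
Proof.
move=> pr_p fP bs hde hep hal; have fA : is_absval f by case: fP.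
have hX l := residue_labels pr_p fP bs (proj1 (hde l)) (proj2 (hde l)).
have hY k := residue_labels pr_p fP bs (proj1 (hep k)) (proj2 (hep k)).
pose F l := projT1 (cid (hX l)); pose G k := projT1 (cid (hY k)).
have hF l : exists phi : K -> F l, #|F l|%:R <= (f (de l))^-1 ^+ r /\
  forall x y, f x <= 1 -> f y <= 1 -> phi x = phi y -> f (x - y) <= f (de l) := projT2 (cid (hX l)).
have hG k : exists phi : K -> G k, #|G k|%:R <= (f (ep k))^-1 ^+ r /\
  forall x y, f x <= 1 -> f y <= 1 -> phi x = phi y -> f (x - y) <= f (ep k) := projT2 (cid (hY k)).
pose phi l := projT1 (cid (hF l)); have phiP l := projT2 (cid (hF l)).
pose chi k := projT1 (cid (hG k)); have chiP k := projT2 (cid (hG k)).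
pose lx (x : 'I_n -> K) : {dffun forall l, F l} := [ffun l => phi l (x l)].
have repP c : exists x, forall x', (forall l, f (x' l) <= 1) -> lx x' = c -> lx x = c /\ forall l, f (x l) <= 1.
  have [[x [x1 xc]]|h] := pselect (exists x, (forall l, f (x l) <= 1) /\ lx x = c).
    by exists x.
  by exists (fun=> 0) => x' x1 xc; case: h; exists x'.
pose rep c := projT1 (cid (repP c)); have repE c := projT2 (cid (repP c)).
pose w (u : ('I_n -> K) * ('I_m -> K)) k := \sum_l al k l * (u.1 l - rep (lx u.1) l) - u.2 k.
pose ly u : {dffun forall k, G k} := [ffun k => chi k (w u k)].
exists ({dffun forall l, F l} * {dffun forall k, G k})%type, (fun u => (lx u.1, ly u)); split.
  rewrite card_prod !card_dffun_prod natrM !natr_prod exprMn -!prodrXl /=.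
  apply: ler_pM; rewrite ?prodr_ge0//.
    by apply: ler_prod => l _; rewrite ler0n (proj1 (phiP l)).
  by apply: ler_prod => k _; rewrite ler0n (proj1 (chiP k)).
have near x x' : (forall l, f (x l) <= 1) -> (forall l, f (x' l) <= 1) -> lx x = lx x' ->
    forall l, f (x l - x' l) <= f (de l).
  move=> x1 x1' /ffunP e l; apply: (proj2 (phiP l)) => //.
  by have := e l; rewrite !ffunE.
have w1 u k : (forall l, f (u.1 l) <= 1) -> (forall k, f (u.2 k) <= 1) -> f (w u k) <= 1.
  move=> h1 h2; have [rE r1] := repE (lx u.1) _ h1 erefl.
  apply: (padic_subl pr_p fP) => //; apply: (padic_sum_le pr_p fP) => // l _.
  apply: le_trans (hal k l); rewrite !(absvalM fA) ler_wpM2l ?(absval_ge0 fA)//.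
  exact: near.
move=> u v u1 u2 v1 v2 [e1 /ffunP e2]; split; first exact: near.
move=> k; have := proj2 (chiP k) (w u k) (w v k) (w1 u k u1 u2) (w1 v k v1 v2).
have ek : chi k (w u k) = chi k (w v k) by have := e2 k; rewrite !ffunE.
move=> /(_ ek); rewrite /w e1; congr (f _ <= _).
rewrite [RHS](_ : _ = (\sum_l al k l * (u.1 l - rep (lx v.1) l) - \sum_l al k l * (v.1 l - rep (lx v.1) l)) - (u.2 k - v.2 k)).
  ring.
by congr (_ - _); rewrite -sumrB; apply: eq_bigr => l _; ring.
Qed.
End Labels.

(** * Integral elements and smallness *)

Section IntegralElements.
Variables (R : realType) (K : fieldExtType rat).

(** If [f x > 1], the top term of a monic integer equation would exceed all others. *)
Lemma padic_integral_le1 p (f : K -> R) x : prime p -> is_padic_place p f -> is_integral x -> f x <= 1.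
Proof.
move=> pr_p fP [q [qm /eqP qx]]; have fA : is_absval f by case: fP.
rewrite leNgt; apply/negP => fx.
have sq : (0 < size q)%N by rewrite size_poly_gt0 monic_neq0.
pose n := (size q).-1; have sE : size q = n.+1 by rewrite prednK.
have qn : q`_n = 1 by have /monicP := qm; rewrite lead_coefE.
move: qx; rewrite (horner_coef_wide (n := n.+1)); last by rewrite -sE size_poly.
rewrite big_ord_recr /= coef_map /= qn mul1r => /eqP; rewrite addrC addr_eq0 => /eqP xn.
have f0 : 0 < f x by lra.
have : f (x ^+ n) <= f x ^+ n / f x.
  rewrite xn (absvalN fA); apply: (padic_sum_le pr_p fP) => [|i _].
    by rewrite divr_ge0 ?exprn_ge0// ltW.
  rewrite coef_map (absvalM fA) (absvalX fA); apply: (@le_trans _ _ (1 * f x ^+ i)).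
    by rewrite ler_wpM2r ?exprn_ge0 ?(ltW f0)// (padic_int_le1 pr_p fP).
  rewrite mul1r ler_pdivlMr// -exprSr ler_eXn2l//.
rewrite (absvalX fA) leNgt => /negP; apply.
by rewrite ltr_pdivrMr// ltr_pMr ?exprn_gt0.
Qed.

Lemma padic_nat_prime p q (f : K -> R) : prime p -> is_padic_place p f -> prime q -> p != q -> f q%:R = 1.
Proof.
move=> pr_p fP pr_q pq; rewrite (padic_nat fP) ?prime_gt0// logn_prime//.
by rewrite (negbTE pq) expr0 invr1.
Qed.

Lemma padic_place_prime_uniq p q (f : K -> R) : prime p -> prime q ->
  is_padic_place p f -> is_padic_place q f -> p = q.
Proof.
move=> pr_p pr_q fp fq; apply/eqP; apply: contraT => pq.
have := padic_nat_prime pr_p fp pr_q pq; rewrite (padic_p pr_q fq) => /eqP.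
by rewrite invr_eq1 pnatr_eq1 => /eqP q1; move: pr_q; rewrite q1.
Qed.

(** A high power of [y] is integral, with conjugates so small that its integer coordinates are below
    1 in absolute value, hence 0. *)
Lemma integral_small_eq0 (s : 'I_(\dim {:K}) -> {rmorphism K -> R[i]}) (w : 'I_(\dim {:K}) -> K) y :
  (forall u : 'rV[R[i]]_(\dim {:K}), (forall x, \sum_i u 0 i * s i x = 0) -> u = 0) ->
  (forall x, is_integral x -> exists c : 'I_(\dim {:K}) -> int, x = \sum_j (c j)%:~R * w j) ->
  (forall p (f : K -> R), prime p -> is_padic_place p f -> f y <= 1) ->
  (forall i, cabs (s i) y < 1) -> y = 0.
Proof.
move=> ind wZ y1 ys; apply/eqP; apply: contraT => y0.
have [M M0 MP] := coordinate_bound ind (integral_basis_spans wZ).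
have e0 : 0 < (M + 1)^-1 / ((\dim {:K})%:R + 1) :> R.
  by rewrite divr_gt0 ?invr_gt0// ltr_wpDl.
have small i : \forall k \near \oo, cabs (s i) y ^+ k < (M + 1)^-1 / ((\dim {:K})%:R + 1).
  by apply: expr_small => //; rewrite ys andbT; apply: (absval_ge0 (proj1 (cabs_arch (s i)))).
have [k _ /(_ k (leqnn k)) /= hk] := @filter_forall _ _ _ \oo _ small.
have yk : is_integral (y ^+ k).
  apply: (@integral_of_padic_le1 R) => p f pr_p fP.
  by rewrite (absvalX (proj1 fP)) exprn_ile1 ?(absval_ge0 (proj1 fP))//; apply: (y1 p).
have [c cE] := wZ _ yk.
have cE' : y ^+ k = \sum_j ((c j)%:~R : rat) *: w j.
  by rewrite cE; apply: eq_bigr => j _; rewrite -mulr_algl alg_num_field ratr_int.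
suff c0 j : c j = 0.
  by have := expf_neq0 k y0; rewrite cE big1 ?eqxx// => j _; rewrite c0 mul0r.
have := MP (fun j => (c j)%:~R) j; rewrite -cE' ratr_int => h.
have sm : \sum_i cabs (s i) (y ^+ k) <= \sum_(i < \dim {:K}) (M + 1)^-1 / ((\dim {:K})%:R + 1).
  by apply: ler_sum => i _; rewrite (absvalX (proj1 (cabs_arch (s i)))); apply/ltW/hk.
rewrite sumr_const card_ord -[_ *+ \dim _]mulr_natr in sm.
have lt1 : `|(c j)%:~R : R| < 1.
  apply: (le_lt_trans h); apply: (@le_lt_trans _ _ (M * ((M + 1)^-1 / ((\dim {:K})%:R + 1) * (\dim {:K})%:R))).
    by rewrite ler_wpM2l.
  have h4 : M * (M + 1)^-1 < 1 by rewrite ltr_pdivrMr ?mul1r ?ltrDl ?ltr_wpDl.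
  have h5 : ((\dim {:K})%:R + 1 : R)^-1 * (\dim {:K})%:R <= 1 by rewrite mulrC ler_pdivrMr ?mul1r ?lerDl// ltr_wpDl.
  have h6 : 0 <= M * (M + 1)^-1 by rewrite divr_ge0// addr_ge0.
  have : M * (M + 1)^-1 * (((\dim {:K})%:R + 1 : R)^-1 * (\dim {:K})%:R) <= M * (M + 1)^-1 by rewrite ler_piMr.
  move=> h7; apply: le_lt_trans h4; apply: le_trans h7; by rewrite !mulrA.
by move: lt1; rewrite -intr_norm -[1]/(1%:~R) ltr_int; lia.
Qed.
End IntegralElements.

(** * Labels for all finite places together *)

Section FinitePart.
Variables (R : realType) (K : fieldExtType rat) (I : finType) (v : I -> K -> R) (v_inj : injective v).
Variables (na : pred I) (pr : I -> nat) (dv : I -> nat) (n m : nat).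
Hypothesis pr_prime : forall i, na i -> prime (pr i).
Hypothesis vP : forall i, na i -> is_padic_place (pr i) (v i).
Hypothesis dvE : forall i r (b : 'I_r -> K), na i ->
  residue_free (pr i) (v i) b -> residue_spans (pr i) (v i) b -> dv i = r.
Variables (de : I -> 'I_n -> K) (ep : I -> 'I_m -> K) (al : I -> 'I_m -> 'I_n -> K).
Hypotheses (de0 : forall i l, de i l != 0) (ep0 : forall i k, ep i k != 0).
Local Notation d := (\dim {:K}).

(** The inverse volume of the box at the place [i]; up to the contribution of [Q h], it bounds the
    number of labels there. *)
Let G i : R := ((\prod_l (v i (de i l))^-1) * (\prod_k (v i (ep i k))^-1)) ^+ dv i.

Let M := (\max_i pr i).+1.
Let inP : pred 'I_M := fun p => prime p && [exists i, na i && (pr i == p)].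

Let prM i : (pr i < M)%N.
Proof. by rewrite /M ltnS; apply: (leq_bigmax i). Qed.

Let inPi i : na i -> inP (Ordinal (prM i)).
Proof. by move=> ni; rewrite /inP /= pr_prime//=; apply/existsP; exists i; rewrite ni eqxx. Qed.

(* Multiplying by Q h with h large makes the radii at the finite places integral. *)
Let Q h : nat := (\prod_(p | inP p) p ^ h)%N.

Let Q_gt0 h : (0 < Q h)%N.
Proof. by apply: prodn_cond_gt0 => p /andP[/prime_gt0 p0 _]; rewrite expn_gt0 p0. Qed.

Let QE p (f : K -> R) h : prime p -> is_padic_place p f -> (exists2 i, na i & pr i = p) ->
  f (Q h)%:R = p%:R^-1 ^+ h.
Proof.
move=> pr_p fP [i ni ip]; have fA : is_absval f by case: fP.
rewrite /Q natr_prod (absval_prod fA) (bigD1 (Ordinal (prM i))) ?inPi//=.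
have -> : f (pr i ^ h)%:R = p%:R^-1 ^+ h by rewrite natrX (absvalX fA) ip (padic_p pr_p fP).
rewrite big1 ?mulr1// => q /andP[/andP[pq _] qi].
rewrite natrX (absvalX fA) (padic_nat_prime pr_p fP pq) ?expr1n//.
by apply: contraNneq qi => pE; apply/eqP/val_inj; rewrite /= ip pE.
Qed.

Let QE1 p (f : K -> R) h : prime p -> is_padic_place p f -> (forall i, na i -> pr i != p) ->
  f (Q h)%:R = 1.
Proof.
move=> pr_p fP np; have fA : is_absval f by case: fP.
rewrite /Q natr_prod (absval_prod fA) big1// => q /andP[pq /existsP[i /andP[ni /eqP iq]]].
rewrite natrX (absvalX fA) (padic_nat_prime pr_p fP pq) ?expr1n//.
by rewrite -iq eq_sym np.
Qed.

Let place_bounds h (u w : ('I_n -> K) * ('I_m -> K)) i : Prop :=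
  (forall l, v i (u.1 l - w.1 l) <= v i (Q h)%:R * v i (de i l)) /\
  (forall k, v i (\sum_l al i k l * (u.1 l - w.1 l) - (u.2 k - w.2 k)) <= v i (Q h)%:R * v i (ep i k)).

Let integral_bounds h (u w : ('I_n -> K) * ('I_m -> K)) (f : K -> R) : Prop :=
  (forall l, f (u.1 l - w.1 l) <= f (Q h)%:R) /\ (forall k, f (u.2 k - w.2 k) <= f (Q h)%:R).

Let padic_integral (u : ('I_n -> K) * ('I_m -> K)) : Prop :=
  forall p (f : K -> R), prime p -> is_padic_place p f ->
    (forall l, f (u.1 l) <= 1) /\ (forall k, f (u.2 k) <= 1).

Let exponent_exists : exists h, forall i, na i ->
  (forall l, v i ((Q h)%:R * de i l) <= 1) /\ (forall k, v i ((Q h)%:R * ep i k) <= 1) /\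
  (forall k l, v i (al i k l * ((Q h)%:R * de i l)) <= 1).
Proof.
pose B i := 1 + \sum_l v i (de i l) + \sum_k v i (ep i k) + \sum_k \sum_l v i (al i k l * de i l).
have near i : \forall h \near \oo, na i -> (pr i)%:R^-1 ^+ h < (B i)^-1.
  have [ni|_] := boolP (na i); last exact: nearW.
  have vA : is_absval (v i) by case: (vP ni).
  have B0 : 0 < B i.
    by rewrite /B -!addrA ltr_pwDl// !addr_ge0 ?sumr_ge0// => *; rewrite ?sumr_ge0// => *; apply: absval_ge0.
  have p1 : 1 < ((pr i)%:R : R) by rewrite ltr1n prime_gt1// pr_prime.
  have B0' : 0 < (B i)^-1 by rewrite invr_gt0.
  have pI : 0 <= ((pr i)%:R^-1 : R) < 1 by rewrite invr_ge0 invf_lt1 ?p1 ?(ltW (lt_trans ltr01 p1))// (lt_trans ltr01 p1).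
  by have := expr_small pI B0'; apply: filterS.
have [h _ /(_ h (leqnn h)) /= hh] := @filter_forall _ _ _ \oo _ near.
exists h => i ni; have vA : is_absval (v i) by case: (vP ni).
have qB := hh i ni; have QQ := QE h (pr_prime ni) (vP ni) (ex_intro2 _ _ i ni erefl).
have B0 : 0 < B i.
  by rewrite /B -!addrA ltr_pwDl// !addr_ge0 ?sumr_ge0// => *; rewrite ?sumr_ge0// => *; apply: absval_ge0.
have key x : 0 <= x -> x <= B i -> v i (Q h)%:R * x <= 1.
  move=> x0 xB; rewrite QQ; apply: (@le_trans _ _ ((B i)^-1 * B i)); last by rewrite mulVf ?gt_eqF.
  by apply: ler_pM => //; [rewrite -QQ; apply: absval_ge0 | apply: ltW].
have s1 : 0 <= \sum_l v i (de i l) by apply: sumr_ge0 => *; apply: absval_ge0.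
have s2 : 0 <= \sum_k v i (ep i k) by apply: sumr_ge0 => *; apply: absval_ge0.
have s3 : 0 <= \sum_k \sum_l v i (al i k l * de i l) by do 2 (apply: sumr_ge0 => ? _); apply: absval_ge0.
split=> [l|]; last split=> [k|k l].
- rewrite (absvalM vA); apply: key; first exact: absval_ge0.
  have : v i (de i l) <= \sum_l v i (de i l).
    by apply: (@ler_term_sum R _ l) => // l'; apply: absval_ge0.
  by rewrite /B; lra.
- rewrite (absvalM vA); apply: key; first exact: absval_ge0.
  have : v i (ep i k) <= \sum_k v i (ep i k).
    by apply: (@ler_term_sum R _ k) => // k'; apply: absval_ge0.
  by rewrite /B; lra.
- rewrite mulrCA (absvalM vA); apply: key; first exact: absval_ge0.
  have : v i (al i k l * de i l) <= \sum_k \sum_l v i (al i k l * de i l).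
    apply: (@ler_term_sum R _ k) => [k'|]; first by apply: sumr_ge0 => *; apply: absval_ge0.
    by apply: (@ler_term_sum R _ l) => // l'; apply: absval_ge0.
  by rewrite /B; lra.
Qed.

Let G_ge0 i : na i -> 0 <= G i.
Proof.
move=> ni; have vA : is_absval (v i) by case: (vP ni).
by rewrite exprn_ge0// mulr_ge0// prodr_ge0// => *; rewrite invr_ge0 absval_ge0.
Qed.

(** All places over [p] are labelled. At those not among the [v i], points are taken modulo [Q h],
    so that differences stay integral there after division by [Q h]. The scaling costs p^(h (n+m)
    r_j) at the j-th place, in total at most p^(h d (n+m)) because the r_j sum to at most d. *)
Lemma prime_labels h (p : 'I_M) : (forall i, na i ->
    (forall l, v i ((Q h)%:R * de i l) <= 1) /\ (forall k, v i ((Q h)%:R * ep i k) <= 1) /\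
    (forall k l, v i (al i k l * ((Q h)%:R * de i l)) <= 1)) -> inP p ->
  exists (F : finType) (psi : ('I_n -> K) * ('I_m -> K) -> F),
    #|F|%:R <= (p ^ (h * (d * (n + m))))%:R * \prod_(i | na i && (pr i == p)) G i /\
    forall u w, psi u = psi w -> padic_integral u -> padic_integral w ->
      (forall i, na i -> pr i = p -> place_bounds h u w i) /\
      (forall f, is_padic_place p f -> (forall i, na i -> v i <> f) -> integral_bounds h u w f).
Proof.
move=> hh /andP[pr_p /existsP[i1 /andP[ni1 /eqP i1p]]].
have pex : exists2 i, na i & pr i = p by exists i1.
have p0 : 0 < ((p : nat)%:R : R) by rewrite ltr0n prime_gt0.
have [s [W [r [b [WI WP rsum bP Wall]]]]] := places_over_prime R K pr_p.
have WA j : is_absval (W j) by case: (WP j).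
have QW j : W j (Q h)%:R = (p : nat)%:R^-1 ^+ h := QE h pr_p (WP j) pex.
have [j1 _] : exists j, W j = v i1 by apply: Wall; rewrite -i1p; apply: vP.
have Q0 : ((Q h)%:R : K) != 0.
  by rewrite -(absval_gt0 (WA j1)) QW exprn_gt0// invr_gt0.
pose cnt j : R := ((p ^ (h * (n + m)))%:R) ^+ r j * \prod_(i | na i && `[< v i = W j >]) G i.
pose rel j (u w : ('I_n -> K) * ('I_m -> K)) : Prop := padic_integral u -> padic_integral w ->
  (forall i, na i -> v i = W j -> place_bounds h u w i) /\
  ((forall i, na i -> v i <> W j) -> integral_bounds h u w (W j)).
have one j : exists (F : finType) (psi : ('I_n -> K) * ('I_m -> K) -> F),
    #|F|%:R <= cnt j /\ forall u w, psi u = psi w -> rel j u w.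
  have powE : ((p : nat)%:R^-1 ^+ h)^-1 ^+ n * ((p : nat)%:R^-1 ^+ h)^-1 ^+ m = (p ^ (h * (n + m)))%:R :> R.
    have -> : ((p : nat)%:R^-1 ^+ h)^-1 = (p : nat)%:R ^+ h :> R by rewrite exprVn invrK.
    by rewrite -exprD natrX exprM.
  have [[i ni iE]|nex] := pselect (exists2 i, na i & v i = W j).
    have ip : pr i = p.
      by apply: (padic_place_prime_uniq (pr_prime ni) pr_p (vP ni)); rewrite iE.
    have [hd [he ha]] := hh i ni.
    have dr : dv i = r j.
      by apply: (dvE (b := b j) ni); rewrite ip iE; case: (bP j).
    have [|||F [psi [cF hF]]] := @place_labels R K p (W j) (r j) (b j) n m (al i)
        (fun l => (Q h)%:R * de i l) (fun k => (Q h)%:R * ep i k) pr_p (WP j) (proj2 (bP j)).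
    - by move=> l; split; [rewrite mulf_neq0 ?de0 | rewrite -iE; apply: hd].
    - by move=> k; split; [rewrite mulf_neq0 ?ep0 | rewrite -iE; apply: he].
    - by move=> k l; rewrite -iE; apply: ha.
    exists F, psi; split.
      apply: (le_trans cF); rewrite /cnt (big_pred1 i); last first.
        move=> i'; apply/andP/eqP => [[_ /asboolP h']|->]; last by split=> //; apply/asboolP.
        by apply: v_inj; rewrite h' iE.
      rewrite /G dr -exprMn -iE; have vA : is_absval (v i) by rewrite iE.
      under eq_bigr do rewrite (absvalM vA) invfM iE QW -iE.
      under [X in _ * X]eq_bigr do rewrite (absvalM vA) invfM iE QW -iE.
      rewrite !big_split /= !prodr_const !card_ord -powE le_eqVlt; apply/orP; left; apply/eqP.
      by congr (_ ^+ _); ring.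
    move=> u w e pu pw; have [u1 u2] := pu _ _ pr_p (WP j); have [w1 w2] := pw _ _ pr_p (WP j).
    have [b1 b2] := hF u w u1 u2 w1 w2 e; split; last by move=> /(_ i ni).
    move=> i' _ h'; have -> : i' = i by apply: v_inj; rewrite h' iE.
    by rewrite /place_bounds iE; split=> [l|k]; rewrite -(absvalM (WA j)).
  have [|||F [psi [cF hF]]] := @place_labels R K p (W j) (r j) (b j) n m (fun _ _ => 0)
        (fun l => (Q h)%:R) (fun k => (Q h)%:R) pr_p (WP j) (proj2 (bP j)).
  - by move=> _; split=> //; apply: (padic_nat_le1 pr_p (WP j)).
  - by move=> _; split=> //; apply: (padic_nat_le1 pr_p (WP j)).
  - by move=> _ _; rewrite mul0r (absval0 (WA j)).
  exists F, psi; split.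
    apply: (le_trans cF); rewrite /cnt.
    have -> : \prod_(i | na i && `[< v i = W j >]) G i = 1.
      apply: big_pred0 => i; case ni : (na i) => //=.
      by apply/asboolP => h'; apply: nex; exists i.
    by rewrite !prodr_const !card_ord QW powE mulr1.
  move=> u w e pu pw; have [u1 u2] := pu _ _ pr_p (WP j); have [w1 w2] := pw _ _ pr_p (WP j).
  have [b1 b2] := hF u w u1 u2 w1 w2 e; split; first by move=> i ni iE; case: nex; exists i.
  move=> _; split=> // k; have := b2 k; rewrite big1 ?sub0r ?(absvalN (WA j))//.
  by move=> *; rewrite mul0r.
have [F [psi [cF hF]]] := label_product one.
exists F, psi; split.
  apply: (le_trans cF); rewrite /cnt big_split /=; apply: ler_pM.
  - by apply: prodr_ge0 => j _; rewrite exprn_ge0.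
  - by apply: prodr_ge0 => j _; apply: prodr_ge0 => i /andP[ni _]; apply: G_ge0.
  - rewrite prodrXr -natrX ler_nat -expnM leq_exp2l ?prime_gt1//.
    by rewrite -mulnA leq_mul2l [X in (_ <= X)%N]mulnC leq_mul2l rsum !orbT.
  have jP i : na i -> pr i = p -> exists j, W j = v i.
    by move=> ni ip; apply: Wall; rewrite -ip; apply: vP.
  (* Each [v i] over [p] occurs once in the list [W]; grouping by its position there turns the
     product over places into one over [j]. *)
  pose jf i : option 'I_s := [pick j | `[< v i = W j >]].
  rewrite [X in _ <= X](partition_big jf (fun x => x != None)) /=; last first.
    move=> i /andP[ni /eqP ip]; have [j ij] := jP i ni ip.
    by rewrite /jf; case: pickP => // /(_ j) /asboolP; rewrite ij.
  have -> : \prod_(x | x != None) \prod_(i | na i && (pr i == p) && (jf i == x)) G i =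
     \prod_(j < s) \prod_(i | na i && (pr i == p) && (jf i == Some j)) G i.
    rewrite (reindex_onto Some (fun x => if x is Some j then j else j1)) /=; last by case.
    by apply: eq_bigl => j; rewrite eqxx.
  rewrite le_eqVlt; apply/orP; left; apply/eqP; apply: eq_bigr => j _; apply: eq_bigl => i.
  case ni : (na i) => //=; apply/asboolP/andP => [iW|[/eqP ip /eqP]].
    split; first by apply/eqP; apply: (padic_place_prime_uniq (pr_prime ni) pr_p (vP ni)); rewrite iW.
    rewrite /jf; case: pickP => [j' /asboolP ij'|/(_ j)/asboolP//].
    by apply/eqP; congr Some; apply: WI; rewrite -ij' iW.
  by rewrite /jf; case: pickP => // j' /asboolP ij' [<-].
move=> u w e pu pw; split.
  move=> i ni ip; have [j ij] := Wall (v i) ltac:(by rewrite -ip; apply: vP).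
  by have [h1 _] := hF u w e j pu pw; apply: h1.
move=> f fP nf; have [j jf] := Wall f fP; rewrite -jf.
by have [_ h2] := hF u w e j pu pw; apply: h2 => i ni; rewrite jf; apply: nf.
Qed.

(** The prime labels are multiplied together. At a prime below no [v i] the integer [Q h] is a unit,
    and the required bounds already follow from integrality. *)
Lemma finite_part_labels : exists (q : nat) (F : finType) (psi : ('I_n -> K) * ('I_m -> K) -> F),
  [/\ (0 < q)%N,
   #|F|%:R <= q%:R ^+ (d * (n + m)) * \prod_(i | na i) G i &
   forall u w, psi u = psi w -> padic_integral u -> padic_integral w ->
    (forall i, na i ->
      (forall l, v i (u.1 l - w.1 l) <= v i q%:R * v i (de i l)) /\
      (forall k, v i (\sum_l al i k l * (u.1 l - w.1 l) - (u.2 k - w.2 k)) <= v i q%:R * v i (ep i k))) /\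
    (forall p f, prime p -> is_padic_place p f -> (forall i, na i -> v i <> f) ->
      (forall l, f (u.1 l - w.1 l) <= f q%:R) /\ (forall k, f (u.2 k - w.2 k) <= f q%:R))].
Proof.
have [h hh] := exponent_exists.
pose cnt (p : 'I_M) : R := if inP p then
  (p ^ (h * (d * (n + m))))%:R * \prod_(i | na i && (pr i == p)) G i else 1.
pose rel (p : 'I_M) (u w : ('I_n -> K) * ('I_m -> K)) : Prop := inP p ->
  padic_integral u -> padic_integral w ->
  (forall i, na i -> pr i = p -> place_bounds h u w i) /\
  (forall f, is_padic_place p f -> (forall i, na i -> v i <> f) -> integral_bounds h u w f).
have [F [psi [cF hF]]] : exists (F : finType) (psi : ('I_n -> K) * ('I_m -> K) -> F),
    #|F|%:R <= \prod_p cnt p /\ forall u w, psi u = psi w -> forall p, rel p u w.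
  apply: label_product => p; rewrite /cnt /rel; case: ifP => [Pp|_].
    have [F [psi [cF hF]]] := prime_labels hh Pp.
    by exists F, psi; split=> // u w e _; apply: hF.
  by exists unit, (fun=> tt); rewrite card_unit.
exists (Q h), F, psi; split=> //.
  apply: (le_trans cF); rewrite /cnt -big_mkcond big_split /=.
  rewrite le_eqVlt; apply/orP; left; apply/eqP; congr (_ * _).
    rewrite /Q natr_prod -prodrXl; apply: eq_bigr => p _.
    by rewrite -natrX -expnM.
  rewrite [RHS](partition_big (fun i => Ordinal (prM i)) inP) /=; last by move=> i; apply: inPi.
  by apply: eq_bigr => p _; apply: eq_bigl => i.
move=> u w e pu pw; split.
  move=> i ni; have [h1 _] := hF u w e (Ordinal (prM i)) (inPi ni) pu pw.
  exact: h1.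
move=> p f pr_p fP nf.
have [[i ni ip]|nex] := pselect (exists2 i, na i & pr i = p).
  have [_ h2] := hF u w e (Ordinal (prM i)) (inPi ni) pu pw.
  by apply: h2 => //; rewrite /= ip.
have Q1 : f (Q h)%:R = 1.
  by apply: (QE1 h pr_p fP) => i ni; apply/eqP => ip; apply: nex; exists i.
have [u1 u2] := pu p f pr_p fP; have [w1 w2] := pw p f pr_p fP.
by rewrite Q1; split=> [l|k]; apply: (padic_subl pr_p fP).
Qed.
End FinitePart.

(** * From the completions to K, and the balance of constants *)

Lemma padic_approximation (R : realType) (K : fieldExtType rat) (p : nat) (f : K -> R)
    (Kv : fieldType) (iota : {rmorphism K -> Kv}) (nv : Kv -> R) (y : Kv) :
  is_completion f iota nv -> prime p -> is_padic_place p f -> y != 0 ->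
  exists2 x, x != 0 & f x = nv y.
Proof.
move=> compl pr_p fP y0; have [nA [nE [_ dens]]] := compl.
have ultra := completion_ultra compl pr_p fP.
have ny : 0 < nv y by rewrite (absval_gt0 nA).
(* By the ultrametric inequality, an element of K closer to [y] than [nv y] has the same absolute
   value as [y]. *)
have [x hx] := dens y _ ny.
have xE : nv (iota x) = nv y.
  apply/eqP; rewrite eq_le; apply/andP; split.
    have -> : iota x = y - (y - iota x) by ring.
    by apply: le_trans (ultra _ _) _; rewrite ge_max lexx (absvalN nA) ltW.
  rewrite leNgt; apply/negP => h; have := ultra (y - iota x) (iota x).
  by rewrite subrK leNgt gt_max hx h.
exists x; last by rewrite -nE.
by rewrite -(absval_gt0 (absval_of_completion compl)) -nE xE.
Qed.

Lemma completion_sum_bound (R : realType) (K : fieldExtType rat) (p : nat) (f : K -> R)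
    (Kv : fieldType) (iota : {rmorphism K -> Kv}) (nv : Kv -> R) n
    (a : 'I_n -> Kv) (al : 'I_n -> K) (x : 'I_n -> K) (y : K) (e : R) :
  is_completion f iota nv -> prime p -> is_padic_place p f -> 0 <= e ->
  (forall l, nv (a l - iota (al l)) * f (x l) <= e) ->
  f (\sum_l al l * x l - y) <= e -> nv (\sum_l a l * iota (x l) - iota y) <= e.
Proof.
move=> compl pr_p fP e0 h1 h2; have [nA [nE _]] := compl.
have ultra := completion_ultra compl pr_p fP.
have addl u w : nv u <= e -> nv w <= e -> nv (u + w) <= e.
  by move=> hu hw; apply: le_trans (ultra _ _) _; rewrite ge_max hu.
have -> : \sum_l a l * iota (x l) - iota y =
    \sum_l (a l - iota (al l)) * iota (x l) + iota (\sum_l al l * x l - y).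
  rewrite rmorphB rmorph_sum addrA -big_split; congr (_ - _); apply: eq_bigr => l _.
  by rewrite rmorphM /=; ring.
apply: (addl); last by rewrite nE.
by elim/big_ind : _ => [|u w hu hw|l _]; rewrite ?(absval0 nA) ?(addl) ?(absvalM nA) ?nE.
Qed.

(** A complex place contributes pi/4 from the disc of half radius, 2/pi from the constant of the
    theorem and 2 from |D_K|^(1/2) = 2^s |det|; the product is 1. *)
Lemma half_volume_product (R : realType) (I : finType) (arch : pred I) (dv : I -> nat) (n m d q : nat)
    (a : 'I_n + 'I_m -> I -> R) (det : R) :
  (forall i, arch i -> dv i = 2%N \/ dv i = 1%N) ->
  (forall x : R, x ^+ d = \prod_(i | arch i) x ^+ dv i) ->
  (forall l i, 0 < a l i) ->
  \prod_i \prod_l a l i ^+ dv i =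
    ((2 / pi) ^+ #|finset (fun i => arch i && (dv i == 2%N))| *
     Num.sqrt (4 ^+ #|finset (fun i => arch i && (dv i == 2%N))| * det ^+ 2)) ^+ (m + n) ->
  \prod_l \prod_(i | arch i) half_volume dv i (q%:R * a l i) =
  `|det| ^+ (n + m) * (q%:R ^+ (d * (n + m)) * \prod_(i | ~~ arch i) (\prod_l (a l i)^-1) ^+ dv i).
Proof.
move=> dv12 dimE a0; set s := #|_|; rewrite (bigID arch) /= => prodE.
have N_card : #|{: 'I_n + 'I_m}| = (n + m)%N by rewrite card_sum !card_ord.
have hE l : \prod_(i | arch i) half_volume dv i (q%:R * a l i) =
    ((pi / 4) ^+ s * q%:R ^+ d) * \prod_(i | arch i) a l i ^+ dv i.
  rewrite dimE /s cardsE -prodr_const big_mkcondr /= -!big_split; apply: eq_bigr => i /dv12 di.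
  by rewrite /half_volume; case: di => -> /=; rewrite ?exprMn ?expr1 ?mul1r ?mulrA.
under eq_bigr do rewrite hE.
rewrite big_split prodr_const N_card /=.
have P0 : \prod_(i | ~~ arch i) \prod_l a l i ^+ dv i != 0.
  by apply/prodf_neq0 => i _; apply/prodf_neq0 => l _; rewrite expf_neq0 ?gt_eqF.
have -> : \prod_(i | ~~ arch i) (\prod_l (a l i)^-1) ^+ dv i =
    (\prod_(i | ~~ arch i) \prod_l a l i ^+ dv i)^-1.
  rewrite -prodfV; apply: eq_bigr => i _.
  by rewrite -prodrXl -prodfV; apply: eq_bigr => l _; rewrite exprVn.
rewrite exchange_big /=; apply: (canRL (mulfK P0)) || apply: (mulIf P0).
rewrite -mulrA prodE [in RHS]mulrA mulfVK// exprM -!exprMn addnC -exprMn; congr (_ ^+ _).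
rewrite sqrtrM ?exprn_ge0// sqrtr_sqr.
have -> : Num.sqrt (4 ^+ s : R) = 2 ^+ s.
  by rewrite (_ : 4 = 2 ^+ 2 :> R) -?exprM ?[(2 * s)%N]mulnC ?exprM ?sqrtr_sqr ?ger0_norm ?exprn_ge0//; ring.
have pi0 : pi != 0 :> R by rewrite gt_eqF// pi_gt0.
rewrite mulrA [_ * _ ^+ d]mulrC -!mulrA [RHS]mulrC; congr (_ * _).
rewrite !mulrA -!exprMn; have -> : pi / 4 * (2 / pi) * 2 = 1 :> R.
  by move: pi0; move: (pi : R) => p p0; field.
by rewrite expr1n mul1r.
Qed.

(** * Translating the data of the theorem into a lattice problem, and back *)

Unset Implicit Arguments. Local Close Scope classical_set_scope.

Theorem theorem1p1 (R : realType) (K : fieldExtType rat)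
  (I : finType) (v : I -> K -> R)
  (v_inj : injective v) (v_place : forall i, is_place (v i))
  (S_arch : forall f : K -> R, is_arch_place f -> exists i, v i = f)
  (Kv : I -> fieldType) (iota : forall i, {rmorphism K -> Kv i})
  (nv : forall i, Kv i -> R)
  (Kv_compl : forall i, is_completion (v i) (iota i) (nv i))
  (dv : I -> nat) (dv_def : forall i, local_degree (nv i) (dv i))
  (D : rat) (D_def : is_discriminant K D)
  (m n : nat) (m_gt0 : (0 < m)%N) (n_gt0 : (0 < n)%N)
  (A : forall i, 'M[Kv i]_(m, n))
  (eps : forall i, 'I_m -> Kv i) (delta : forall i, 'I_n -> Kv i)
  (eps_nz : forall i k, eps i k != 0) (delta_nz : forall i j, delta i j != 0)
  (eps_lt1 : forall i k, nv i (eps i k) ^+ dv i < 1)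
  (delta_ge1 : forall i j, 1 <= nv i (delta i j) ^+ dv i)
  (prod_eq : \prod_(i : I)
       ((\prod_(k < m) nv i (eps i k) ^+ dv i) *
        (\prod_(j < n) nv i (delta i j) ^+ dv i))
     = constK R #|[set i : I | `[< is_arch_place (v i) >] && (dv i == 2%N)]| D
         ^+ (m + n)) :
  exists (x : 'I_n -> K) (y : 'I_m -> K),
    (forall j, in_OS v (x j)) /\ (forall k, in_OS v (y k)) /\
    (exists j, x j != 0) /\
    forall i : I,
      (forall k : 'I_m,
         nv i (\sum_(j < n) A i k j * iota i (x j) - iota i (y k)) <= nv i (eps i k)) /\
      (forall j : 'I_n, nv i (iota i (x j)) <= nv i (delta i j)).
Proof.
have [s [t [sigma st]]] := embedding_pairing_exists v_inj S_arch Kv_compl dv_def.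
have [tinj tim deg sE ind] := st.
have [w [wI [wZ DE]]] := D_def.
have wQ := integral_basis_spans wZ.
pose arch i := `[< is_arch_place (v i) >]; pose na i := ~~ arch i.
have vA i : is_absval (v i) by case: (v_place i).
have prP i : exists p, na i -> prime p /\ is_padic_place p (v i).
  case: (boolP (na i)) => [nai|_]; last by exists 0%N.
  case: (v_place i) => _ [h|[p [pp hp]]]; last by exists p.
  by case/negP: nai; apply/asboolP.
pose pr i := projT1 (cid (prP i)); have prE i : na i -> prime (pr i) /\ is_padic_place (pr i) (v i) := projT2 (cid (prP i)).
have nA i : is_absval (nv i) by case: (Kv_compl i).
have nE i x : nv i (iota i x) = v i x by case: (Kv_compl i) => _ [].
have delta0 i j : 0 < nv i (delta i j) by rewrite (absval_gt0 (nA i)).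
have eps0 i k : 0 < nv i (eps i k) by rewrite (absval_gt0 (nA i)).
have eps1 i k : nv i (eps i k) < 1.
  by rewrite ltNge; apply/negP => h; have := eps_lt1 i k; rewrite ltNge exprn_ege1.
have deP i l : exists2 x, x != 0 & na i -> v i x = nv i (delta i l).
  case: (boolP (na i)) => [nai|_]; last by exists 1; rewrite ?oner_eq0.
  have [pp fp] := prE i nai.
  by have [x x0 xE] := padic_approximation (Kv_compl i) pp fp (delta_nz i l); exists x.
have epP i k : exists2 x, x != 0 & na i -> v i x = nv i (eps i k).
  case: (boolP (na i)) => [nai|_]; last by exists 1; rewrite ?oner_eq0.
  have [pp fp] := prE i nai.
  by have [x x0 xE] := padic_approximation (Kv_compl i) pp fp (eps_nz i k); exists x.
pose de i l := s2val (cid2 (deP i l)); pose ep i k := s2val (cid2 (epP i k)).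
have de0 i l : de i l != 0 := s2valP (cid2 (deP i l)).
have ep0 i k : ep i k != 0 := s2valP (cid2 (epP i k)).
have deE i l : na i -> v i (de i l) = nv i (delta i l) := s2valP' (cid2 (deP i l)).
have epE i k : na i -> v i (ep i k) = nv i (eps i k) := s2valP' (cid2 (epP i k)).
(* With this precision, replacing [A i k l] by an element of K costs at most [nv i (eps i k)] once
   [x l] satisfies its own bound. *)
have alP i k l : exists x, nv i (A i k l - iota i x) < nv i (eps i k) / nv i (delta i l).
  by case: (Kv_compl i) => _ [_ [_ dens]]; apply: dens; rewrite divr_gt0.
pose al i k l := projT1 (cid (alP i k l)).
have alE i k l : nv i (A i k l - iota i (al i k l)) < nv i (eps i k) / nv i (delta i l) := projT2 (cid (alP i k l)).
have dvE i r (b : 'I_r -> K) : na i -> residue_free (pr i) (v i) b -> residue_spans (pr i) (v i) b -> dv i = r.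
  by move=> /prE[pp fp] bf bs; apply: (padic_local_degree (Kv_compl i) pp fp (dv_def i) bf bs).
have [q [F [psi [q0 cF psiP]]]] := finite_part_labels v_inj (fun i h => proj1 (prE i h))
  (fun i h => proj2 (prE i h)) dvE al de0 ep0.
pose val (z : 'cV[int]_(\dim {:K})) : K := \sum_j (z j 0)%:~R * w j.
have valB z z' : val (z - z') = val z - val z'.
  by rewrite /val -sumrB; apply: eq_bigr => j _; rewrite !mxE rmorphB mulrBl.
have val_padic p (f : K -> R) z : prime p -> is_padic_place p f -> f (val z) <= 1.
  move=> pp fp; apply: (padic_sum_le pp fp) => // j _; rewrite (absvalM (proj1 fp)).
  by rewrite mulr_ile1 ?(absval_ge0 (proj1 fp)) ?(padic_int_le1 pp fp) ?(padic_integral_le1 pp fp).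
have val_eq0 z : val z = 0 -> z = 0.
  have [M M0 MP] := coordinate_bound ind wQ.
  move=> z0; apply/colP => j; rewrite mxE; apply/eqP.
  have := MP (fun j => (z j 0)%:~R) j.
  have -> : \sum_k ((z k 0)%:~R : rat) *: w k = 0.
    by rewrite -[RHS]z0; apply: eq_bigr => k _; rewrite -mulr_algl alg_num_field ratr_int.
  rewrite ratr_int big1 ?mulr0 ?normr_le0 ?intr_eq0// => r _.
  by rewrite /cabs rmorph0 Normc.normc0.
pose lab (X : 'I_n -> 'cV[int]_(\dim {:K})) (Y : 'I_m -> 'cV[int]_(\dim {:K})) :=
  psi (val \o X, val \o Y).
have arch_fst i : arch i -> exists r, t r = (i, false) by move=> ai; apply/tim.
have arch_snd i : arch i -> dv i = 2%N -> exists r, t r = (i, true) by move=> ai d2; apply/tim.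
have arch_t r : arch (t r).1.
  by have [] := proj1 (tim (t r).1 (t r).2) (ex_intro _ r (surjective_pairing _)).
have dv12 i : arch i -> dv i = 2%N \/ dv i = 1%N.
  by move=> ai; case: (deg i ai) => _ [|[]]; [left | right].
have dimE (x : R) : x ^+ \dim {:K} = \prod_(i | arch i) x ^+ dv i.
  by rewrite -(prod_pairing_place st (fun=> x)) prodr_const card_ord.
have coP i k : exists co : 'I_n -> R[i], arch i ->
    (forall (x : 'I_n -> K) y, nv i (\sum_j A i k j * iota i (x j) - iota i y) =
     Normc.normc (\sum_j co j * sigma i (x j) - sigma i y)) /\
    (dv i = 1%N -> forall j, complex.Im (co j) = 0).
  case: (boolP (arch i)) => [ai|_]; last by exists (fun=> 0).
  by have [co coE] := completion_form_complex Kv_compl st (fun j => A i k j) ai; exists co.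
pose co i k := projT1 (cid (coP i k)); have coE i k := projT2 (cid (coP i k)).
pose B := coordinate_mx t sigma w.
have Bu : B \in unitmx := coordinate_mx_unit st wQ.
(* The matrix of z -> A z at the archimedean places, from integral-basis coordinates to the
   coordinates Re, Im. *)
pose Qm k l : 'M[R]_(\dim {:K}) := \matrix_(r, j) complex_part (t r).2 (co (t r).1 k l * sigma (t r).1 (w j)).
pose av (l : 'I_n + 'I_m) i : R := match l with inl l => nv i (delta i l) | inr k => nv i (eps i k) end.
have av0 l i : 0 < av l i by case: l => l; rewrite /av ?delta0 ?eps0.
(* The search runs over O_K and the result is divided by [q] at the end, so the archimedean radii
   are multiplied by [q]. *)
pose rad (l : 'I_n + 'I_m) i : R := q%:R * av l i.
have qR : 0 < (q%:R : R) by rewrite ltr0n.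
have rad0 l i : 0 < rad l i by rewrite mulr_gt0.
have nm0 : (0 < n + m)%N by rewrite addn_gt0 n_gt0.
have exa : exists i, arch i.
  by exists (t (Ordinal (adim_gt0 {:K}))).1; apply: arch_t.
(* The label bound [cF] is the only inequality used; the rest is the equality assumed in [prod_eq],
   so this is exactly the critical volume. *)
have hvol : `|\det B| ^+ (n + m) * #|F|%:R <= \prod_(l : 'I_n + 'I_m) \prod_(i | arch i) half_volume dv i (rad l i).
  rewrite (half_volume_product (det := \det B) q dv12 dimE av0).
    rewrite ler_wpM2l ?exprn_ge0//; apply: (le_trans cF); rewrite le_eqVlt; apply/orP; left; apply/eqP.
    congr (_ * _); apply: eq_bigr => i nai; rewrite big_sumType /=; congr ((_ * _) ^+ _).
      by apply: eq_bigr => l _; rewrite deE.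
    by apply: eq_bigr => k _; rewrite epE.

  rewrite -(abs_disc_coordinate st w) -DE -prod_eq; apply: eq_bigr => i _.
  by rewrite big_sumType mulrC.
have [X [X' [Y [Y' [e nt hx hy]]]]] := minkowski tinj arch_t arch_fst arch_snd dv12 dimE lab Qm Bu rad0 nm0 exa hvol.
pose zx l := val (X l - X' l); pose zy k := val (Y k - Y' k).
have qK : (q%:R : K) != 0 by rewrite -(ratr_nat K) -alg_num_field scaler_eq0 oner_eq0 orbF pnatr_eq0 -lt0n.
have int_pair (X0 : 'I_n -> 'cV[int]_(\dim {:K})) (Y0 : 'I_m -> 'cV[int]_(\dim {:K})) p (f : K -> R) :
   prime p -> is_padic_place p f ->
   (forall l, f ((val \o X0, val \o Y0).1 l) <= 1) /\ (forall k, f ((val \o X0, val \o Y0).2 k) <= 1).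
  by move=> pp fp; split=> *; apply: val_padic fp.
have [fin1 fin2] := psiP _ _ e (int_pair X Y) (int_pair X' Y').
(* Division by [q] removes |q| from the bounds in S; outside S, differences bounded by |q| become
   integral. *)
pose x l := zx l / q%:R; pose y k := zy k / q%:R.
have x_zx l : x l * q%:R = zx l by rewrite divfK.
have y_zy k : y k * q%:R = zy k by rewrite divfK.
have outside z (f : K -> R) : is_place f -> (forall i, v i <> f) ->
    (forall p, prime p -> is_padic_place p f -> f z <= f q%:R) -> f (z / q%:R) <= 1.
  move=> [fA fP] nf h; case: fP => [fq|[p [pp fp]]].
    by have [i iE] := S_arch f (conj fA fq); case: (nf i).
  rewrite (absvalM fA) (absvalV fA) ler_pdivrMr ?mul1r ?(absval_gt0 fA)//.
  exact: h (conj fA fp).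
have xOS l : in_OS v (x l).
  move=> f fP nf; apply: outside => // p pp fp.
  by have [h _] := fin2 p f pp fp (fun i _ => nf i); have := h l; rewrite /= -valB.
have yOS k : in_OS v (y k).
  move=> f fP nf; apply: outside => // p pp fp.
  by have [_ h] := fin2 p f pp fp (fun i _ => nf i); have := h k; rewrite /= -valB.
have div_bound i z c : v i (z * q%:R) <= v i q%:R * c -> v i z <= c.
  by rewrite (absvalM (vA i)) mulrC ler_pM2l ?(absval_gt0 (vA i)).
have na_x i l : na i -> v i (x l) <= nv i (delta i l).
  move=> nai; have [h _] := fin1 i nai; apply: div_bound.
  rewrite x_zx -deE//; have := h l; rewrite /= -valB.
  exact.
have na_y i k : na i -> nv i (\sum_(j < n) A i k j * iota i (x j) - iota i (y k)) <= nv i (eps i k).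
  move=> nai; have [pp fp] := prE i nai; have [_ h] := fin1 i nai.
  apply: (completion_sum_bound (al := al i k) (Kv_compl i) pp fp (ltW (eps0 i k))) => [l|].
    have := alE i k l; rewrite ltr_pdivlMr// => /ltW; apply: le_trans.
    by rewrite ler_wpM2l ?(absval_ge0 (nA i))// na_x.
  apply: div_bound; rewrite mulrBl mulr_suml y_zy -epE//.
  have := h k; congr (v i (_ - _) <= _); last by rewrite /zy valB.
  by apply: eq_bigr => l _; rewrite -mulrA x_zx /zx valB.
have realE z r : real_mul B z r 0 = complex_part (t r).2 (sigma (t r).1 (val z)).
  rewrite /real_mul !mxE /val rmorph_sum complex_part_sum; apply: eq_bigr => j _.
  by rewrite !mxE rmorphM rmorph_int complex_part_int mulrC.
have formE k l z r : real_mul (Qm k l) z r 0 = complex_part (t r).2 (co (t r).1 k l * sigma (t r).1 (val z)).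
  rewrite /real_mul !mxE /val rmorph_sum mulr_sumr complex_part_sum; apply: eq_bigr => j _.
  by rewrite !mxE rmorphM rmorph_int mulrCA complex_part_int mulrC.
have vC i z : arch i -> v i z = Normc.normc (sigma i z) by move=> ai; have [-> _] := deg i ai.
have vq i : arch i -> Normc.normc (sigma i q%:R) = q%:R.
  move=> ai; rewrite -vC// -(ratr_nat K); have /asboolP[_ ->] := ai.
  by rewrite ratr_nat normr_nat.
have sigma_real i z : arch i -> dv i = 1%N -> complex.Im (sigma i z) = 0.
  by move=> ai d1; have [_ [d2|[_]]] := deg i ai; [rewrite d2 in d1 | apply].
have arch_x i l : arch i -> v i (x l) <= nv i (delta i l).
  move=> ai; apply: div_bound; rewrite x_zx !vC// vq//.
  rewrite -ler_sqr ?nnegrE ?normc_ge0 ?(ltW (rad0 (inl l) i))//.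
  rewrite (normc_pairing st ai); last exact: sigma_real.
  apply: le_trans (hx l i ai); rewrite /fiber_norm le_eqVlt; apply/orP; left; apply/eqP.
  by apply: eq_bigr => r /eqP rE; rewrite realE rE.
have arch_y i k : arch i -> nv i (\sum_(j < n) A i k j * iota i (x j) - iota i (y k)) <= nv i (eps i k).
  move=> ai; have [cE cR] := coE i k ai; rewrite cE.
  have q0R : 0 < Normc.normc (sigma i q%:R) by rewrite vq.
  rewrite -(ler_pM2r q0R) -Normc.normcM mulrBl mulr_suml.
  rewrite -rmorphM y_zy; under eq_bigr do rewrite -mulrA -rmorphM x_zx.
  rewrite vq// mulrC -ler_sqr ?nnegrE ?normc_ge0 ?(ltW (rad0 (inr k) i))//.
  rewrite (normc_pairing st ai); last first.
    move=> d1; rewrite -[LHS]/(complex_part true _) complex_partB complex_part_sum.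
    rewrite [X in _ - X]sigma_real// subr0 big1// => l _ /=.
    have mul0 (a b : R[i]) : complex.Im a = 0 -> complex.Im b = 0 -> complex.Im (a * b) = 0.
      by case: a b => a1 a2 [b1 b2] /= -> ->; rewrite mulr0 mul0r addr0.
    by apply: mul0; [exact: cR | exact: sigma_real].
  apply: le_trans (hy k i ai); rewrite /fiber_norm le_eqVlt; apply/orP; left; apply/eqP.
  apply: eq_bigr => r /eqP rE; rewrite realE complex_partB complex_part_sum rE.
  by congr ((_ - _) ^+ 2); apply: eq_bigr => l _; rewrite formE rE.
exists x, y; split=> //; split=> //; split; last first.
  move=> i; split=> [k|j]; rewrite ?nE; case: (boolP (arch i)) => ai.
  - exact: arch_y.
  - exact: na_y.
  - exact: arch_x.
  - exact: na_x.
apply: contrapT => nx.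
have x0 l : x l = 0 by apply/eqP; apply: contraT => h; case: nx; exists l.
have zx0 l : X l = X' l by apply/subr0_eq/val_eq0; rewrite -/(zx l) -x_zx x0 mul0r.
case: nt => [[l /eqP[]]|[k /eqP[]]]; first exact: zx0.
apply/subr0_eq/val_eq0; rewrite -/(zy k) -y_zy.
(* When [x] vanishes, the inequalities for the linear forms bound [y k] itself, and |eps| < 1 puts
   it below 1 at every place of S. *)
have y_lt1 i : v i (y k) < 1.
  apply: le_lt_trans (eps1 i k); rewrite -nE -(absvalN (nA i)).
  have -> : - iota i (y k) = \sum_j A i k j * iota i (x j) - iota i (y k).
    by rewrite big1 ?sub0r// => j _; rewrite x0 rmorph0 mulr0.
  by case: (boolP (arch i)) => ai; [exact: arch_y | exact: na_y].
suff -> : y k = 0 by rewrite mul0r.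
apply: (integral_small_eq0 ind wZ) => [p f pp fp|r].
  have [[i <-]|nf] := pselect (exists i, v i = f); first exact: ltW.
  apply: yOS => [|i vf]; last by case: nf; exists i.
  by split; [exact: (proj1 fp) | right; exists p; split=> //; exact: (proj2 fp)].
have := y_lt1 (t r).1; rewrite vC// /cabs sE.
by case: ifP; rewrite ?normc_conj.
Qed.
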